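(* Assume that $\mathcal K_{g,h}(\Omega,\Omega')$ is non-empty. Then there exists a unique solution to the obstacle problem in $\mathcal K_{g,h}(\Omega,\Omega')$. Moreover, the solution to the obstacle problem is a weak supersolution to $\mathcal L u=0$ in $\Omega$.
   Context: Fix $s\in(0,1)$, $p\in(1,\infty)$, $\Lambda\ge 1$, and a measurable symmetric kernel $K:\mathbb R^n\times\mathbb R^n\to[0,\infty)$, $K(x,y)=K(y,x)$, with $\Lambda^{-1}\le K(x,y)|x-y|^{n+sp}\le\Lambda$ for a.e. $x,y\in\mathbb R^n$. Write $L(a,b):=|a-b|^{p-2}(a-b)$ for $a,b\in\mathbb R$ (with $L(a,a)=0$). Formally, $\mathcal L u(x)=\mathrm{p.v.}\int_{\mathbb R^n}K(x,y)L(u(x),u(y))\,dy$. For open $U\subset\mathbb R^n$, $W^{s,p}(U)$ is the fractional Sobolev space with norm $\|v\|_{L^p(U)}+\left(\int_U\int_U\frac{|v(x)-v(y)|^p}{|x-y|^{n+sp}}\,dx\,dy\right)^{1/p}$. The tail space is $L^{p-1}_{sp}(\mathbb R^n):=\{f\in L^{p-1}_{\rm loc}(\mathbb R^n):\int_{\mathbb R^n}|f(x)|^{p-1}(1+|x|)^{-n-sp}\,dx<\infty\}$. A function $u\in W^{s,p}_{\rm loc}(\Omega)\cap L^{p-1}_{sp}(\mathbb R^n)$ is a weak supersolution to $\mathcal Lu=0$ in $\Omega$ if $\int_{\mathbb R^n}\int_{\mathbb R^n}L(u(x),u(y))(\eta(x)-\eta(y))K(x,y)\,dx\,dy\ge0$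 for every nonnegative $\eta\in C_0^\infty(\Omega)$. Obstacle problem. Let $\Omega\Subset\Omega'$ be open bounded subsets of $\mathbb R^n$, let $h:\mathbb R^n\to[-\infty,\infty)$ be an extended real-valued function (the obstacle), and let $g\in W^{s,p}(\Omega')\cap L^{p-1}_{sp}(\mathbb R^n)$ (the boundary values). Define $$\mathcal K_{g,h}(\Omega,\Omega'):=\{u\in W^{s,p}(\Omega'): u\ge h\text{ a.e. in }\Omega,\ u=g\text{ a.e. on }\mathbb R^n\setminus\Omega\}$$ (functions defined on $\mathbb R^n$, identified when equal a.e.). For $u\in\mathcal K_{g,h}(\Omega,\Omega')$ and $v\in W^{s,p}(\Omega')$ let $$\mathcal Au(v):=\int_{\Omega'}\int_{\Omega'}L(u(x),u(y))(v(x)-v(y))K(x,y)\,dx\,dy+2\int_{\mathbb R^n\setminus\Omega'}\int_\Omega L(u(x),g(y))v(x)K(x,y)\,dx\,dy,$$ where in the second term $x\in\Omega$ and $y\in\mathbb R^n\setminus\Omega'$. A function $u\in\mathcal K_{g,h}(\Omega,\Omega')$ is a solution to the obstacle problem in $\mathcal K_{g,h}(\Omega,\Omega')$ if $\mathcal Au(v-u)\ge0$ whenever $v\in\mathcal K_{g,h}(\Omega,\Omega')$. *)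

(* Defs.v *)
From HB Require Import structures.
From mathcomp Require Import all_boot all_order all_algebra.
From mathcomp Require Import all_classical all_reals all_analysis.
From mathcomp Require Import measurable_realfun.

Set Implicit Arguments.
Unset Strict Implicit.
Unset Printing Implicit Defensive.

Import Order.TTheory GRing.Theory Num.Theory.
Import numFieldNormedType.Exports.

Local Open Scope classical_set_scope.
Local Open Scope ring_scope.

Definition rV_display : measure_display.
Proof. exact: default_measure_display. Qed.

Section measurable_rV.
Context {R : realType} (n : nat).

Let coors : 'I_n -> 'rV[R]_n -> measurableTypeR R := fun i v => v ord0 i.

Let rV_set0 : g_sigma_preimage coors set0.
Proof. exact: sigma_algebra0. Qed.

Let rV_setC A : g_sigma_preimage coors A -> g_sigma_preimage coors (~` A).
Proof. exact: sigma_algebraC. Qed.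

Let rV_bigcup (F : _^nat) : (forall i, g_sigma_preimage coors (F i)) ->
  g_sigma_preimage coors (\bigcup_i (F i)).
Proof. exact: sigma_algebra_bigcup. Qed.

(* The product sigma-algebra, i.e. the Borel sigma-algebra of R^n. *)
HB.instance Definition _ := @isMeasurable.Build rV_display
  'rV[R]_n (g_sigma_preimage coors) rV_set0 rV_setC rV_bigcup.

End measurable_rV.

Section measurable_rV_lemmas.
Context {R : realType}.

Lemma measurable_coord n (i : 'I_n) :
  measurable_fun [set: 'rV[R]_n] (fun v => v ord0 i : measurableTypeR R).
Proof.
move=> _ Y mY; rewrite setTI; apply: sub_sigma_algebra => /=.
rewrite -bigcup_seq/=; exists i => /=; first by rewrite mem_index_enum.
by exists Y => //; rewrite setTI.
Qed.

Lemma measurable_fun_rVP d (T : measurableType d) n (f : T -> 'rV[R]_n) :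
  (forall i, measurable_fun [set: T] (fun x => f x ord0 i : measurableTypeR R))
  -> measurable_fun [set: T] f.
Proof.
move=> mf _ A mA; rewrite setTI.
have sub : g_sigma_preimage
    (fun (i : 'I_n) (v : 'rV[R]_n) => v ord0 i : measurableTypeR R)
    `<=` [set B | measurable (f @^-1` B)].
  apply: smallest_sub.
    split.
    - by rewrite /= preimage_set0.
    - by move=> B mB; rewrite /= setTD preimage_setC; exact: measurableC.
    - by move=> F mF /=; rewrite preimage_bigcup; exact: bigcupT_measurable.
  rewrite -bigcup_seq => B [i _] [Y mY <-] /=.
  by rewrite setTI -[X in measurable X]setTI; exact: mf.
exact: sub.
Qed.

Definition rV_cons n (p : measurableTypeR R * 'rV[R]_n) : 'rV[R]_n.+1 :=
  \row_i if unlift ord0 i is Some j then p.2 ord0 j else p.1.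

Definition rV_uncons n (v : 'rV[R]_n.+1) : measurableTypeR R * 'rV[R]_n :=
  (v ord0 ord0, \row_j v ord0 (lift ord0 j)).

Lemma rV_consK n : cancel (@rV_cons n) (@rV_uncons n).
Proof.
case=> x v; rewrite /rV_uncons /rV_cons mxE unlift_none; congr (_, _).
by apply/rowP => j; rewrite !mxE liftK.
Qed.

Lemma rV_unconsK n : cancel (@rV_uncons n) (@rV_cons n).
Proof.
move=> v; apply/rowP => i; rewrite mxE.
by case: unliftP => [j ->|->] //=; rewrite mxE.
Qed.

Lemma measurable_rV_cons n :
  measurable_fun setT (@rV_cons n).
Proof.
apply: measurable_fun_rVP => i; rewrite /rV_cons.
under eq_fun do rewrite mxE.
case: unliftP => [j _|_]; last exact: measurable_fst.
exact: (measurableT_comp (measurable_coord j) measurable_snd).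
Qed.

Lemma measurable_rV_uncons n : measurable_fun setT (@rV_uncons n).
Proof.
apply/measurable_fun_pairP; split; first exact: measurable_coord.
apply: measurable_fun_rVP => j /=.
under eq_fun do rewrite mxE.
exact: measurable_coord.
Qed.

End measurable_rV_lemmas.

Section lebesgue_rV.
Context {R : realType}.

Section step.
Context {n : nat} (mu : {sigma_finite_measure set 'rV[R]_n -> \bar R}).

Definition lebesgue_rV_step : set 'rV[R]_n.+1 -> \bar R :=
  pushforward (lebesgue_measure \x mu)%E (@rV_cons R n).

HB.instance Definition _ := Measure.copy lebesgue_rV_step
  (measure_function_pushforward__canonical__measure_function_Measure
    (lebesgue_measure \x mu)%E (@measurable_rV_cons R n)).


Let lebesgue_rV_step_sigma_finite : sigma_finite setT lebesgue_rV_step.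
Proof.
have /sigma_finiteP[F [TF ndF Foo]] := sigma_finiteT (@lebesgue_measure R).
have /sigma_finiteP[G [TG ndG Goo]] := sigma_finiteT mu.
exists (fun k => @rV_uncons R n @^-1` (F k `*` G k)).
  rewrite -preimage_bigcup (_ : \bigcup_k _ = setT) ?preimage_setT//.
  apply/seteqP; split => // -[x y] _.
  have [i _ Fix] : (\bigcup_k F k) x by rewrite -TF.
  have [j _ Gjy] : (\bigcup_k G k) y by rewrite -TG.
  exists (maxn i j) => //; split => /=.
  - by move: x Fix; exact/subsetPset/ndF/leq_maxl.
  - by move: y Gjy; exact/subsetPset/ndG/leq_maxr.
move=> k; have [mF Fkoo] := Foo k; have [mG Gkoo] := Goo k; split.
  rewrite -[X in measurable X]setTI.
  by apply: measurable_rV_uncons => //; exact: measurableX.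
rewrite /lebesgue_rV_step /pushforward -comp_preimage.
rewrite (_ : _ \o _ = id) ?preimage_id; last by apply/funext; exact: rV_consK.
by rewrite product_measure1E// lte_mul_pinfty// ge0_fin_numE.
Qed.

HB.instance Definition _ := @Measure_isSigmaFinite.Build _ _ _
  lebesgue_rV_step lebesgue_rV_step_sigma_finite.

End step.

(* Lebesgue measure on R^n, as an iterated product of lebesgue_measure; the
   lemma lebesgue_rV_box gives its value on boxes, which determines it. *)
Fixpoint lebesgue_rV n : {sigma_finite_measure set 'rV[R]_n -> \bar R} :=
  if n is m.+1 then lebesgue_rV_step (lebesgue_rV m) else \d_(0 : 'rV[R]_0).

Lemma lebesgue_rV_box n (a b : 'rV[R]_n) :
  (forall i, a ord0 i <= b ord0 i) ->
  lebesgue_rV n [set v | forall i, v ord0 i \in `]a ord0 i, b ord0 i]]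
  = (\prod_i (b ord0 i - a ord0 i))%:E.
Proof.
elim: n a b => [|n IHn] a b ab.
  rewrite big_ord0 /= diracE mem_set//= => i; by case: i.
pose tl (v : 'rV[R]_n.+1) := (rV_uncons v).2.
pose A : set (measurableTypeR R) := `]a ord0 ord0, b ord0 ord0]%classic.
pose B := [set v : 'rV[R]_n |
  forall i, v ord0 i \in `]tl a ord0 i, tl b ord0 i]].
have AB : @rV_cons R n @^-1`
    [set v | forall i, v ord0 i \in `]a ord0 i, b ord0 i]] = A `*` B.
  apply/seteqP; split => [[x v] /= H|[x v] /= [xab H] i].
  - split; first by have := H ord0; rewrite /rV_cons mxE unlift_none.
    by move=> i; have := H (lift ord0 i); rewrite /rV_cons !mxE liftK.
  - rewrite /rV_cons mxE; case: unliftP => [j ->|->] //=.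
    by have := H j; rewrite !mxE.
have mB : measurable B.
  rewrite [X in measurable X](_ : _ = \bigcap_(i in [set: 'I_n])
      ((fun v : 'rV[R]_n => v ord0 i : measurableTypeR R) @^-1`
       `]tl a ord0 i, tl b ord0 i]%classic)); last first.
    by apply/seteqP; split => v /= H i => [_|]; exact: H.
  apply: fin_bigcap_measurable => // i _.
  by rewrite -[X in measurable X]setTI; apply: measurable_coord.
rewrite -[LHS]/((lebesgue_measure \x lebesgue_rV n)%E (@rV_cons R n @^-1`
  [set v | forall i, v ord0 i \in `]a ord0 i, b ord0 i]])).
rewrite AB product_measure1E//; last exact: measurable_itv.
rewrite /B IHn; last by move=> i; rewrite !mxE.
rewrite big_ord_recl EFinM.
congr (_ * _)%E; last by congr EFin; apply: eq_bigr => i _; rewrite !mxE.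
apply: (etrans (lebesgue_measure_itv `]a ord0 ord0, b ord0 ord0])).
rewrite /= lte_fin.
have := ab ord0; rewrite le_eqVlt => /predU1P[->|->]; last by rewrite EFinB.
by rewrite ltxx subrr.
Qed.

End lebesgue_rV.
Arguments lebesgue_rV {R n}.

(* For mu = lebesgue_rV, this is Lebesgue measurability of f on D. Such an f
   agrees mu-a.e. on D with a Borel function, and its library integral, built
   on Borel simple functions, is the integral of any such representative. *)
Definition completed_measurable_fun d (T : measurableType d) (R : realType)
    (mu : set T -> \bar R) (D : set T) (f : T -> R) : Prop :=
  forall Y : set (measurableTypeR R), measurable Y ->
    completed_algebra_gen mu (D `&` f @^-1` Y).

Section fractional_sobolev.
Context {R : realType} {n : nat}.
Local Notation Rn := 'rV[R]_n.
Local Notation mu := (@lebesgue_rV R n).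

(* The norm of 'rV[R]_n in the library is the maximum norm. *)
Definition euclidean_norm (x : Rn) : R := Num.sqrt (\sum_i x ord0 i ^+ 2).

Definition compactly_contained (U V : set Rn) : Prop :=
  compact (closure U) /\ closure U `<=` V.

Definition iter_partial (l : seq 'I_n) (f : Rn -> R) : Rn -> R :=
  foldr (fun i g => 'D_(delta_mx ord0 i : Rn) g) f l.

Definition smooth (f : Rn -> R) : Prop :=
  forall l : seq 'I_n, continuous (iter_partial l f) /\
    forall (i : 'I_n) (x : Rn),
      derivable (iter_partial l f) x (delta_mx ord0 i).

Definition test_function (U : set Rn) (eta : Rn -> R) : Prop :=
  smooth eta /\
  let supp := closure [set x | eta x != 0] in compact supp /\ supp `<=` U.

Variables s p : R.

Definition Wsp_norm (U : set Rn) (v : Rn -> R) : \bar R :=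
  ((\int[mu]_(x in U) (`|v x| `^ p)%:E) `^ p^-1
   + (\int[mu \x mu]_(z in U `*` U)
        (`|v z.1 - v z.2| `^ p
         / euclidean_norm (z.1 - z.2) `^ (n%:R + s * p))%:E) `^ p^-1)%E.

Definition Wsp (U : set Rn) (v : Rn -> R) : Prop :=
  completed_measurable_fun mu U v /\ (Wsp_norm U v < +oo)%E.

Definition Wsp_loc (U : set Rn) (v : Rn -> R) : Prop :=
  forall V, open V -> compactly_contained V U -> Wsp V v.

Definition tail_space (f : Rn -> R) : Prop :=
  [/\ completed_measurable_fun mu setT f,
      forall C, compact C ->
        (\int[mu]_(x in C) (`|f x| `^ (p - 1))%:E < +oo)%E &
      (\int[mu]_x (`|f x| `^ (p - 1)
        * (1 + euclidean_norm x) `^ (- n%:R - s * p))%:E < +oo)%E].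

Definition L (a b : R) : R := `|a - b| `^ (p - 2) * (a - b).

Variable K : Rn -> Rn -> R.

Definition weak_supersolution (Om : set Rn) (u : Rn -> R) : Prop :=
  [/\ Wsp_loc Om u, tail_space u &
      forall eta, test_function Om eta -> (forall x, 0 <= eta x) ->
        (0 <= \int[mu \x mu]_z
           (L (u z.1) (u z.2) * (eta z.1 - eta z.2) * K z.1 z.2)%:E)%E].

Variables (Om Om' : set Rn) (g : Rn -> R) (h : Rn -> \bar R).

Definition obstacle_class (u : Rn -> R) : Prop :=
  [/\ Wsp Om' u,
      {ae mu, forall x, Om x -> (h x <= (u x)%:E)%E} &
      {ae mu, forall x, ~ Om x -> u x = g x}].

Definition obstacle_form (u v : Rn -> R) : \bar R :=
  (\int[mu \x mu]_(z in Om' `*` Om')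
     (L (u z.1) (u z.2) * (v z.1 - v z.2) * K z.1 z.2)%:E
   + 2%:E * \int[mu \x mu]_(z in Om `*` ~` Om')
     (L (u z.1) (g z.2) * v z.1 * K z.1 z.2)%:E)%E.

Definition obstacle_solution (u : Rn -> R) : Prop :=
  obstacle_class u /\
  forall v, obstacle_class v -> (0 <= obstacle_form u (v \- u)%R)%E.

End fractional_sobolev.

(* Main.v *)
Require Import Defs.
From mathcomp Require Import all_boot all_order all_algebra.
From mathcomp Require Import all_classical all_reals all_analysis.
From mathcomp Require Import measurable_realfun.
From mathcomp Require Import ring lra.

Set Implicit Arguments.
Unset Strict Implicit.
Unset Printing Implicit Defensive.

Import Order.TTheory GRing.Theory Num.Theory.
Import numFieldNormedType.Exports.

Local Open Scope classical_set_scope.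
Local Open Scope ring_scope.


(** Fix one member [w] of the obstacle class. Every other member is [w + f] with [f] vanishing
    outside [Om], so the problem lives on a convex set of corrections [f]. Let [D u (x, y)] be
    [u x - u y] and let [W] be the kernel on [Om' * Om'], twice the kernel on [Om * ~` Om'], and 0
    elsewhere. Because corrections vanish outside [Om], the form [A u (psi)] is the integral of
    [W * dpow p (D u) * D psi], where [dpow p a] is [|a|^(p-2) a] ([formE]). Up to the factor [p]
    this is the derivative of the convex functional
      [J f = \int W * (|D (w + f)|^p - |D w|^p)].
    Subtracting [|D w|^p] is essential: outside [Om'] the boundary values are only known to have a
    finite tail of order [p - 1], so [W |D w|^p] alone need not be integrable, whereas the increment
    is controlled by [|D w|^(p-1) |D f| + |D f|^p] ([powR_incr_le], [moment_bound]).

    Existence is the direct method. The functional is coercive, and the uniform convexity of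
    [|.|^p], in a form that tolerates the non-integrable part [D w] ([midgap_shifted]), makes every
    minimising sequence Cauchy. The energy space is complete ([energy_complete]): a Poincare
    inequality ([poincare]) yields convergence of the corrections themselves, almost everywhere
    along a subsequence, which also carries the obstacle condition to the limit. Convexity and
    dominated convergence turn minimality into the variational inequality. This argument only sees
    the functions [W^(1/p) D f] in an [L^p] space, so it is carried out for a general measure
    ([monotone_variational_inequality]).

    Uniqueness is strict monotonicity of [dpow p]: two solutions have the same differences almost
    everywhere for the weight [W], and the Poincare inequality makes them equal.

    For the supersolution property take the competitor [u + eta] with a nonnegative test function
    [eta]; it has finite energy because [eta] is Lipschitz and [s < 1]. By symmetry of the kernel,
    the integral over all pairs folds onto the two blocks where [W] lives and is [A u (eta)]
    ([pairing_whole]).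

    Functions in the statement are Lebesgue measurable, while integrals and Fubini want Borel
    functions; each Sobolev function and the kernel are therefore replaced by Borel
    representatives. *)

(** * The signed power *)

Section signed_power.
Context {R : realType} (p : R).
Hypothesis p1 : 1 < p.

Definition dpow (a : R) : R := `|a| `^ (p - 2) * a.

Lemma L_dpow a b : L p a b = dpow (a - b). Proof. by []. Qed.

Let p0 : 0 < p. Proof. by rewrite (lt_trans _ p1). Qed.
Let pB0 : 0 < p - 1. Proof. by rewrite subr_gt0. Qed.

Lemma powRS (a : R) : 0 <= a -> a `^ p = a `^ (p - 1) * a.
Proof. by move=> a0; rewrite mulrC mulr_powRB1. Qed.

Lemma dpow_sg a : dpow a = Num.sg a * `|a| `^ (p - 1).
Proof.
have [->|a0] := eqVneq a 0; first by rewrite /dpow mulr0 sgr0 mul0r.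
have -> : p - 1 = (p - 2) + 1 by lra.
rewrite /dpow [in RHS]powRD; last by rewrite normr_eq0 a0 implybT.
by rewrite (powRr1 (normr_ge0 a)) mulrCA -numEsg.
Qed.

Lemma normr_dpow a : `|dpow a| = `|a| `^ (p - 1).
Proof.
have [->|a0] := eqVneq a 0.
  by rewrite /dpow mulr0 !normr0 powR0// gt_eqF.
by rewrite dpow_sg normrM normr_sg a0 mul1r ger0_norm// powR_ge0.
Qed.

Lemma dpow_mul a : dpow a * a = `|a| `^ p.
Proof. by rewrite dpow_sg powRS// -[X in _ = _ * X]/(`|a|) mulrAC -normrEsg mulrC. Qed.

Lemma dpowN a : dpow (- a) = - dpow a.
Proof. by rewrite /dpow normrN mulrN. Qed.

Lemma dpow_homo c a b : 0 <= c -> dpow (c * a) * (c * b) = c `^ p * (dpow a * b).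
Proof.
move=> c0; have [->|cn0] := eqVneq c 0.
  by rewrite !mul0r powR0 ?mulr0 ?mul0r// gt_eqF.
have -> : c `^ p = c `^ (p - 2) * c ^+ 2.
  rewrite -powR_mulrn// -powRD; first by congr (_ `^ _); lra.
  by rewrite cn0 implybT.
rewrite /dpow normrM (ger0_norm c0) powRM//.
ring.
Qed.

Lemma dpow_lt : {homo dpow : a b / a < b}.
Proof.
move=> a b ab; rewrite !dpow_sg.
have mon : forall x y : R, 0 <= x -> x < y -> x `^ (p - 1) < y `^ (p - 1).
  move=> x y x0 xy; apply: gt0_ltr_powR => //; rewrite nnegrE//.
  exact: le_trans (ltW xy).
have [a0|a0|a0] := ltrgt0P a; have [b0|b0|b0] := ltrgt0P b; try lra.
- by rewrite !gtr0_sg// !mul1r mon// ltW.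
- by rewrite ltr0_sg// gtr0_sg// mul1r mulN1r ltrNl (lt_le_trans _ (powR_ge0 _ _))// oppr_lt0 powR_gt0// oppr_gt0.
- by rewrite !ltr0_sg// !mulN1r ltrN2 mon//; lra.
- by rewrite b0 sgr0 mul0r ltr0_sg// mulN1r oppr_lt0 powR_gt0// oppr_gt0.
- by rewrite a0 sgr0 mul0r gtr0_sg// mul1r powR_gt0.
Qed.

Lemma dpow_monotone a b : 0 <= (dpow a - dpow b) * (a - b).
Proof.
have [ab|ab|->] := ltgtP a b; last by rewrite !subrr mulr0.
- by have := dpow_lt ab => ?; rewrite nmulr_rge0; lra.
- by have := dpow_lt ab => ?; rewrite mulr_ge0//; lra.
Qed.

Lemma dpow_monotone_eq0 a b : (dpow a - dpow b) * (a - b) = 0 -> a = b.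
Proof.
move=> /eqP; rewrite mulf_eq0 !subr_eq0 => /orP[|/eqP//].
by have [ab|ab|->//] := ltgtP a b; have := dpow_lt ab; lra.
Qed.

(** Young's inequality for the exponents [p / (p - 1)] and [p] is exactly the statement that the
    graph of [|.|^p] lies above its tangent at [a]. *)
Lemma powR_tangent a b :
  `|a| `^ p + p * dpow a * (b - a) <= `|b| `^ p.
Proof.
have -> : `|a| `^ p + p * dpow a * (b - a) =
    p * (dpow a * b) - (p - 1) * `|a| `^ p by rewrite -dpow_mul; ring.
rewrite lerBlDl -ler_pdivlMl//.
rewrite (le_trans (ler_norm _))// normrM normr_dpow.
have q0 : 0 < p / (p - 1) by rewrite divr_gt0.
have := @conjugate_powR _ (`|a| `^ (p - 1)) `|b| (p / (p - 1)) p
  (powR_ge0 _ _) (normr_ge0 _) q0 p0.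
rewrite -powRrM mulrCA divff ?gt_eqF// mulr1.
move=> /(_ _)/le_trans; apply; first by field; rewrite gt_eqF//= gt_eqF.
by rewrite le_eqVlt; apply/orP; left; apply/eqP; field; rewrite gt_eqF//= gt_eqF.
Qed.

Lemma powRD_le q (x y : R) : 0 <= q -> 0 <= x -> 0 <= y ->
  (x + y) `^ q <= 2 `^ q * (x `^ q + y `^ q).
Proof.
move=> q0; wlog xy : x y / x <= y => [H x0 y0|x0 y0].
  have [/H|/ltW/H] := leP x y; first exact.
  by rewrite addrC (addrC (_ `^ q)); exact.
apply: (@le_trans _ _ ((2 * y) `^ q)).
  by apply: ge0_ler_powR => //; rewrite ?nnegrE; lra.
by rewrite powRM// ler_wpM2l ?powR_ge0// lerDr powR_ge0.
Qed.

Lemma powR_normD q (x y : R) : 0 <= q ->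
  `|x + y| `^ q <= 2 `^ q * (`|x| `^ q + `|y| `^ q).
Proof.
move=> q0; apply: le_trans (powRD_le _ _ _) => //.
by apply: (ge0_ler_powR q0); rewrite ?nnegrE ?ler_normD ?addr_ge0.
Qed.

(** The larger of [a] and [x] carries the product. *)
Lemma young_crude (a x : R) : 0 <= a -> 0 <= x ->
  a `^ (p - 1) * x <= a `^ p + x `^ p.
Proof.
move=> a0 x0; rewrite !powRS//.
have := powR_ge0 a (p - 1); have := powR_ge0 x (p - 1) => h1 h2.
have [ax|xa] := leP a x.
  have h : a `^ (p - 1) <= x `^ (p - 1).
    by apply: ge0_ler_powR => //; rewrite ?nnegrE// ltW.
  nra.
nra.
Qed.

(** Comparing the tangents at [a] and at [a + x] leaves no [p]-th power of [a] on the right: the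
    increment can be integrable where [|a|^p] is not. *)
Lemma powR_incr_le (a x : R) :
  `| `|a + x| `^ p - `|a| `^ p| <=
  p * (2 `^ (p - 1) + 1) * (`|a| `^ (p - 1) * `|x| + `|x| `^ p).
Proof.
have t1 := powR_tangent a (a + x).
have t2 := powR_tangent (a + x) a.
have e1 : `|dpow a * x| = `|a| `^ (p - 1) * `|x| by rewrite normrM normr_dpow.
have e2 : `|dpow (a + x) * x| <= 2 `^ (p - 1) * (`|a| `^ (p - 1) + `|x| `^ (p - 1)) * `|x|.
  rewrite normrM normr_dpow ler_wpM2r//.
  exact/powR_normD/ltW.
rewrite (powRS (normr_ge0 x)).
move: e1 e2 t1 t2.
have := normr_ge0 x; have := powR_ge0 `|a| (p - 1); have := powR_ge0 `|x| (p - 1).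
have := powR_ge0 2 (p - 1).
set A := `|a| `^ _; set X := `|x| `^ (p - 1); set T := 2 `^ _; set y := `|x|.
move=> T0 X0 A0 y0 e1 e2 t1 t2.
have := ler_norm (- (dpow a * x)); have := ler_norm (dpow (a + x) * x).
rewrite normrN e1 => n2 n1.
have Ay : 0 <= A * y by rewrite mulr_ge0.
have Xy : 0 <= X * y by rewrite mulr_ge0.
have TAy : 0 <= T * (A * y) by rewrite mulr_ge0.
have TXy : 0 <= T * (X * y) by rewrite mulr_ge0.
have k1 : p * (dpow (a + x) * x) <= p * (T * (A + X) * y).
  by rewrite ler_pM2l// (le_trans n2).
have k2 : p * - (dpow a * x) <= p * (A * y) by rewrite ler_pM2l.
have k3 : 0 <= p * (A * y + X * y) by rewrite mulr_ge0 ?(ltW p0)// addr_ge0.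
have k4 : 0 <= p * (T * (A * y) + T * (X * y)) by rewrite mulr_ge0 ?(ltW p0)// addr_ge0.
have k5 : 0 <= p * (X * y) by rewrite mulr_ge0// ltW.
rewrite ler_norml; apply/andP; split; nra.
Qed.

(** Where [|a| <= |x|] the triangle inequality recovers [|x|^p]; where [|x| < |a|] the term
    [|a|^(p-1) |x|] dominates it. As in the upper bound, [|a|^p] does not occur alone. *)
Lemma powR_incr_coercive (a x : R) :
  2 `^ (- p) * `|x| `^ p - (p + 2) * (`|a| `^ (p - 1) * `|x|) <=
  `|a + x| `^ p - `|a| `^ p.
Proof.
have T0 : 0 < 2 `^ (- p) :> R by rewrite powR_gt0.
have T1 : 2 `^ (- p) <= 1 :> R.
  by rewrite -[leRHS](powRr0 2) ler_powR// ?ler1n// oppr_le0 ltW.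
have TT : 2 `^ (- p) * 2 `^ p = 1 :> R.
  by rewrite -powRD ?addNr ?powRr0// pnatr_eq0 implybT.
have [ax|xa] := leP `|a| `|x|.
  have : `|x| `^ p <= 2 `^ p * (`|a + x| `^ p + `|a| `^ p).
    rewrite -[X in `|X|](addKr a) addrC -(normrN a).
    exact/powR_normD/ltW.
  move=> /(ler_wpM2l (ltW T0)); rewrite [leRHS]mulrA TT mul1r.
  have : `|a| `^ p <= `|a| `^ (p - 1) * `|x| by rewrite powRS// ler_wpM2l// powR_ge0.
  have := powR_ge0 `|a| p => h0 h1 h2.
  have : 0 <= p * (`|a| `^ (p - 1) * `|x|) by rewrite !mulr_ge0 ?powR_ge0// ltW.
  nra.
have t1 := powR_tangent a (a + x).
have := ler_norm (- (dpow a * x)); rewrite normrN normrM normr_dpow => n1.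
have xp : `|x| `^ p <= `|a| `^ (p - 1) * `|x|.
  by rewrite powRS// ler_wpM2r// ge0_ler_powR// ?nnegrE// ltW.
have : p * - (dpow a * x) <= p * (`|a| `^ (p - 1) * `|x|) by rewrite ler_pM2l.
have : 0 <= `|x| `^ p by rewrite powR_ge0.
nra.
Qed.

(** * Uniform convexity of the p-th power *)

(** The deficit in midpoint convexity of [|.|^p]. *)
Definition midgap (s t : R) : R :=
  (`|s| `^ p + `|t| `^ p) / 2 - `|(s + t) / 2| `^ p.

(** The tangent inequalities between [s], [t], their midpoint and the two quarter points add up to
    this bound, which reduces positivity of the deficit to monotonicity of [dpow]. *)
Lemma midgap_ge (s t : R) :
  p / 8 * ((dpow ((3 * s + t) / 4) - dpow ((s + 3 * t) / 4)) * (s - t))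
  <= midgap s t.
Proof.
have a1 := powR_tangent ((3 * s + t) / 4) s.
have a2 := powR_tangent ((s + t) / 2) ((3 * s + t) / 4).
have b1 := powR_tangent ((s + 3 * t) / 4) t.
have b2 := powR_tangent ((s + t) / 2) ((s + 3 * t) / 4).
rewrite /midgap.
rewrite (_ : s - (3 * s + t) / 4 = (s - t) / 4) in a1; last by field.
rewrite (_ : (3 * s + t) / 4 - (s + t) / 2 = (s - t) / 4) in a2; last by field.
rewrite (_ : t - (s + 3 * t) / 4 = - ((s - t) / 4)) in b1; last by field.
rewrite (_ : (s + 3 * t) / 4 - (s + t) / 2 = - ((s - t) / 4)) in b2; last by field.
nra.
Qed.

Lemma midgap_ge0 s t : 0 <= midgap s t.
Proof.
apply: le_trans (midgap_ge _ _).
have -> : s - t = 2 * ((3 * s + t) / 4 - (s + 3 * t) / 4) by field.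
rewrite [X in _ * X](mulrCA _ 2) mulr_ge0// ?divr_ge0// ?(ltW p0)//.
by rewrite mulr_ge0// dpow_monotone.
Qed.

Lemma midgap_gt0 s t : s != t -> 0 < midgap s t.
Proof.
move=> st; rewrite lt_neqAle midgap_ge0 andbT; apply/eqP => e.
have := midgap_ge s t; rewrite -e.
have -> : s - t = 2 * ((3 * s + t) / 4 - (s + 3 * t) / 4) by field.
rewrite [X in _ * X](mulrCA _ 2) mulrA => h.
have : (dpow ((3 * s + t) / 4) - dpow ((s + 3 * t) / 4)) *
   ((3 * s + t) / 4 - (s + 3 * t) / 4) = 0.
  apply/eqP; rewrite eq_le dpow_monotone andbT.
  by move: h; rewrite pmulr_rle0 ?divr_gt0// -mulrA pmulr_rle0.
by move=> /dpow_monotone_eq0 h'; move: st => /eqP; apply; lra.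
Qed.

Lemma midgapC s t : midgap s t = midgap t s.
Proof. by rewrite /midgap (addrC (_ `^ p)) (addrC s). Qed.

Lemma midgap_homo c s t : midgap (c * s) (c * t) = `|c| `^ p * midgap s t.
Proof.
by rewrite /midgap -mulrDr -[in X in _ - X]mulrA !normrM !powRM//; ring.
Qed.

Lemma continuous_powR_norm q : 0 < q -> continuous (fun x : R => `|x| `^ q).
Proof.
move=> q0 x.
have [->|x0] := eqVneq x 0; last first.
  apply: (@continuous_comp _ _ _ (fun x : R => `|x|) (fun y => y `^ q)).
    exact: norm_continuous.
  apply: differentiable_continuous; apply/derivable1_diffP.
  by apply: derivable_powR; rewrite in_itv/= andbT normr_gt0.
apply/cvgrPdist_lt => e e0; rewrite normr0 powR0 ?gt_eqF//.
near=> y; rewrite sub0r normrN ger0_norm ?powR_ge0//.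
have -> : e = (e `^ q^-1) `^ q by rewrite -powRrM mulVf ?gt_eqF// powRr1// ltW.
apply: gt0_ltr_powR => //; rewrite ?nnegrE ?powR_ge0//.
rewrite -[`|y|]/(`|y|) -[y]subr0.
near: y.
have := @cvg_id _ (nbhs (0:R)) => /cvgrPdist_lt/(_ (e `^ q^-1)).
rewrite powR_gt0// => /(_ isT).
by apply: filterS => z /=; rewrite distrC.
Unshelve. all: by end_near. Qed.

Lemma continuous_dpow : continuous dpow.
Proof.
move=> x.
have [->|x0] := eqVneq x 0.
  have := continuous_powR_norm pB0 (x := 0) => h.
  rewrite /continuous_at {2}/dpow mulr0; apply/norm_cvg0P.
  under eq_fun do rewrite normr_dpow.
  by move: h; rewrite /continuous_at normr0 powR0 ?gt_eqF.
apply: cvgM; last exact: cvg_id.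
apply: (@continuous_comp _ _ _ (fun x : R => `|x|) (fun y => y `^ (p - 2))).
  exact: norm_continuous.
apply: differentiable_continuous; apply/derivable1_diffP.
by apply: derivable_powR; rewrite in_itv/= andbT normr_gt0.
Qed.

(** Both sides are homogeneous of degree [p], so [s = 1] and [-1 <= t <= 1] may be assumed. For [t]
    close to 1 the left side is below [e]; on the remaining compact interval the deficit has a
    positive minimum. One argument thus covers [p < 2] and [p >= 2]. *)
Lemma midgap_uniform (e : R) : 0 < e ->
  exists2 C, 0 <= C & forall s t,
    `|s - t| `^ p <= e * (`|s| `^ p + `|t| `^ p) + C * midgap s t.
Proof.
move=> e0.
pose r := Num.min 1 (e `^ p^-1).
have r0 : 0 < r by rewrite /r lt_min ltr01 powR_gt0.
have re : r `^ p <= e.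
  have -> : e = (e `^ p^-1) `^ p by rewrite -powRrM mulVf ?gt_eqF// powRr1// ltW.
  by apply: ge0_ler_powR; rewrite ?nnegrE ?powR_ge0 ?(ltW p0)// ?(ltW r0)// /r ge_min lexx orbT.
have r1 : r <= 1 by rewrite /r ge_min lexx.
have mc : {within `[(-1), 1 - r], continuous (midgap 1)}.
  apply: continuous_subspaceT => x; rewrite /midgap.
  apply: cvgB.
    apply: cvgM; last exact: cvg_cst.
    apply: cvgD; first exact: cvg_cst.
    exact: continuous_powR_norm.
  apply: (@continuous_comp _ _ _ (fun x : R => (1 + x) / 2) (fun y => `|y| `^ p)).
    apply: cvgM; last exact: cvg_cst.
    by apply: cvgD; [exact: cvg_cst|exact: cvg_id].
  exact: continuous_powR_norm.
have [|c cI cmin] := EVT_min _ mc; first by lra.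
have m0 : 0 < midgap 1 c.
  by apply: midgap_gt0; move: cI; rewrite in_itv/=; apply: contraTneq => <-; lra.
exists (2 `^ p / midgap 1 c) => [|s t].
  by rewrite divr_ge0 ?powR_ge0// ltW.
wlog st : s t / `|t| <= `|s| => [H|].
  have [/H//|/ltW/H] := leP `|t| `|s|.
  move=> h; rewrite (distrC s t) (midgapC s t) (addrC (`|s| `^ p)).
  exact: h.
have [s0|s0] := eqVneq s 0.
  move: st; rewrite s0 normr0 normr_le0 => /eqP ->.
  rewrite subrr normr0 powR0 ?gt_eqF//.
  by rewrite addr0 mulr0 add0r mulr_ge0 ?midgap_ge0// divr_ge0 ?powR_ge0 ?ltW.
have key : forall x, -1 <= x <= 1 -> `|1 - x| `^ p <= e + 2 `^ p / midgap 1 c * midgap 1 x.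
  move=> x /andP[x1 x2].
  have [xr|xr] := leP (1 - r) x.
    rewrite (@le_trans _ _ e)//; last first.
      by rewrite lerDl mulr_ge0 ?midgap_ge0// divr_ge0 ?powR_ge0 ?ltW.
    apply: le_trans re; apply: ge0_ler_powR; rewrite ?nnegrE ?(ltW p0) ?(ltW r0)//.
    by rewrite ger0_norm; lra.
  apply: (@le_trans _ _ (2 `^ p)).
    apply: ge0_ler_powR; rewrite ?nnegrE ?(ltW p0)//.
    by rewrite ger0_norm; lra.
  rewrite ler_wpDl ?(ltW e0)// mulrAC ler_pdivlMr// ler_wpM2l ?powR_ge0//.
  by apply: cmin; rewrite in_itv/= x1 ltW.
have := key (t / s) _.
rewrite -ler_norml normf_div ler_pdivrMr ?normr_gt0// mul1r st => /(_ isT).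
move=> /(ler_wpM2l (powR_ge0 `|s| p)).
rewrite -powRM// -normrM mulrBr mulr1 mulrCA divff// mulr1 => h.
apply: le_trans h _.
have -> : midgap s t = `|s| `^ p * midgap 1 (t / s).
  by rewrite -midgap_homo mulr1 mulrCA divff// mulr1.
have := powR_ge0 `|s| p; have := powR_ge0 `|t| p => h1 h2.
rewrite mulrDr mulrCA; apply: lerD => //.
by rewrite mulrC ler_wpM2l ?(ltW e0)// lerDl.
Qed.

(** The common part [a] of the two arguments may be large. If [|a|] is at most a fixed multiple of
    [|x| + |y|], [midgap_uniform] applies; if it is much larger, [|x - y|^p] is itself small
    against [|a|^(p-1) (|x| + |y|)]. *)
Lemma midgap_shifted (e : R) : 0 < e ->
  exists2 C, 0 <= C & forall a x y,
    `|x - y| `^ p <= e * (`|x| `^ p + `|y| `^ p + `|a| `^ (p - 1) * (`|x| + `|y|))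
      + C * midgap (a + x) (a + y).
Proof.
move=> e0.
have [M M0 Me] : exists2 M, 1 <= M & M `^ (1 - p) <= e.
  exists (Num.max 1 (e `^ (1 - p)^-1)); first by rewrite le_max lexx.
  have -> : 1 - p = - (p - 1) by rewrite opprB.
  rewrite powRN invf_ple ?posrE// ?powR_gt0 ?lt_max ?ltr01//.
  have -> : e^-1 = (e `^ (- (p - 1))^-1) `^ (p - 1).
    by rewrite -powRrM invrN mulNr mulVf ?gt_eqF// powR_inv1// ltW.
  apply: ge0_ler_powR; rewrite ?nnegrE ?powR_ge0 ?(ltW pB0)// ?le_max ?lexx ?ler01 ?orbT//.
pose T : R := 2 `^ p.
have T0 : 0 < T by rewrite powR_gt0.
pose e' := e / (T * (2 * M + 1)).
have e'0 : 0 < e' by rewrite divr_gt0// mulr_gt0//; lra.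
have [C C0 HC] := midgap_uniform e'0.
exists C => // a x y.
have := HC (a + x) (a + y).
rewrite (_ : a + x - (a + y) = x - y); last by ring.
have d0 := midgap_ge0 (a + x) (a + y).
have Cd : 0 <= C * midgap (a + x) (a + y) by rewrite mulr_ge0.
move: (powR_ge0 `|x| p) (powR_ge0 `|y| p) (powR_ge0 `|a| (p - 1)) (normr_ge0 x) (normr_ge0 y) (normr_ge0 a).
move=> X0 Y0 A0 x0 y0 a0.
have [aM|Ma] := leP `|a| (M * (`|x| + `|y|)).
  move=> h; apply: le_trans h _; rewrite lerD2r.
  have h1 : `|a + x| `^ p <= T * (`|a| `^ p + `|x| `^ p).
    exact/powR_normD/ltW.
  have h2 : `|a + y| `^ p <= T * (`|a| `^ p + `|y| `^ p).
    exact/powR_normD/ltW.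
  have h3 : `|a| `^ p <= M * (`|a| `^ (p - 1) * (`|x| + `|y|)).
    by rewrite powRS// mulrCA ler_wpM2l.
  have Q0 : 0 <= `|a| `^ (p - 1) * (`|x| + `|y|) by rewrite mulr_ge0// addr_ge0.
  have -> : e = e' * (T * (2 * M + 1)).
    by rewrite /e' divfK// gt_eqF// mulr_gt0//; lra.
  rewrite -mulrA ler_wpM2l ?(ltW e'0)//.
  apply: le_trans (lerD h1 h2) _; rewrite -mulrDr -mulrA ler_wpM2l ?(ltW T0)//.
  set Q := `|a| `^ (p - 1) * _ in h3 Q0 *.
  nra.
move=> _; apply: ler_wpDr => //.
apply: (@le_trans _ _ (e * (`|a| `^ (p - 1) * (`|x| + `|y|)))); last first.
  by rewrite ler_wpM2l ?(ltW e0)// lerDr addr_ge0.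
have s0 : 0 <= `|x| + `|y| by rewrite addr_ge0.
apply: (@le_trans _ _ ((`|x| + `|y|) `^ p)).
  by apply: ge0_ler_powR; rewrite ?nnegrE// ?ler_normB// ltW.
rewrite powRS// mulrA ler_wpM2r//.
have -> : `|x| + `|y| = M^-1 * (M * (`|x| + `|y|)) by rewrite mulrA mulVf ?mul1r//; lra.
rewrite powRM ?invr_ge0 ?mulr_ge0//; try lra.
apply: ler_pM; rewrite ?powR_ge0//.
  apply: le_trans Me; rewrite -powR_inv1; last lra.
  by rewrite -powRrM mulN1r opprB.
by apply: ge0_ler_powR; rewrite ?nnegrE ?mulr_ge0 ?(ltW pB0) ?(ltW Ma)//; lra.
Qed.

(** The parameter [t] distributes Young's inequality between [b] and [x]; taken large, it makes the
    contribution of a fixed [b] small. *)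
Lemma dpow_add_le (a b x t : R) : 0 < t ->
  `|dpow (a + b) * x| <= 2 `^ (p - 1) *
    (`|a| `^ (p - 1) * `|x| + (`|b| `^ p / t + t `^ (p - 1) * `|x| `^ p)).
Proof.
move=> t0.
rewrite normrM normr_dpow.
apply: (@le_trans _ _ (2 `^ (p - 1) * (`|a| `^ (p - 1) + `|b| `^ (p - 1)) * `|x|)).
  rewrite ler_wpM2r//.
  exact/powR_normD/ltW.
rewrite -mulrA ler_wpM2l ?powR_ge0// mulrDl lerD2l.
have := @young_crude `|b| (t * `|x|) (normr_ge0 _) (mulr_ge0 (ltW t0) (normr_ge0 x)).
rewrite powRM ?(ltW t0)// (powRS (ltW t0)) => h.
rewrite -(ler_pM2l t0) mulrCA (le_trans h)// le_eqVlt; apply/orP; left; apply/eqP.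
by field; rewrite gt_eqF.
Qed.

End signed_power.

(** * Real-valued integrals over the whole space *)

Section real_integrals.
Context d (T : measurableType d) (R : realType).
Variable mu : {measure set T -> \bar R}.
Implicit Types f g : T -> R.

Definition Rintegrable f := mu.-integrable setT (EFin \o f).

Lemma Rintegrable_meas f : Rintegrable f -> measurable_fun setT f.
Proof. by move=> /measurable_int/measurable_EFinP. Qed.

Lemma Rintegrable_le f g : measurable_fun setT f -> (forall x, `|f x| <= g x) ->
  Rintegrable g -> Rintegrable f.
Proof.
move=> mf fg; apply: le_integrable => //; first exact/measurable_EFinP.
move=> x _ /=; rewrite lee_fin (le_trans (fg x))// ler_norm//.
Qed.

Lemma RintegrableD f g : Rintegrable f -> Rintegrable g -> Rintegrable (fun x => f x + g x).
Proof. exact: integrableD. Qed.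

Lemma RintegrableB f g : Rintegrable f -> Rintegrable g -> Rintegrable (fun x => f x - g x).
Proof. exact: integrableB. Qed.

Lemma RintegrableZ k f : Rintegrable f -> Rintegrable (fun x => k * f x).
Proof. exact: integrableZl. Qed.

Lemma Rintegrable_norm f : Rintegrable f -> Rintegrable (fun x => `|f x|).
Proof. exact: integrable_norm. Qed.

Lemma Rintegrable0 : Rintegrable (cst 0).
Proof. exact: integrable0. Qed.

Lemma rint_le f g : Rintegrable f -> Rintegrable g -> (forall x, f x <= g x) ->
  \int[mu]_x f x <= \int[mu]_x g x.
Proof. by move=> intf intg fg; apply: le_Rintegral. Qed.

Lemma rintD f g : Rintegrable f -> Rintegrable g ->
  \int[mu]_x (f x + g x) = \int[mu]_x f x + \int[mu]_x g x.
Proof. exact: RintegralD. Qed.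

Lemma rintB f g : Rintegrable f -> Rintegrable g ->
  \int[mu]_x (f x - g x) = \int[mu]_x f x - \int[mu]_x g x.
Proof. exact: RintegralB. Qed.

Lemma rintZ k f : Rintegrable f -> \int[mu]_x (k * f x) = k * \int[mu]_x f x.
Proof. exact: RintegralZl. Qed.

Lemma rint_norm f : Rintegrable f -> `|\int[mu]_x f x| <= \int[mu]_x `|f x|.
Proof. exact: le_normr_Rintegral. Qed.

Lemma rint_ge0 f : (forall x, 0 <= f x) -> 0 <= \int[mu]_x f x.
Proof. by move=> f0; apply: Rintegral_ge0. Qed.

Lemma Rintegrable_ge0P f : measurable_fun setT f -> (forall x, 0 <= f x) ->
  (Rintegrable f <-> (\int[mu]_x (f x)%:E < +oo)%E).
Proof.
move=> mf f0; have e : (\int[mu]_x `|(f x)%:E| = \int[mu]_x (f x)%:E)%E.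
  by apply: eq_integral => x _; rewrite gee0_abs// lee_fin.
split => [/integrableP[_]|fi]; first by rewrite e.
by apply/integrableP; split; [exact/measurable_EFinP|rewrite /= e].
Qed.

Lemma measurable_powR_norm f q : measurable_fun setT f ->
  measurable_fun setT (fun x => `|f x| `^ q).
Proof.
move=> mf; apply: (measurableT_comp (measurable_powR q)).
exact: measurableT_comp.
Qed.

End real_integrals.

(** * A variational inequality for the p-energy *)

Section monotone_variational_inequality.
Context d (T : measurableType d) (R : realType).
Variable mu : {measure set T -> \bar R}.
Variable p : R.
Hypothesis p1 : 1 < p.
Variable U0 : T -> R.
Hypothesis mU0 : measurable_fun setT U0.
(** [C] is the set of corrections to a fixed function [U0], which itself may fail to be in
    [L^p]. *)
Variable C : set (T -> R).
Hypothesis mC : forall f, C f -> measurable_fun setT f.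
Hypothesis lpC : forall f, C f -> Rintegrable mu (fun z => `|f z| `^ p).
Hypothesis C0 : C (cst 0).
Hypothesis convC : forall f g t, C f -> C g -> 0 <= t <= 1 ->
  C (fun z => f z + t * (g z - f z)).
Variable A : R.
Hypothesis A0 : 0 <= A.
(** With [t] the inverse of the [L^p] norm of [f - g], the bound reads [2 * A] times that norm: the
    moment against [|U0|^(p-1)] is continuous. The form with a free [t] avoids roots of integrals. *)
Hypothesis growthC : forall f g, C f -> C g ->
  Rintegrable mu (fun z => `|U0 z| `^ (p - 1) * `|f z - g z|) /\
  forall t, 0 < t -> \int[mu]_z (`|U0 z| `^ (p - 1) * `|f z - g z|) <=
    A * (t `^ (p - 1) * \int[mu]_z (`|f z - g z| `^ p) + t^-1).
Hypothesis complC : forall F : nat -> T -> R, (forall k, C (F k)) ->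
  (forall e, 0 < e -> exists N, forall j k, (N <= j)%N -> (N <= k)%N ->
     \int[mu]_z (`|F j z - F k z| `^ p) < e) ->
  exists2 f, C f & forall e, 0 < e -> exists N, forall k, (N <= k)%N ->
     \int[mu]_z (`|F k z - f z| `^ p) < e.

Let p0 : 0 < p. Proof. by rewrite (lt_trans _ p1). Qed.
Let pB0 : 0 < p - 1. Proof. by rewrite subr_gt0. Qed.

Let nrm (f : T -> R) := \int[mu]_z (`|f z| `^ p).
Let mom (f : T -> R) := \int[mu]_z (`|U0 z| `^ (p - 1) * `|f z|).
Let dens (f : T -> R) z := `|U0 z + f z| `^ p - `|U0 z| `^ p.
Let energy f := \int[mu]_z dens f z.

Let mom_itg f : C f -> Rintegrable mu (fun z => `|U0 z| `^ (p - 1) * `|f z|).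
Proof.
move=> Cf; have [+ _] := growthC Cf C0.
by under eq_fun do rewrite subr0.
Qed.

Let mom_le f t : C f -> 0 < t -> mom f <= A * (t `^ (p - 1) * nrm f + t^-1).
Proof.
move=> Cf t0; have [_ /(_ t t0)] := growthC Cf C0.
have -> : (fun z => `|U0 z| `^ (p - 1) * `|f z - cst 0 z|) =
  (fun z => `|U0 z| `^ (p - 1) * `|f z|) by apply/funext => z; rewrite subr0.
by have -> : (fun z => `|f z - cst 0 z| `^ p) = (fun z => `|f z| `^ p)
  by apply/funext => z; rewrite subr0.
Qed.

Let diff_itg f g : C f -> C g -> Rintegrable mu (fun z => `|f z - g z| `^ p).
Proof.
move=> Cf Cg.
apply: (@Rintegrable_le _ _ _ _ _ (fun z => 2 `^ p * (`|f z| `^ p + `|g z| `^ p))).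
- by apply: measurable_powR_norm; apply: measurable_funB; exact: mC.
- move=> z; rewrite ger0_norm ?powR_ge0// -(normrN (g z)).
  exact/powR_normD/ltW.
- by apply: RintegrableZ; apply: RintegrableD; exact: lpC.
Qed.

Let mdens f : C f -> measurable_fun setT (dens f).
Proof.
move=> Cf; apply: measurable_funB; last exact: measurable_powR_norm.
by apply: measurable_powR_norm; apply: measurable_funD => //; exact: mC.
Qed.

Let dens_itg f : C f -> Rintegrable mu (dens f).
Proof.
move=> Cf; apply: Rintegrable_le; [exact: mdens|move=> z; exact: powR_incr_le|].
by apply: RintegrableZ; apply: RintegrableD; [exact: mom_itg|exact: lpC].
Qed.

Let c := 2 `^ (- p) :> R.
Let c0 : 0 < c. Proof. by rewrite powR_gt0. Qed.

(** The moment of [U0] is absorbed by the [p]-th power, up to a constant. *)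
Let energy_ge : exists2 B, 0 <= B & forall f, C f -> c / 2 * nrm f - B <= energy f.
Proof.
pose D := (p + 2) * A.
have D0 : 0 <= D by rewrite mulr_ge0// addr_ge0// ltW.
(* this t gives the moment at most half the coefficient of nrm f *)
pose t := (c / (2 * (D + 1))) `^ (p - 1)^-1.
have q0 : 0 < c / (2 * (D + 1)) by rewrite divr_gt0// mulr_gt0// ltr_wpDl.
have t0 : 0 < t by rewrite powR_gt0.
have tp : t `^ (p - 1) = c / (2 * (D + 1)).
  by rewrite /t -powRrM mulVf ?gt_eqF// powRr1// ltW.
exists (D * t^-1) => [|f Cf]; first by rewrite mulr_ge0// invr_ge0 ltW.
have h1 : c * nrm f - (p + 2) * mom f <= energy f.
  rewrite /nrm /mom -rintZ; last exact: lpC.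
  rewrite -rintZ; last exact: mom_itg.
  rewrite -rintB; [|exact/RintegrableZ/lpC|exact/RintegrableZ/mom_itg].
  apply: rint_le; [|exact: dens_itg|by move=> z; exact: powR_incr_coercive].
  by apply: RintegrableB; [exact/RintegrableZ/lpC|exact/RintegrableZ/mom_itg].
apply: le_trans h1.
have h2 := mom_le Cf t0.
have n0 : 0 <= nrm f by apply: rint_ge0 => z; exact: powR_ge0.
have h3 : (p + 2) * mom f <= D * t `^ (p - 1) * nrm f + D * t^-1.
  rewrite -mulrA -mulrDr /D -(mulrA (p + 2)).
  by rewrite ler_wpM2l// addr_ge0// ltW.
have h4 : D * t `^ (p - 1) * nrm f <= c / 2 * nrm f.
  rewrite ler_wpM2r// tp mulrA ler_pdivrMr ?mulr_gt0// ?ltr_wpDl//.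
  rewrite (_ : c / 2 * (2 * (D + 1)) = D * c + c); last by field.
  by rewrite lerDl ltW.
rewrite (_ : c * nrm f = c / 2 * nrm f + c / 2 * nrm f); last by field.
move: h3 h4; move: (D * t `^ (p - 1) * nrm f) ((p + 2) * mom f) (D / t) (c / 2 * nrm f).
by move=> a1 a2 a3 a4; lra.
Qed.

Let energies := [set energy f | f in C].
Let m := inf energies.

Let energies_inf : has_inf energies.
Proof.
split; first by exists (energy (cst 0)), (cst 0).
have [B _ HB] := energy_ge; exists (- B) => _ [f Cf <-].
have := HB f Cf; have : 0 <= nrm f by apply: rint_ge0 => z; exact: powR_ge0.
move=> n0 h; have : 0 <= c / 2 * nrm f by rewrite mulr_ge0// divr_ge0// ltW.
lra.
Qed.

Let m_le f : C f -> m <= energy f.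
Proof. by move=> Cf; apply: ge_inf; [exact: energies_inf.2|exists f]. Qed.

Let minimizing : exists F : nat -> T -> R,
  forall k, C (F k) /\ energy (F k) < m + k.+1%:R^-1.
Proof.
have h k : exists f, C f /\ energy f < m + k.+1%:R^-1; last by have [F HF] := boolp.choice h; exists F.
have [_ [f Cf <-] fm] := inf_adherent (ltac:(by rewrite invr_gt0): 0 < k.+1%:R^-1) energies_inf.
by exists f.
Qed.

(** The midpoint of [f] and [g] is again a correction, so its energy is at least [m]. *)
Let gap_energy f g : C f -> C g ->
  Rintegrable mu (fun z => midgap p (U0 z + f z) (U0 z + g z)) /\
  \int[mu]_z (midgap p (U0 z + f z) (U0 z + g z)) <=
    (energy f + energy g) / 2 - m.
Proof.
move=> Cf Cg.
have Ch : C (fun z => f z + 2^-1 * (g z - f z)) by apply: convC => //; lra.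
have e z : midgap p (U0 z + f z) (U0 z + g z) =
    2^-1 * (dens f z + dens g z) - dens (fun z => f z + 2^-1 * (g z - f z)) z.
  rewrite /midgap /dens.
  have -> : (U0 z + f z + (U0 z + g z)) / 2 = U0 z + (f z + 2^-1 * (g z - f z)) by field.
  by field.
under eq_fun do rewrite e.
have i1 : Rintegrable mu (fun z => 2^-1 * (dens f z + dens g z)).
  by apply: RintegrableZ; apply: RintegrableD; exact: dens_itg.
split; first by apply: RintegrableB => //; exact: dens_itg.
rewrite rintB//; last exact: dens_itg.
rewrite rintZ; last by apply: RintegrableD; exact: dens_itg.
rewrite rintD; [|exact: dens_itg..].
rewrite mulrC lerD2l lerN2; exact: m_le.
Qed.

(** Corrections of almost minimal energy are close to each other. *)
Let nrm_diff_le B e : 0 < e -> 0 <= B -> exists2 D, 0 <= D &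
  forall f g, C f -> C g -> nrm f <= B -> nrm g <= B ->
    \int[mu]_z (`|f z - g z| `^ p) <= e + D * ((energy f + energy g) / 2 - m).
Proof.
move=> e0 B0.
pose S := 2 * B + 2 * (A * (B + 1)) + 1.
have S0 : 0 < S.
  have := mulr_ge0 A0 (ltac:(lra) : 0 <= B + 1); rewrite /S; lra.
have [D D0 HD] := midgap_shifted p1 (divr_gt0 e0 S0).
exists D => // f g Cf Cg fB gB.
have [ig lg] := gap_energy Cf Cg.
pose rhs z := e / S * (`|f z| `^ p + `|g z| `^ p +
   (`|U0 z| `^ (p - 1) * `|f z| + `|U0 z| `^ (p - 1) * `|g z|)).
have irhs0 : Rintegrable mu (fun z => `|f z| `^ p + `|g z| `^ p).
  by apply: RintegrableD; exact: lpC.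
have irhs1 : Rintegrable mu (fun z => `|U0 z| `^ (p - 1) * `|f z| + `|U0 z| `^ (p - 1) * `|g z|).
  by apply: RintegrableD; exact: mom_itg.
have irhs : Rintegrable mu rhs by apply: RintegrableZ; exact: RintegrableD.
have : \int[mu]_z (`|f z - g z| `^ p) <= \int[mu]_z (rhs z + D * midgap p (U0 z + f z) (U0 z + g z)).
  apply: rint_le; first exact: diff_itg.
    by apply: RintegrableD => //; exact: RintegrableZ.
  by move=> z; rewrite /rhs -mulrDr; exact: HD.
rewrite rintD//; last exact: RintegrableZ.
rewrite (rintZ _ ig).
have -> : \int[mu]_z rhs z = e / S * (nrm f + nrm g + (mom f + mom g)).
  rewrite /rhs rintZ; last exact: RintegrableD.
  rewrite rintD// rintD; [|exact: lpC..].
  by rewrite rintD//; exact: mom_itg.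
move=> h; apply: le_trans h _.
apply: lerD; last by rewrite ler_wpM2l.
have mf := mom_le Cf ltr01; have mg := mom_le Cg ltr01.
rewrite powR1 invr1 mul1r in mf; rewrite powR1 invr1 mul1r in mg.
have mono x y : x <= y -> A * (x + 1) <= A * (y + 1).
  by move=> xy; rewrite ler_wpM2l// lerD2r.
have k1 : mom f <= A * (B + 1) := le_trans mf (mono _ _ fB).
have k2 : mom g <= A * (B + 1) := le_trans mg (mono _ _ gB).
have eS0 : 0 < e / S by rewrite divr_gt0.
rewrite -[leRHS](divfK (lt0r_neq0 S0)) ler_wpM2l ?(ltW eS0)// /S.
rewrite ler_wpDr// (_ : 2 * B + 2 * _ = B + B + (A * (B + 1) + A * (B + 1))); last by ring.
by rewrite !lerD.
Qed.

(** Continuity of the pairing in its second argument, for fixed [f]. *)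
Let pairing f g h t : C f -> C g -> C h -> 0 < t ->
  Rintegrable mu (fun z => dpow p (U0 z + f z) * (g z - h z)) /\
  `|\int[mu]_z (dpow p (U0 z + f z) * (g z - h z))| <=
   2 `^ (p - 1) * ((A + 1) * t `^ (p - 1) * \int[mu]_z (`|g z - h z| `^ p) +
     (A + nrm f) / t).
Proof.
move=> Cf Cg Ch t0.
have [i1 l1] := growthC Cg Ch.
have i2 := lpC Cf; have i3 := diff_itg Cg Ch.
pose rhs z := 2 `^ (p - 1) * (`|U0 z| `^ (p - 1) * `|g z - h z| +
  (t^-1 * `|f z| `^ p + t `^ (p - 1) * `|g z - h z| `^ p)).
have irhs1 : Rintegrable mu (fun z => t^-1 * `|f z| `^ p + t `^ (p - 1) * `|g z - h z| `^ p).
  by apply: RintegrableD; exact: RintegrableZ.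
have irhs : Rintegrable mu rhs by apply: RintegrableZ; exact: RintegrableD.
have ml : measurable_fun setT (fun z => dpow p (U0 z + f z) * (g z - h z)).
  apply: measurable_funM; last by apply: measurable_funB; exact: mC.
  apply: (@measurableT_comp _ _ _ _ _ _ (dpow p)).
    by apply: continuous_measurable_fun; exact: continuous_dpow.
  by apply: measurable_funD => //; exact: mC.
have ll z : `|dpow p (U0 z + f z) * (g z - h z)| <= rhs z.
  by have := dpow_add_le p1 (U0 z) (f z) (g z - h z) t0; rewrite /rhs (mulrC t^-1).
have il := Rintegrable_le ml ll irhs.
split => //.
apply: le_trans (rint_norm il) _.
apply: le_trans (rint_le (Rintegrable_norm il) irhs ll) _.
rewrite /rhs rintZ; last exact: RintegrableD.
rewrite rintD// rintD; [|exact: RintegrableZ..].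
rewrite !rintZ// ler_wpM2l ?powR_ge0//.
have := l1 t t0; rewrite -/(nrm f).
move: (Rintegral _ _ _) (Rintegral _ _ _) (nrm f) (t `^ _) (t^-1) => a2 a1 a3 a4 a5 h1.
rewrite (_ : (A + 1) * a4 * a2 + (A + a3) * a5 = A * (a4 * a2 + a5) + (a5 * a3 + a4 * a2)); last by ring.
by rewrite lerD2r.
Qed.

(** Coercivity bounds a minimising sequence, [nrm_diff_le] makes it Cauchy, and the tangent
    inequality at the limit shows that the energy of the limit does not exceed the infimum. *)
Let minimizer : exists2 f, C f & energy f <= m.
Proof.
have [F HF] := minimizing.
have CF k := (HF k).1.
have mF k := (HF k).2.
have [B' B'0 HB'] := energy_ge.
have inv1 k : k.+1%:R^-1 <= 1 :> R by rewrite invf_le1 ?ler1n.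
pose B := Num.max 0 ((m + 1 + B') / (c / 2)).
have FB k : nrm (F k) <= B.
  rewrite le_max; apply/orP; right.
  rewrite ler_pdivlMr ?divr_gt0// mulrC.
  move: (HB' _ (CF k)) (mF k) (inv1 k).
  move: (c / 2 * nrm (F k)) (energy (F k)) (k.+1%:R^-1) => a1 a2 a3; lra.
have B0 : 0 <= B by rewrite le_max lexx.
have [|f Cf Hf] := complC CF.
  move=> e e0.
  have e2 : 0 < e / 2 by rewrite divr_gt0.
  have [D D0 HD] := nrm_diff_le e2 B0.
  have [N] := @ltr_add_invr R 0 (e / 2 / (D + 1)) (ltac:(by rewrite divr_gt0// ltr_wpDl)).
  rewrite add0r => HN; exists N => j k Nj Nk.
  apply: le_lt_trans (HD _ _ (CF j) (CF k) (FB j) (FB k)) _.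
  have iN i : (N <= i)%N -> i.+1%:R^-1 <= N.+1%:R^-1 :> R.
    by move=> Ni; rewrite lef_pV2 ?posrE// ler_nat ltnS.
  have h : (energy (F j) + energy (F k)) / 2 - m <= N.+1%:R^-1.
    move: (mF j) (mF k) (iN _ Nj) (iN _ Nk).
    move: (energy (F j)) (energy (F k)) (j.+1%:R^-1) (k.+1%:R^-1) (N.+1%:R^-1).
    by move=> a1 a2 a3 a4 a5; lra.
  rewrite [ltRHS](splitr e) ltrD2l.
  apply: le_lt_trans (ler_wpM2l D0 h) _.
  have i0 : 0 < N.+1%:R^-1 :> R by rewrite invr_gt0.
  move: HN; rewrite ltr_pdivlMr ?ltr_wpDl// mulrDr mulr1 mulrC.
  by apply: lt_trans; rewrite ltrDl.
exists f => //.
apply/ler_addgt0Pr => e e0.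
have T0 : 0 < 2 `^ (p - 1) :> R by rewrite powR_gt0.
pose T1 := p * 2 `^ (p - 1).
have T10 : 0 < T1 by rewrite mulr_gt0.
have Af0 : 0 <= A + nrm f.
  by rewrite addr_ge0//; apply: rint_ge0 => z; exact: powR_ge0.
pose q := A + nrm f.
pose t := 3 * T1 * q / e + 1.
have t0 : 0 < t.
  by rewrite /t ltr_wpDl// divr_ge0 ?(ltW e0)// !mulr_ge0// ltW.
have ht : T1 * (q / t) <= e / 3.
  rewrite mulrA ler_pdivrMr// /t (mulrDr (e / 3)) mulr1.
  have -> : e / 3 * (3 * T1 * q / e) = T1 * q.
    by field; rewrite gt_eqF.
  by rewrite lerDl divr_ge0// ltW.
pose s := T1 * ((A + 1) * t `^ (p - 1)).
have s0 : 0 <= s by rewrite mulr_ge0 ?(ltW T10)// mulr_ge0 ?powR_ge0// addr_ge0.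
have [N1 HN1] := Hf (e / 3 / (s + 1)) (ltac:(by rewrite !divr_gt0// ltr_wpDl)).
have [N2] := @ltr_add_invr R 0 (e / 3) (ltac:(by rewrite divr_gt0)).
rewrite add0r => HN2.
pose k := maxn N1 N2.
have hk1 : k.+1%:R^-1 < e / 3.
  apply: le_lt_trans HN2.
  by rewrite lef_pV2 ?posrE// ler_nat ltnS leq_maxr.
have hk2 := HN1 k (leq_maxl _ _).
have [ip lp] := pairing Cf (CF k) Cf t0; rewrite -/q in lp.
have key : energy f + p * \int[mu]_z (dpow p (U0 z + f z) * (F k z - f z)) <= energy (F k).
  rewrite -rintZ// -rintD; [|exact: dens_itg|exact: RintegrableZ].
  apply: rint_le; [|exact: dens_itg|].
    by apply: RintegrableD; [exact: dens_itg|exact: RintegrableZ].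
  move=> z; have := powR_tangent p1 (U0 z + f z) (U0 z + F k z).
  rewrite /dens (_ : U0 z + F k z - (U0 z + f z) = F k z - f z); last by ring.
  lra.
move: key lp; set I := \int[mu]_z (dpow _ _ * _); set Nk := Rintegral _ _ _ => key lp.
have lp2 : - (p * I) <= s * Nk + T1 * (q / t).
  have -> : s * Nk + T1 * (q / t) =
      p * (2 `^ (p - 1) * ((A + 1) * t `^ (p - 1) * Nk + q / t)).
    by rewrite /s /T1; ring.
  rewrite -mulrN ler_pM2l//; apply: le_trans lp.
  by rewrite -normrN ler_norm.
have lp3 : s * Nk <= e / 3.
  move: hk2; rewrite ltr_pdivlMr ?ltr_wpDl// mulrDr mulr1 mulrC => hk2.
  apply: le_trans (ltW hk2); rewrite lerDl.
  by apply: rint_ge0 => z; exact: powR_ge0.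
have := mF k.
move: key hk1 lp2 lp3 ht.
move: (energy f) (energy (F k)) (p * I) (s * _) (T1 * _) (k.+1%:R^-1).
by move=> a1 a2 a3 a4 a5 a6; lra.
Qed.

(** Compare the minimiser [f] with [h k = f + t k * (g - f)]. By convexity the inequality holds with
    [dpow] taken at [h k]; no difference quotient has to be differentiated under the integral, and
    dominated convergence replaces [h k] by [f]. *)
Theorem monotone_variational_inequality : exists2 f, C f & forall g, C g ->
  0 <= \int[mu]_z (dpow p (U0 z + f z) * (g z - f z)).
Proof.
have [f Cf fm] := minimizer.
exists f => // g Cg.
pose t k : R := k.+1%:R^-1.
have t01 k : 0 <= t k <= 1 by rewrite invr_ge0 ler0n invf_le1 ?ler1n.
have t0 k : 0 < t k by rewrite invr_gt0.
pose h k z := f z + t k * (g z - f z).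
have Ch k : C (h k) by exact: convC.
have Ih k : Rintegrable mu (fun z => dpow p (U0 z + h k z) * (g z - f z)).
  by have [] := pairing (Ch k) Cg Cf ltr01.
have pos k : 0 <= \int[mu]_z (dpow p (U0 z + h k z) * (g z - f z)).
  rewrite -(pmulr_rge0 _ (mulr_gt0 p0 (t0 k))) -rintZ//.
  apply: (@le_trans _ _ (energy (h k) - energy f)).
    by rewrite subr_ge0 (le_trans fm)// m_le.
  rewrite /energy -rintB; [|exact: dens_itg..].
  apply: rint_le; [|exact: RintegrableZ|].
    by apply: RintegrableB; exact: dens_itg.
  move=> z; have := powR_tangent p1 (U0 z + h k z) (U0 z + f z).
  rewrite (_ : U0 z + f z - (U0 z + h k z) = - (t k * (g z - f z))); last by rewrite /h; ring.
  by rewrite /dens; lra.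
have [I0 _] := pairing Cf Cg Cf ltr01.
pose G z := 2 `^ (p - 1) * (`|U0 z| `^ (p - 1) * `|g z - f z| +
  (2 `^ p * (`|f z| `^ p + `|g z - f z| `^ p) + `|g z - f z| `^ p)).
have iG : Rintegrable mu G.
  have [i1 _] := growthC Cg Cf.
  apply: RintegrableZ; apply: RintegrableD => //; apply: RintegrableD; last exact: diff_itg.
  by apply: RintegrableZ; apply: RintegrableD; [exact: lpC|exact: diff_itg].
have [] := @dominated_convergence _ T R mu setT measurableT
  (fun k z => (dpow p (U0 z + h k z) * (g z - f z))%:E)
  (fun z => (dpow p (U0 z + f z) * (g z - f z))%:E) (EFin \o G).
- by move=> k; exact: measurable_int (Ih k).
- exact: measurable_int I0.
- apply: aeW => z _; apply: cvg_EFin; first exact: nearW.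
  apply: cvgM; last exact: cvg_cst.
  apply: continuous_cvg; first exact: continuous_dpow.
  rewrite -[X in _ --> X]addr0.
  under eq_fun do rewrite addrA.
  apply: cvgD; first exact: cvg_cst.
  rewrite -[X in _ --> X](mul0r (g z - f z)).
  by apply: cvgM; [exact: cvg_harmonic|exact: cvg_cst].
- exact: iG.
- apply: aeW => z k _; rewrite lee_fin.
  apply: le_trans (dpow_add_le p1 (U0 z) (h k z) (g z - f z) ltr01) _.
  rewrite powR1 divr1 mul1r /G ler_wpM2l ?powR_ge0// lerD2l lerD2r.
  apply: le_trans (powR_normD _ _ (ltW p0)) _.
  rewrite ler_wpM2l ?powR_ge0// lerD2l.
  apply: ge0_ler_powR; rewrite ?nnegrE ?(ltW p0)//.
  by rewrite normrM ger0_norm ?(ltW (t0 k))// ler_piMl//; case/andP: (t01 k).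
move=> _ _ cv; apply: fine_ge0.
apply: (closed_cvg (fun x => (0 <= x)%E)) cv => //; last first.
  apply: nearW => k /=.
  by rewrite -(fineK (integrable_fin_num measurableT (Ih k))) lee_fin; exact: pos.
exact: closed_ereal_le_ereal.
Qed.

End monotone_variational_inequality.

(** * Almost everywhere equality and Lebesgue measurability *)

Section ae_integral.
Context d (T : measurableType d) (R : realType).
Variable mu : {measure set T -> \bar R}.
Local Open Scope ereal_scope.
Import HBNNSimple.

(** The integral of a nonnegative function is a supremum over simple functions below it, and a simple
    function can be cut off on the exceptional null set. Integrands that are only Lebesgue
    measurable, not Borel, are covered in this way. *)
Lemma ae_le_ge0_integral (f g : T -> \bar R) :
  (forall x, 0 <= f x) -> (forall x, 0 <= g x) ->
  {ae mu, forall x, f x <= g x} -> \int[mu]_x f x <= \int[mu]_x g x.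
Proof.
move=> f0 g0 [N [mN N0 fgN]].
rewrite !ge0_integralTE//; apply: ge_ereal_sup => _ [h /= hf <-].
have mCN : measurable (~` N) by exact: measurableC.
pose h' := proj_nnsfun h mCN.
have -> : sintegral mu h = sintegral mu h'.
  have e (k : {nnsfun T >-> R}) : sintegral mu k = \int[mu]_x (k x)%:E.
    by rewrite integral_nnsfun// patch_setT.
  rewrite !e; apply: ge0_ae_eq_integral => //.
  - exact/measurable_EFinP.
  - exact/measurable_EFinP.
  - by move=> x _; rewrite lee_fin.
  - by move=> x _; rewrite lee_fin.
  exists N; split => // x /= /not_implyP[_]; apply: contra_notP => Nx.
  by rewrite mindicE mem_set// mulr1.
apply: ereal_sup_ubound; exists h' => //= x.
rewrite mindicE; have [xN|xN] := boolP (x \in ~` N); last by rewrite mulr0.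
rewrite mulr1; apply: le_trans (hf x) _.
by move: xN; rewrite inE; apply: contra_notP => ?; exact: fgN.
Qed.

Lemma ae_eq_integral_any (f g : T -> \bar R) :
  {ae mu, forall x, f x = g x} -> \int[mu]_x f x = \int[mu]_x g x.
Proof.
move=> fg; rewrite integralE [RHS]integralE.
have h u v : {ae mu, forall x, u x = v x} -> (forall x, 0 <= u x) ->
    (forall x, 0 <= v x) -> \int[mu]_x u x = \int[mu]_x v x.
  move=> uv u0 v0; apply/eqP; rewrite eq_le; apply/andP; split;
    apply: ae_le_ge0_integral => //; apply: filterS uv => x ->//.
congr (_ - _); apply: h => //; apply: filterS fg => x.
- by rewrite !funeposE => ->.
- by rewrite !funenegE => ->.
Qed.

Lemma ae_eq_integral_in D (f g : T -> \bar R) :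
  {ae mu, forall x, D x -> f x = g x} ->
  \int[mu]_(x in D) f x = \int[mu]_(x in D) g x.
Proof.
move=> fg; rewrite integral_mkcond [RHS]integral_mkcond.
apply: ae_eq_integral_any; apply: filterS fg => x fg.
by rewrite /patch; case: ifPn => //; rewrite inE => /fg.
Qed.

End ae_integral.

Section completed.
Context d (T : measurableType d) (R : realType).
Variable mu : {measure set T -> \bar R}.

(** For each rational [q] the set [f < q] is Borel up to a null set. Off the union of these countably
    many null sets, [f] has Borel sublevel sets. *)
Lemma completed_measurable_funP (D : set T) (f : T -> R) :
  completed_measurable_fun mu D f ->
  exists2 g : T -> R, measurable_fun setT g & {ae mu, forall x, D x -> f x = g x}.
Proof.
move=> cf.
have mY (q : rat) : measurable ([set` `]-oo, ratr q[] : set (measurableTypeR R)).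
  exact: measurable_itv.
have h q : exists AN : set T * set T, [/\ measurable AN.1, measurable AN.2, mu AN.2 = 0%E &
    AN.1 `<=` D `&` f @^-1` [set` `]-oo, ratr q[] /\
    D `&` f @^-1` [set` `]-oo, ratr q[] `<=` AN.1 `|` AN.2].
  have [A mA [N [M [mM M0 NM]] AN]] := cf _ (mY q).
  exists (A, M); split => //=; rewrite -AN; split; first exact: subsetUl.
  exact: setUS.
have [F HF] := boolp.choice h.
have [A mA [N [M [mM M0 NM]] AND]] : completed_algebra_gen mu D.
  by have := cf setT measurableT; rewrite preimage_setT setIT.
pose Z := M `|` \bigcup_q (F q).2.
have mZ : measurable Z.
  by apply: measurableU => //; apply: bigcupT_measurable_rat => q; case: (HF q).
have Z0 : mu Z = 0%E.
  apply/negligibleP => //; apply: negligibleU; first exact/negligibleP.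
  rewrite (_ : \bigcup_q (F q).2 =
     \bigcup_n (if @unpickle rat n is Some q then (F q).2 else set0)).
    apply: negligible_bigcup => n; case: unpickle => [q|]; last exact: negligible_set0.
    by have [_ m2 z2 _] := HF q; apply/negligibleP.
  apply/seteqP; split => [x [q _ Fx]|x [n _]].
    by exists (pickle q); [exact: I|rewrite pickleK; exact: Fx].
  by case: unpickle => // q Fx; exists q.
pose E := A `\` Z.
have mE : measurable E by exact: measurableD.
exists (f \_ E); last first.
  exists Z; split => // x /= /not_implyP[Dx]; apply: contra_notP => nZ.
  rewrite patchE ifT// inE; split => //.
  by move: Dx; rewrite -AND => -[//|/NM Mx]; exfalso; apply: nZ; left.
apply/(measurable_restrictT f mE).
apply: (measurability _ (RGenInftyO.measurableE R)) => //.
move=> _ [_ [r ->] <-].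
rewrite [X in measurable X](_ : _ =
  \bigcup_(q in [set q : rat | ratr q <= r]) (E `&` (F q).1)).
  rewrite bigcup_mkcond; apply: bigcupT_measurable_rat => q; case: ifPn => // _.
  by apply: measurableI => //; case: (HF q).
apply/seteqP; split => [x [[Ax nZ]]|x [q /= qr [[Ax nZ] Fx]]].
  rewrite /= in_itv/= => fr.
  have [q] := rat_in_itvoo fr; rewrite in_itv/= => /andP[fq qr].
  exists q; first exact: ltW.
  split => //; have [_ _ _ [_ /(_ x)]] := HF q; case => //=.
    split; first by rewrite -AND; left.
    by rewrite in_itv.
  by move=> F2; exfalso; apply: nZ; right; exists q.
split => //; have [_ _ _ [/(_ _ Fx)[_ /=] + _]] := HF q.
by rewrite !in_itv/= => /lt_le_trans; exact.
Qed.

Lemma ae_measurable_completed (D : set T) (f g : T -> R) :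
  measurable D -> measurable_fun setT g -> {ae mu, forall x, D x -> f x = g x} ->
  completed_measurable_fun mu D f.
Proof.
move=> mD mg [Z [mZ Z0 fgZ]] Y mY.
exists ((D `&` g @^-1` Y) `\` Z).
  apply: measurableD => //; apply: measurableI => //.
  by rewrite -[X in measurable X]setTI; exact: mg.
exists ((D `&` f @^-1` Y) `&` Z).
  by exists Z; split => //; exact: subIsetr.
have fg x : D x -> ~ Z x -> f x = g x.
  by move=> Dx; apply: contra_notP => h; apply: fgZ => /= /(_ Dx).
apply/seteqP; split => x /=.
  by move=> [[[Dx gY] nZ]|[]//]; split => //; rewrite fg.
move=> [Dx fY]; have [Zx|nZ] := pselect (Z x); first by right.
by left; split => //; split => //; rewrite -fg.
Qed.

End completed.

(** * Borel structure of the space of row vectors *)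

Section rV_borel.
Context {R : realType} {n : nat}.
Local Notation Rn := 'rV[R]_n.

Lemma rV_ballE (x v : Rn) e : 0 < e ->
  ball x e v <-> forall i, `|x ord0 i - v ord0 i| < e.
Proof.
by move=> e0; split => [[_ xv] i|xv]; [exact: xv|split => // i j; rewrite ord1; exact: xv].
Qed.

Lemma measurable_rV_ball (x : Rn) e : 0 < e -> measurable (ball x e).
Proof.
move=> e0; have -> : ball x e = \bigcap_(i in [set: 'I_n])
    ((fun v : Rn => v ord0 i : measurableTypeR R) @^-1` (ball (x ord0 i) e)).
  apply/seteqP; split => v /=.
    by move/(rV_ballE _ _ e0) => xv i _; exact: xv.
  by move=> xv; apply/rV_ballE => // i; exact: xv.
apply: fin_bigcap_measurable => // i _.
rewrite -[X in measurable X]setTI; apply: measurable_coord => //.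
exact: measurable_ball.
Qed.

(** The sigma-algebra is generated by the coordinates, and balls of the norm of ['rV_n] are boxes: an
    open set is the union of the countably many rational boxes that it contains. *)
Lemma open_rV_measurable (U : set Rn) : open U -> measurable U.
Proof.
move=> oU.
pose b (a : 'rV[rat]_n * nat) : set Rn := ball (map_mx ratr a.1 : Rn) (a.2.+1%:R^-1).
have -> : U = \bigcup_a (if `[< b a `<=` U >] then b a else set0).
  apply/seteqP; split => [x Ux|x [a _]]; last by case: ifPn => // /asboolP; exact.
  have /nbhs_ballP[e /= e0 xeU] : nbhs x U by exact: open_nbhs_nbhs.
  have [N] := @ltr_add_invr R 0 (e / 2) (ltac:(by rewrite divr_gt0)).
  rewrite add0r => Ne.
  have i0 : 0 < N.+1%:R^-1 :> R by rewrite invr_gt0.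
  have h i : exists q : rat, ball (x ord0 i) N.+1%:R^-1 (ratr q).
    have [q] := rat_in_itvoo (ltac:(by rewrite ltrDl) : x ord0 i < x ord0 i + N.+1%:R^-1).
    rewrite in_itv/= => /andP[h1 h2]; exists q.
    by rewrite /ball/= ltr0_norm ?subr_lt0// opprB ltrBlDl.
  have [f Hf] := boolp.choice h.
  exists (\row_i f i, N) => //.
  have bx : b (\row_i f i, N) x.
    by apply/rV_ballE => // i; rewrite !mxE distrC; exact: Hf.
  rewrite ifT//; apply/asboolP => y By; apply: xeU.
  have -> : e = e / 2 + e / 2 by exact: splitr.
  apply: (@ball_triangle _ _ (map_mx ratr (\row_i f i) : Rn)).
    by apply: le_ball (ltW Ne) _ _; exact: ball_sym.
  exact: le_ball (ltW Ne) _ By.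
apply: countable_bigcupT_measurable => [|a]; first exact: countableP.
by case: ifPn => // _; apply: measurable_rV_ball; rewrite invr_gt0.
Qed.

Lemma closed_rV_measurable (U : set Rn) : closed U -> measurable U.
Proof.
by move=> cU; rewrite -[U]setCK; apply: measurableC; apply: open_rV_measurable; exact: closed_openC.
Qed.

Lemma continuous_rV_measurable (f : Rn -> R) : continuous f ->
  measurable_fun setT f.
Proof.
move=> /continuousP cf; apply: (measurability _ (RGenOpens.measurableE R)).
move=> _ [_ [a [b ->] <-]]; rewrite setTI; apply: open_rV_measurable.
exact/cf/interval_open.
Qed.

Lemma measurable_rVB : measurable_fun setT (fun z : Rn * Rn => z.1 - z.2).
Proof.
apply: measurable_fun_rVP => i.
under eq_fun do rewrite !mxE.
apply: measurable_funB.
  exact: (measurableT_comp (measurable_coord i) measurable_fst).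
exact: (measurableT_comp (measurable_coord i) measurable_snd).
Qed.

Lemma measurable_euclidean_norm : measurable_fun setT (@euclidean_norm R n).
Proof.
have -> : @euclidean_norm R n = fun x => (\sum_i x ord0 i ^+ 2) `^ (2^-1).
  by apply/funext => x; rewrite powR12_sqrt// sumr_ge0// => i _; rewrite sqr_ge0.
apply: (measurableT_comp (measurable_powR _)).
apply: measurable_sum => i; apply: measurable_funX; exact: measurable_coord.
Qed.

End rV_borel.

(** * Product measures *)

Section product.
Context d (T : measurableType d) (R : realType).
Variable mu : {sigma_finite_measure set T -> \bar R}.
Local Notation mm := (mu \x mu)%E.

Lemma ae_prod_fst (P : T -> Prop) : {ae mu, forall x, P x} ->
  {ae mm, forall z, P z.1}.
Proof.
move=> [N [mN N0 PN]]; exists (N `*` setT); split; first exact: measurableX.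
  by rewrite product_measure1E// [X in (X * _)%E](N0) mul0e.
by move=> z /= nP; split => //; exact: PN.
Qed.

Lemma ae_prod_snd (P : T -> Prop) : {ae mu, forall x, P x} ->
  {ae mm, forall z, P z.2}.
Proof.
move=> [N [mN N0 PN]]; exists (setT `*` N); split; first exact: measurableX.
  by rewrite product_measure1E// N0 mule0.
by move=> z /= nP; split => //; exact: PN.
Qed.

Lemma measurable_swap_prod : measurable_fun setT (fun z : T * T => (z.2, z.1)).
Proof. by apply/measurable_fun_pairP; split; [exact: measurable_snd|exact: measurable_fst]. Qed.

Lemma ge0_integral_swap (f : T * T -> \bar R) : measurable_fun setT f ->
  (forall z, (0 <= f z)%E) ->
  (\int[mm]_z f (z.2, z.1) = \int[mm]_z f z)%E.
Proof.
move=> mf f0.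
rewrite (fubini_tonelli1 (fun z => f (z.2, z.1)))//; last first.
  exact: (measurableT_comp mf measurable_swap_prod).
by rewrite (fubini_tonelli2 f).
Qed.

Lemma ae_swap (P : T * T -> Prop) : {ae mm, forall z, P z} ->
  {ae mm, forall z, P (z.2, z.1)}.
Proof.
move=> [N [mN N0 PN]]; exists ((fun z => (z.2, z.1)) @^-1` N); split.
- by rewrite -[X in measurable X]setTI; exact: measurable_swap_prod.
- have m' : measurable ((fun z : T * T => (z.2, z.1)) @^-1` N).
    by rewrite -[X in measurable X]setTI; exact: measurable_swap_prod.
  have h := @ge0_integral_swap (fun z => (\1_N z)%:E).
  rewrite -[X in mm X]setIT -integral_indic//; apply: etrans (h _ _) _.
  - exact/measurable_EFinP.
  - by move=> z; rewrite lee_fin.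
  - by rewrite integral_indic// setIT.
by move=> z /= nP; exact: PN.
Qed.

Lemma integral_swap (f : T * T -> \bar R) : measurable_fun setT f ->
  (\int[mm]_z f (z.2, z.1) = \int[mm]_z f z)%E.
Proof.
move=> mf; rewrite integralE [RHS]integralE.
have fp z : ((fun z => f (z.2, z.1)) ^\+ z = f ^\+ (z.2, z.1))%E by rewrite !funeposE.
have fn z : ((fun z => f (z.2, z.1)) ^\- z = f ^\- (z.2, z.1))%E by rewrite !funenegE.
under eq_integral do rewrite fp.
under [in X in (_ - X)%E]eq_integral do rewrite fn.
rewrite !ge0_integral_swap//.
- exact: measurable_funeneg.
- exact: measurable_funepos.
Qed.

Lemma tonelli_split (f g : T -> \bar R) :
  measurable_fun setT f -> measurable_fun setT g ->
  (forall x, (0 <= f x)%E) -> (forall x, (0 <= g x)%E) ->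
  (\int[mm]_z (f z.1 * g z.2) = \int[mu]_x f x * \int[mu]_x g x)%E.
Proof.
move=> mf mg f0 g0.
rewrite fubini_tonelli1//=; last 2 first.
- apply: emeasurable_funM.
  + exact: (measurableT_comp mf measurable_fst).
  + exact: (measurableT_comp mg measurable_snd).
- by move=> z; rewrite mule_ge0.
rewrite /fubini_F/=.
under eq_integral => x _ do rewrite ge0_integralZl//.
by rewrite ge0_integralZr// integral_ge0.
Qed.

End product.

(** * Integrals of radial kernels *)

Lemma powR_gt1 (R : realType) (x a : R) : 1 < x -> 0 < a -> 1 < x `^ a.
Proof.
move=> x1 a0; apply: (@le_lt_trans _ _ (1 `^ a)); first by rewrite powR1.
by apply: gt0_ltr_powR; rewrite ?nnegrE// ltW// (lt_trans _ x1).
Qed.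

Lemma powR_expn (R : realType) (x a : R) k : 0 <= x ->
  (x ^+ k) `^ a = (x `^ a) ^+ k.
Proof.
by move=> x0; rewrite -powR_mulrn// -powRrM mulrC powRrM powR_mulrn ?powR_ge0.
Qed.

Lemma powR_addn (R : realType) (x a : R) k : 0 < x ->
  x `^ (- k%:R - a) = (x ^+ k)^-1 * x `^ (- a).
Proof.
move=> x0; rewrite powRD; last by rewrite [x == 0]gt_eqF// implybT.
by rewrite [X in X * _]powRN powR_mulrn// ltW.
Qed.

Section euclidean.
Context {R : realType} {n : nat}.
Local Notation Rn := 'rV[R]_n.
Local Notation mu := (@lebesgue_rV R n).
Local Notation en := (@euclidean_norm R n).
Implicit Types x y : Rn.

Lemma euclidean_norm_ge0 x : 0 <= en x.
Proof. exact: sqrtr_ge0. Qed.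

Lemma coord_le_euclidean x i : `|x ord0 i| <= en x.
Proof.
rewrite /euclidean_norm -sqrtr_sqr ler_wsqrtr// (bigD1 i)//= lerDl sumr_ge0// => j _.
exact: sqr_ge0.
Qed.

Lemma coord_le_mxnorm x i : `|x ord0 i| <= `|x|.
Proof.
rewrite /Num.norm/= mx_normrE.
exact: (le_bigmax _ (fun ij => `|x ij.1 ij.2|) (ord0, i)).
Qed.

Lemma euclidean_norm_eq0 x : en x = 0 -> x = 0.
Proof.
move=> x0; apply/rowP => i; rewrite mxE; apply/eqP; rewrite -normr_eq0.
by rewrite eq_le normr_ge0 andbT -x0 coord_le_euclidean.
Qed.

Lemma euclidean_norm_le x M : 0 <= M -> (forall i, `|x ord0 i| <= M) -> en x <= n%:R * M.
Proof.
move=> M0 xM; rewrite /euclidean_norm.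
rewrite -[leRHS]ger0_norm ?mulr_ge0// -sqrtr_sqr ler_wsqrtr//.
apply: (@le_trans _ _ (\sum_(i < n) M ^+ 2)).
  apply: ler_sum => i _; rewrite -[leLHS]real_normK ?num_real//.
  by rewrite lerXn2r ?nnegrE.
rewrite sumr_const card_ord -[leLHS]mulr_natl exprMn ler_wpM2r ?sqr_ge0//.
by rewrite -natrX ler_nat; case: (n) => // k; rewrite expnS expn1 leq_pmulr.
Qed.

Lemma euclidean_normN x : en (- x) = en x.
Proof. by congr Num.sqrt; apply: eq_bigr => i _; rewrite mxE sqrrN. Qed.

Definition cube x (r : R) : set Rn :=
  [set v | forall i, v ord0 i \in `]x ord0 i - r, x ord0 i + r]].

Lemma measurable_cube x r : measurable (cube x r).
Proof.
rewrite [X in measurable X](_ : _ = \bigcap_(i in [set: 'I_n])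
    ((fun v : Rn => v ord0 i : measurableTypeR R) @^-1`
       `]x ord0 i - r, x ord0 i + r]%classic)).
  apply: fin_bigcap_measurable => // i _.
  by rewrite -[X in measurable X]setTI; exact: measurable_coord.
by apply/seteqP; split => v /= H i => [_|]; exact: H.
Qed.

Lemma lebesgue_cube x r : 0 <= r -> mu (cube x r) = ((2 * r) ^+ n)%:E.
Proof.
move=> r0; have := @lebesgue_rV_box R n (x - const_mx r) (x + const_mx r).
have -> : cube x r = [set v | forall i, v ord0 i
    \in `](x - const_mx r) ord0 i, (x + const_mx r) ord0 i]].
  by apply/seteqP; split => v /= + i => /(_ i); rewrite !mxE.
move=> ->; last by move=> i; rewrite !mxE; lra.
rewrite (eq_bigr (fun=> 2 * r)) ?big_const_ord ?iter_mulr_1//.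
by move=> i _; rewrite !mxE; lra.
Qed.

Lemma dyadic_index (t : R) : 1 <= t -> exists k, 2 ^+ k <= t < 2 ^+ k.+1.
Proof.
move=> t1; have [N tN] : exists N, t < 2 ^+ N.
  exists (Num.truncn t).+1; apply: lt_trans (Num.Theory.truncnS_gt _) _.
  by rewrite -natrX ltr_nat ltn_expl.
elim: N tN => [|N ih] tN; first by move: tN; rewrite expr0 ltNge t1.
by have [/ih|h1] := ltP t (2 ^+ N); [|exists N; rewrite h1].
Qed.

Local Open Scope ereal_scope.

(** If [f <= c k] on the [k]-th layer, contained in the cube of radius [r k], the integral is bounded
    by a series that is geometric in the applications. Dyadic layers do the work of polar
    coordinates, for growing cubes at infinity and for shrinking cubes at a singularity. *)
Lemma layered_integral_le (f : Rn -> R) y (c r : nat -> R) M q :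
  measurable_fun setT f -> (forall x, (0 <= f x)%R) -> (forall k, (0 <= c k)%R) ->
  (forall k, (0 <= r k)%R) -> (0 <= M)%R -> (0 < q < 1)%R ->
  (forall x, f x = 0%R \/ exists2 k, cube y (r k) x & (f x <= c k)%R) ->
  (forall k, (c k * (2 * r k) ^+ n <= M * q ^+ k)%R) ->
  \int[mu]_x (f x)%:E <= (M / (1 - q))%:E.
Proof.
move=> mf f0 c0 r0 M0 /andP[q0 q1] cover decay.
pose u k x := (c k * \1_(cube y (r k)) x)%:E.
have u0 k x : 0 <= u k x by rewrite lee_fin mulr_ge0.
have mu_ k : measurable_fun setT (u k).
  apply/measurable_EFinP; apply: measurable_funM => //.
  by apply: measurable_indic; exact: measurable_cube.
apply: (@le_trans _ _ (\int[mu]_x \sum_(k <oo) u k x)).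
  apply: ge0_le_integral => //.
  - by move=> x _; rewrite lee_fin.
  - exact/measurable_EFinP.
  - by apply: ge0_emeasurable_sum.
  - move=> x _; have [->|[k kx fc]] := cover x; first exact: nneseries_ge0.
    apply: (@le_trans _ _ (u k x)).
      by rewrite /u indicE mem_set// mulr1 lee_fin.
    apply: le_trans (nneseries_lim_ge k.+1 _) => //.
    by rewrite big_nat_recr//= leeDr// sume_ge0.
rewrite integral_nneseries//.
have e k : \int[mu]_x u k x = (c k * (2 * r k) ^+ n)%:E.
  rewrite /u; under eq_integral do rewrite EFinM.
  rewrite ge0_integralZl//; last 2 first.
  - by apply/measurable_EFinP; apply: measurable_indic; exact: measurable_cube.
  - by rewrite lee_fin.
  rewrite integral_indic//; last exact: measurable_cube.
  by rewrite setIT EFinM; congr (_ * _); exact: lebesgue_cube.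
apply: (@le_trans _ _ (\sum_(k <oo) (M * q ^+ k)%:E)).
  apply: lee_nneseries => k _; first by rewrite integral_ge0.
  by rewrite e lee_fin.
have cv : series (geometric M q) @ \oo --> (M / (1 - q))%R.
  by apply: cvg_geometric_series; rewrite ger0_norm// ltW.
rewrite le_eqVlt; apply/orP; left; apply/eqP.
apply: cvg_lim => //.
have -> : (fun m => \sum_(0 <= k < m) (M * q ^+ k)%:E) = EFin \o series (geometric M q).
  by apply/funext => m; rewrite /= /series/= sumEFin.
by apply: cvg_EFin => //; exact: nearW.
Qed.

End euclidean.

Section kernel_bounds.
Context {R : realType} {n : nat}.
Local Notation Rn := 'rV[R]_n.
Local Notation mu := (@lebesgue_rV R n).
Local Notation en := (@euclidean_norm R n).

(** The layer [2^k <= 1 + |x| < 2^(k+1)] has volume of order [2^(n k)], so it contributes [2^(- a k)]. *)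
Lemma tail_weight_integrable (a : R) : 0 < a ->
  (\int[mu]_x ((1 + en x) `^ (- n%:R - a))%:E < +oo)%E.
Proof.
move=> a0.
pose c k : R := (2 ^+ k) `^ (- n%:R - a).
pose r k : R := 2 ^+ k.+1.
have two0 k : 0 < 2 ^+ k :> R by rewrite exprn_gt0.
apply: le_lt_trans (@layered_integral_le R n _ 0 c r (4 ^+ n) (2 `^ (- a)) _ _ _ _ _ _ _ _) (ltry _).
- apply: (measurableT_comp (measurable_powR _)).
  by apply: measurable_funD => //; exact: measurable_euclidean_norm.
- by move=> x; exact: powR_ge0.
- by move=> k; exact: powR_ge0.
- by move=> k; exact: exprn_ge0.
- exact: exprn_ge0.
- rewrite powR_gt0//= powRN invf_lt1 ?powR_gt0//.
  by apply: powR_gt1 => //; rewrite ltr1n.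
- move=> x; right.
  have [k /andP[k1 k2]] := @dyadic_index R (1 + en x) (ltac:(by rewrite lerDl euclidean_norm_ge0)).
  exists k.
    rewrite /cube/= => i; rewrite mxE !add0r in_itv/=.
    have : `|x ord0 i| < r k.
      apply: le_lt_trans (coord_le_euclidean _ _) _.
      by apply: le_lt_trans k2; rewrite lerDr.
    by rewrite ltr_norml => /andP[-> /ltW].
  rewrite /c -opprD !powRN lef_pV2 ?posrE ?powR_gt0//; last first.
    by rewrite ltr_wpDr ?euclidean_norm_ge0.
  apply: ge0_ler_powR; rewrite ?nnegrE ?addr_ge0 ?euclidean_norm_ge0// ?ltW//.
- move=> k; rewrite /c /r.
  have P0 := two0 k.
  rewrite -powR_expn// exprS mulrA (_ : 2 * 2 = 4); last by rewrite -natrM.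
  rewrite powR_addn// (exprMn n 4) mulrCA -[X in 4 ^+ n * X]mulrA.
  by rewrite [X in 4 ^+ n * X]mulrCA mulVf ?mulr1// expf_neq0// gt_eqF.
Qed.

(** The layer where [|x - y|] is of order [D 2^(- k)] contributes [2^(- b k)], whatever [y] is. *)
Lemma singular_kernel_bound (b D : R) : 0 < b -> 0 < D -> exists2 C : R, 0 <= C &
  forall y : Rn,
    (\int[mu]_x (en (x - y) `^ b / en (x - y) `^ n%:R *
       \1_[set x | en (x - y) <= D] x)%:E <= C%:E)%E.
Proof.
move=> b0 D0.
pose q : R := 2 `^ (- b).
have q0 : 0 < q by rewrite powR_gt0.
have q1 : q < 1.
  rewrite /q powRN invf_lt1 ?powR_gt0//.
  by apply: powR_gt1 => //; rewrite ltr1n.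
exists (D `^ b * 8 ^+ n / (1 - q)) => [|y].
  by rewrite divr_ge0 ?mulr_ge0 ?powR_ge0 ?exprn_ge0// subr_ge0 ltW.
have two0 k : 0 < 2 ^+ k :> R by rewrite exprn_gt0.
pose rho k : R := D / 2 ^+ k.
have rho0 k : 0 < rho k by rewrite divr_gt0.
pose c k : R := rho k `^ b / rho k.+1 `^ n%:R.
pose r k : R := 2 * rho k.
have my : measurable_fun setT (fun x : Rn => en (x - y)).
  apply: (measurableT_comp measurable_euclidean_norm).
  apply: measurable_fun_rVP => i.
  under eq_fun do rewrite !mxE.
  by apply: measurable_funB => //; exact: measurable_coord.
apply: (@layered_integral_le R n _ y c r).
- apply: measurable_funM; first apply: measurable_funM.
  + exact: (measurableT_comp (measurable_powR _)).
  + under eq_fun do rewrite -powRN.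
    exact: (measurableT_comp (measurable_powR _)).
  + apply: measurable_indic.
    rewrite (_ : [set x | _] = (fun x => en (x - y)) @^-1` [set` `]-oo, D]]).
      by rewrite -[X in measurable X]setTI; exact: my.
    by apply/seteqP; split => x /=; rewrite in_itv.
- by move=> x; rewrite mulr_ge0// divr_ge0// powR_ge0.
- by move=> k; rewrite divr_ge0// powR_ge0.
- by move=> k; rewrite mulr_ge0// ltW.
- by rewrite mulr_ge0 ?powR_ge0// exprn_ge0.
- by rewrite q0.
- move=> x; rewrite indicE; have [|_] := boolP (x \in _); last by left; rewrite mulr0.
  rewrite inE/= => xyD; rewrite mulr1.
  have [->|xy0] := eqVneq (en (x - y)) 0.
    by left; rewrite powR0 ?mul0r// gt_eqF.
  have xyp : 0 < en (x - y) by rewrite lt_neqAle eq_sym xy0 euclidean_norm_ge0.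
  right; have [k /andP[k1 k2]] := @dyadic_index R (D / en (x - y)) (ltac:(by rewrite ler_pdivlMr// mul1r)).
  have h1 : en (x - y) <= rho k by rewrite ler_pdivlMr// mulrC -ler_pdivlMr.
  have h2 : rho k.+1 <= en (x - y) by rewrite ler_pdivrMr// mulrC -ler_pdivrMr// ltW.
  exists k.
    move=> i; have := coord_le_euclidean (x - y) i; rewrite !mxE => h.
    have : `|x ord0 i - y ord0 i| < r k.
      by apply: le_lt_trans h (le_lt_trans h1 _); rewrite /r ltr_pMl// ltr1n.
    rewrite ltr_norml in_itv/= ltrBlDl ltrBrDl => /andP[h3 /ltW h4].
    by rewrite h4 andbT ltrBlDl -ltrBlDr ltrBlDl -ltrBDr.
  rewrite /c; apply: ler_pM; rewrite ?powR_ge0 ?invr_ge0 ?powR_ge0//.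
    by apply: ge0_ler_powR; rewrite ?nnegrE ?euclidean_norm_ge0 ?(ltW b0) ?(ltW (rho0 _)).
  rewrite lef_pV2 ?posrE ?powR_gt0//.
  by apply: ge0_ler_powR; rewrite ?nnegrE ?euclidean_norm_ge0 ?(ltW (rho0 _)).
- move=> k; rewrite /c /r.
  have rk : rho k = 2 * rho k.+1 by rewrite /rho exprS; field; rewrite gt_eqF.
  have -> : 2 * (2 * rho k) = 8 * rho k.+1 by rewrite rk; ring.
  rewrite powR_mulrn ?(ltW (rho0 _))// (exprMn n 8) -mulrA mulrCA.
  have s0 := rho0 k.+1.
  have cancel (u v w : R) : 0 < u -> u^-1 * (v * (w * u)) = v * w.
    by move=> u0; field; rewrite gt_eqF.
  rewrite cancel ?exprn_gt0//.
  rewrite mulrAC ler_wpM2r ?exprn_ge0//.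
  rewrite /rho powRM ?(ltW D0)// ?invr_ge0 ?(ltW (two0 _))// ler_wpM2l ?powR_ge0//.
  by rewrite /q -powR_expn// powRN -powR_inv1 ?(ltW (two0 _))// -!powRrM mulN1r powRN.
Qed.

End kernel_bounds.

(** * Bounded sets and test functions *)

Section geometry.
Context {R : realType} {n : nat}.
Local Notation Rn := 'rV[R]_n.
Local Notation mu := (@lebesgue_rV R n).
Local Notation en := (@euclidean_norm R n).

Lemma bounded_set_coord (U : set Rn) : bounded_set U ->
  exists2 M, 0 < M & forall x, U x -> forall i, `|x ord0 i| <= M.
Proof.
move=> [M [_ HM]]; exists (Num.max 0 M + 1) => [|x Ux i].
  by rewrite ltr_wpDl// le_max lexx.
apply: le_trans (coord_le_mxnorm x i) _; apply: HM => //.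
by rewrite (@le_lt_trans _ _ (Num.max 0 M))// ?le_max ?lexx ?orbT// ltrDl.
Qed.

Lemma bounded_lebesgue_lty (U : set Rn) : measurable U -> bounded_set U ->
  (mu U < +oo)%E.
Proof.
move=> mU /bounded_set_coord[M M0 HM].
apply: (@le_lt_trans _ _ (mu (cube 0 (M + 1)))).
  apply: le_measure; rewrite ?inE//; first exact: measurable_cube.
  move=> x Ux i; rewrite mxE !add0r in_itv/=.
  by have := HM _ Ux i; rewrite ler_norml => /andP[h1 h2]; apply/andP; split; lra.
by rewrite [X in (X < _)%E]lebesgue_cube ?ltry// addr_ge0// ltW.
Qed.

(** A unit cube on which every function vanishing outside [V] is zero, and which is still at bounded
    distance from [U]: it is the reference set of the Poincare inequality. *)
Lemma cube_away (U V : set Rn) : (0 < n)%N -> bounded_set U -> bounded_set V ->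
  exists A : set Rn, [/\ measurable A, A `&` V = set0, mu A = 1%E &
    exists2 D, 0 < D & forall x y, U x -> A y -> en (x - y) <= D].
Proof.
move=> n0 /bounded_set_coord[M1 M10 HM1] /bounded_set_coord[M2 M20 HM2].
exists (cube (const_mx (M2 + 2)) (2^-1)); split.
- exact: measurable_cube.
- apply/seteqP; split => // y [/= Ay Vy]; pose i0 := Ordinal n0.
  have := HM2 _ Vy i0; have := Ay i0; rewrite mxE in_itv/= ler_norml.
  by move=> /andP[h1 h2] /andP[h3 h4]; lra.
- rewrite [LHS]lebesgue_cube ?invr_ge0// divff// expr1n//.
have D0 : 0 < M1 + (M2 + 3) by lra.
exists (n%:R * (M1 + (M2 + 3))) => [|x y Ux Ay].
  by rewrite mulr_gt0// ltr0n.
apply: euclidean_norm_le => [|i]; first exact: ltW.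
rewrite !mxE; apply: le_trans (ler_normB _ _) _; apply: lerD; first exact: HM1.
have := Ay i; rewrite mxE in_itv/= => /andP[h1 h2].
by rewrite ler_norml; apply/andP; split; lra.
Qed.

(** Points of [U] keep a positive distance from the complement of [V], and [U] is bounded, so
    [|x - y|] is comparable to [1 + |y|]. *)
Lemma dist_weight_le (U V : set Rn) : bounded_set U -> open V ->
  compactly_contained U V ->
  exists2 c, 0 < c & forall x y, U x -> ~ V y -> 1 + en y <= c * en (x - y).
Proof.
move=> bU oV [cU UV].
have [d d0 Hd] : exists2 d, 0 < d & forall x, U x -> ball x d `<=` V.
  have [e /= e0 He] : \forall d \near (0 : R)^'+, closure U `<=` (fun x => ball x d `<=` V).
    apply: ((compact_near_coveringP _).1 cU) => x Kx.
    have /nbhs_ballP[r /= r0 rV] : nbhs x V by apply: open_nbhs_nbhs; split => //; exact: UV.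
    have r20 : 0 < r / 2 by rewrite divr_gt0.
    exists (ball x (r / 2), [set d | d < r / 2]) => /=.
      by split; [exact: nbhsx_ballx|exact: nbhs_right_lt].
    move=> [x' d'] [/= xx' dr] y x'y; apply: rV.
    rewrite (splitr r); apply: ball_triangle xx' _.
    exact: le_ball (ltW dr) _ x'y.
  have e20 : 0 < e / 2 by rewrite divr_gt0.
  exists (e / 2) => // x Ux; apply: (He (e / 2)) => //=.
    by rewrite sub0r normrN gtr0_norm// ltr_pdivrMr// ltr_pMr// ltr1n.
  exact: subset_closure.
have [M M0 HM] := bounded_set_coord bU.
have nM : 0 < 1 + n%:R * M by rewrite ltr_wpDr// mulr_ge0// ltW.
exists ((1 + n%:R * M) / d + n%:R) => [|x y Ux nVy].
  by rewrite ltr_wpDr// divr_gt0.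
have dxy : d <= en (x - y).
  rewrite leNgt; apply/negP => xyd; apply: nVy; apply: (Hd x) => //.
  apply/rV_ballE => // i; apply: le_lt_trans xyd.
  by have := coord_le_euclidean (x - y) i; rewrite !mxE.
have eny : en y <= n%:R * (M + en (x - y)).
  apply: euclidean_norm_le => [|i]; first by rewrite addr_ge0 ?euclidean_norm_ge0// ltW.
  have := coord_le_euclidean (x - y) i; rewrite !mxE => h.
  have -> : y ord0 i = x ord0 i - (x ord0 i - y ord0 i) by ring.
  by apply: le_trans (ler_normB _ _) _; rewrite lerD// HM.
apply: (@le_trans _ _ (1 + n%:R * M + n%:R * en (x - y))).
  by rewrite -addrA lerD2l -mulrDr.
by rewrite mulrDl lerD2r mulrAC ler_pdivlMr// ler_wpM2l// ltW.
Qed.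

(** The partial derivatives are continuous and vanish off a compact set, hence are bounded. Going from
    [x] to [y] one coordinate at a time, the mean value theorem applies to each step. *)
Lemma smooth_lipschitz (U : set Rn) (eta : Rn -> R) : test_function U eta ->
  exists2 B, 0 <= B & forall x y, `|eta x - eta y| <= B * en (x - y).
Proof.
move=> [sm [cs _]]; set S := closure _ in cs.
pose e i : Rn := delta_mx ord0 i.
have cont i : continuous ('D_(e i) eta) := (sm [:: i]).1.
have der i x : derivable eta x (e i) := (sm [::]).2 i x.
have out i x : ~ S x -> 'D_(e i) eta x = 0.
  move=> nSx.
  have oS : open (~` S) by apply: closed_openC; exact: closed_closure.
  have nb : \forall y \near x, eta y = 0.
    have : nbhs x (~` S) by apply: open_nbhs_nbhs.
    apply: filterS => y nS; apply/eqP; apply: contra_notT nS => ey.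
    exact: subset_closure.
  have -> : 'D_(e i) eta x = 'D_(e i) (cst (0 : R)) x by exact: near_eq_derive.
  exact: derive_cst.
have bnd i : exists2 B, 0 <= B & forall x, `|'D_(e i) eta x| <= B.
  have : bounded_set (('D_(e i) eta) @` S).
    by apply: compact_bounded; apply: continuous_compact => //; exact: continuous_subspaceT.
  move=> [M [_ HM]]; exists (Num.max 0 M + 1) => [|x].
    by rewrite addr_ge0// le_max lexx.
  have [Sx|/out ->] := pselect (S x); last by rewrite normr0 addr_ge0// le_max lexx.
  apply: (HM (Num.max 0 M + 1)); last by exists x.
  by rewrite (@le_lt_trans _ _ (Num.max 0 M))// ?le_max ?lexx ?orbT// ltrDl.
have line i : exists2 B, 0 <= B & forall x t, `|eta (x + t *: e i) - eta x| <= B * `|t|.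
  have [B B0 HB] := bnd i; exists B => // x t.
  pose h (u : R) := eta (x + u *: e i).
  have dh (u : R) : is_derive u (1 : R) h ('D_(e i) eta (x + u *: e i)).
    have E : (fun k : R => k^-1 *: ((h \o shift u) (k *: (1 : R)) - h u)) =
        (fun k => k^-1 *: ((eta \o shift (x + u *: e i)) (k *: e i) - eta (x + u *: e i))).
      apply/funext => k; rewrite /h /=; congr (_ *: (eta _ - _)).
      by rewrite scalerDl addrCA /GRing.scale/= mulr1.
    by split; [rewrite /derivable E; exact: der|rewrite /derive E].
  have ch : continuous h.
    move=> u; apply: differentiable_continuous; apply/derivable1_diffP.
    exact: (@ex_derive _ _ _ _ _ _ _ (dh u)).
  have -> : eta x = h 0 by rewrite /h scale0r addr0.
  rewrite -/(h t).
  have [t0|t0] := leP 0 t.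
    have [c _ ->] := MVT_segment t0 (fun u _ => dh u) (continuous_subspaceT ch).
    by rewrite subr0 normrM ler_wpM2r.
  have [c _] := MVT_segment (ltW t0) (fun u _ => dh u) (continuous_subspaceT ch).
  by move=> hc; rewrite distrC hc sub0r normrM normrN ler_wpM2r.
have line' i : exists B : R, 0 <= B /\
    forall x t, `|eta (x + t *: e i) - eta x| <= B * `|t|.
  by have [B B0 HB] := line i; exists B.
have [B HB] := boolp.choice line'.
exists (\sum_i B i) => [|x y].
  by apply: sumr_ge0 => i _; have [] := HB i.
pose z k : Rn := \row_j if (j < k)%N then y ord0 j else x ord0 j.
have z0 : z 0 = x by apply/rowP => j; rewrite mxE.
have zn : z n = y by apply/rowP => j; rewrite mxE ltn_ord.
have zS (i : 'I_n) : z i.+1 = z i + (y ord0 i - x ord0 i) *: e i.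
  apply/rowP => j; rewrite !mxE eqxx/= ltnS.
  have [->|ji] := eqVneq j i; first by rewrite leqnn ltnn mulr1 addrC subrK.
  rewrite mulr0 addr0 leq_eqVlt.
  by have /negbTE -> : val j != val i by [].
have -> : eta x - eta y = - \sum_(i < n) (eta (z i.+1) - eta (z i)).
  by rewrite -(big_mkord xpredT (fun k => eta (z k.+1) - eta (z k))) telescope_sumr// z0 zn opprB.
rewrite normrN mulr_suml; apply: le_trans (ler_norm_sum _ _ _) _.
apply: ler_sum => i _; have [B0 Bi] := HB i.
rewrite zS; apply: le_trans (Bi _ _) _; rewrite ler_wpM2l//.
by have := coord_le_euclidean (x - y) i; rewrite !mxE distrC.
Qed.

End geometry.

(** * Almost everywhere limits *)

Section limits.
Context d (T : measurableType d) (R : realType).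
Variable mu : {measure set T -> \bar R}.

Lemma fatou_le (f_ : nat -> T -> R) (f : T -> R) (c : \bar R) N :
  (forall k, measurable_fun setT (f_ k)) -> (forall k x, 0 <= f_ k x) ->
  (forall x, f_ k x @[k --> \oo] --> f x) ->
  (forall k, (N <= k)%N -> (\int[mu]_x (f_ k x)%:E <= c)%E) ->
  (\int[mu]_x (f x)%:E <= c)%E.
Proof.
move=> mf f0 ff fc.
have := @fatou _ T R mu setT measurableT (fun k x => (f_ (k + N)%N x)%:E).
have -> : (fun x => limn_einf (fun k => (f_ (k + N)%N x)%:E)) = EFin \o f.
  apply/funext => x; have cx : (f_ (k + N)%N x)%:E @[k --> \oo] --> (f x)%:E.
    apply: cvg_EFin; first exact: nearW.
    by have := ff x; rewrite -(cvg_shiftn N).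
  by rewrite is_cvg_limn_einfE; [exact: cvg_lim cx|apply/cvg_ex; exists (f x)%:E].
move=> /(_ (fun k => (measurable_EFinP _ _).2 (mf _))) h.
apply: le_trans (h _) _; first by move=> k x _; rewrite lee_fin.
rewrite limn_einf_lim; apply: lime_le; first exact: is_cvg_einfs.
apply: nearW => k; apply: le_trans (fc (k + N)%N (leq_addl _ _)).
by apply: ereal_inf_lbound; exists k => //=.
Qed.

(** The series of [2^((p-1) k) |f k.+1 - f k|^p] is integrable, hence finite almost everywhere. An
    increment is at most [2^(- k)] or at most its term in that series, so the increments are
    summable. *)
Lemma ae_cvg_geometric (p C : R) (f : nat -> T -> R) : 1 < p -> 0 <= C ->
  (forall k, measurable_fun setT (f k)) ->
  (forall k, (\int[mu]_x (`|f k.+1 x - f k x| `^ p)%:E <= (C * (2 `^ (- p)) ^+ k)%:E)%E) ->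
  {ae mu, forall x, cvgn (f ^~ x)}.
Proof.
move=> p1 C0 mf fC.
pose u k x : R := (2 `^ (p - 1)) ^+ k * `|f k.+1 x - f k x| `^ p.
have u0 k x : 0 <= u k x by rewrite mulr_ge0 ?powR_ge0// exprn_ge0// powR_ge0.
have md k : measurable_fun setT (fun x => `|f k.+1 x - f k x| `^ p).
  by apply: measurable_powR_norm; exact: measurable_funB.
have mu_ k : measurable_fun setT (u k) by apply: measurable_funM.
pose g x := (\sum_(k <oo) (u k x)%:E)%E.
have g0 x : (0 <= g x)%E by apply: nneseries_ge0 => k _ _; rewrite lee_fin.
have mg : measurable_fun setT g.
  apply: ge0_emeasurable_sum => [k x _|k _]; first by rewrite lee_fin.
  exact/measurable_EFinP.
have ig : mu.-integrable setT g.
  apply/integrableP; split => //.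
  under eq_integral => x _ do rewrite gee0_abs//.
  rewrite integral_nneseries//; last 2 first.
  - by move=> k; exact/measurable_EFinP.
  - by move=> k x _; rewrite lee_fin.
  apply: (@le_lt_trans _ _ (\sum_(k <oo) (C * 2^-1 ^+ k)%:E)%E).
    apply: lee_nneseries => k _.
      by move=> _; apply: integral_ge0 => x _; rewrite lee_fin.
    under eq_integral do rewrite EFinM.
    have T0 : (0 <= ((2 : R) `^ (p - 1) ^+ k)%:E)%E by rewrite lee_fin exprn_ge0// powR_ge0.
    rewrite ge0_integralZl//; last exact/measurable_EFinP.
    apply: (@le_trans _ _ (((2 `^ (p - 1)) ^+ k)%:E * (C * 2 `^ (- p) ^+ k)%:E)%E).
      by rewrite lee_wpmul2l.
    rewrite -EFinM lee_fin mulrCA -exprMn -powRD; last by rewrite pnatr_eq0 implybT.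
    by rewrite (_ : p - 1 + - p = - 1) ?powR_inv1//; ring.
  have cv : series (geometric C 2^-1) @ \oo --> C / (1 - 2^-1).
    by apply: cvg_geometric_series; rewrite ger0_norm ?invr_ge0// invf_lt1// ltr1n.
  rewrite (_ : (\sum_(k <oo) (C * 2^-1 ^+ k)%:E)%E = (C / (1 - 2^-1))%:E) ?ltry//.
  apply: cvg_lim => //.
  have -> : (fun m => \sum_(0 <= k < m) (C * 2^-1 ^+ k)%:E)%E = EFin \o series (geometric C 2^-1).
    by apply/funext => m; rewrite /= /series/= sumEFin.
  by apply: cvg_EFin => //; exact: nearW.
have := integrable_ae measurableT ig; apply: filterS => x /(_ I) gx.
have cu : cvgn (series (u ^~ x)).
  apply: nondecreasing_is_cvgn; first exact: nondecreasing_series.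
  exists (fine (g x)) => _ [m _ <-].
  rewrite -lee_fin fineK// /series/= -sumEFin.
  by apply: nneseries_lim_ge => k _ _; rewrite lee_fin.
have cgeo : cvgn (series (geometric 1 2^-1) : R^nat).
  by apply: is_cvg_geometric_series; rewrite ger0_norm ?invr_ge0// invf_lt1// ltr1n.
have ctel : cvgn (series (telescope (f ^~ x))).
  apply: normed_cvg.
  apply: (@series_le_cvg _ _ (fun k => geometric 1 2^-1 k + u k x)).
  - by move=> k /=.
  - by move=> k; rewrite addr_ge0//= mul1r exprn_ge0// invr_ge0.
  - move=> k; rewrite /= mul1r /telescope/= /u.
    set y := `|_|; have y0 : 0 <= y by exact: normr_ge0.
    have [yk|ky] := leP y (2^-1 ^+ k).
      by rewrite ler_wpDr// mulr_ge0 ?powR_ge0// exprn_ge0// powR_ge0.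
    rewrite ler_wpDl// ?exprn_ge0 ?invr_ge0//.
    rewrite (powRS p1 y0) mulrA ler_peMl//.
    rewrite -powR_expn// -powRM ?exprn_ge0//.
    apply: (@le_trans _ _ (1 `^ (p - 1))); first by rewrite powR1.
    apply: ge0_ler_powR; rewrite ?nnegrE ?subr_ge0 ?(ltW p1)// ?mulr_ge0 ?exprn_ge0//.
    by move: ky; rewrite exprVn -[X in X < _]mul1r ltr_pdivrMr ?exprn_gt0// mulrC => /ltW.
  - have -> : series (fun k => geometric 1 2^-1 k + u k x) =
       series (geometric 1 2^-1) \+ series (u ^~ x).
      by apply/funext => m; rewrite /series/= big_split.
    exact: is_cvgD.
have -> : f ^~ x = (fun n => f 0%N x + series (telescope (f ^~ x)) n).
  by apply/funext => m; rewrite -eq_sum_telescope.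
by apply: is_cvgD => //; exact: is_cvg_cst.
Qed.

End limits.

Section product_real.
Context d (T : measurableType d) (R : realType).
Variable mu : {sigma_finite_measure set T -> \bar R}.
Local Notation mm := (mu \x mu)%E.

Lemma Rintegrable_prod (f g : T -> R) : Rintegrable mu f -> Rintegrable mu g ->
  (forall x, 0 <= f x) -> (forall x, 0 <= g x) ->
  Rintegrable mm (fun z => f z.1 * g z.2) /\
  \int[mm]_z (f z.1 * g z.2) = \int[mu]_x f x * \int[mu]_x g x.
Proof.
move=> fi gi f0 g0.
have mf := Rintegrable_meas fi; have mg := Rintegrable_meas gi.
have E : (\int[mm]_z (f z.1 * g z.2)%:E = \int[mu]_x (f x)%:E * \int[mu]_x (g x)%:E)%E.
  under eq_integral do rewrite EFinM.
  rewrite (@tonelli_split _ _ _ mu (EFin \o f) (EFin \o g))//.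
  - exact/measurable_EFinP.
  - exact/measurable_EFinP.
have Ff := integrable_fin_num measurableT fi.
have Fg := integrable_fin_num measurableT gi.
split; last by rewrite /Rintegral E fineM.
apply/Rintegrable_ge0P.
- apply: measurable_funM.
  + exact: (measurableT_comp mf measurable_fst).
  + exact: (measurableT_comp mg measurable_snd).
- by move=> z; rewrite mulr_ge0.
- by rewrite E ltey_eq fin_numM.
Qed.

End product_real.

(** * Weighted differences and the energy space *)

Lemma affine_absorb (R : realType) (a b c x N : R) :
  0 <= a -> 0 <= b -> 0 <= c -> 0 <= N -> x <= c * N ->
  a + N + (b + x) <= (a + 1 + b + c) * (N + 1).
Proof. by move=> *; nra. Qed.

Lemma product_absorb (R : realType) (a b c d e : R) :
  a * e <= b + c -> e <= 1 + c -> 0 <= b -> 0 <= d ->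
  (a + d) * e <= (1 + b + c) * (1 + d).
Proof. by move=> *; nra. Qed.

Lemma rint_le0_ae0 d (T : measurableType d) (R : realType)
    (mu : {measure set T -> \bar R}) (P : T -> R) :
  Rintegrable mu P -> (forall z, 0 <= P z) -> \int[mu]_z P z <= 0 ->
  {ae mu, forall z, P z = 0}.
Proof.
move=> iP P0 P_le0.
have : (\int[mu]_z `|(P z)%:E| = 0)%E.
  have -> : (\int[mu]_z `|(P z)%:E| = \int[mu]_z (P z)%:E)%E.
    by apply: eq_integral => z _; rewrite gee0_abs// lee_fin.
  rewrite -[LHS]fineK ?(integrable_fin_num measurableT iP)//; congr EFin.
  by apply/eqP; rewrite eq_le P_le0 rint_ge0.
move=> /(ae_eq_integral_abs _ measurableT (measurable_int _ iP)).
by apply: filterS => z /(_ I) [].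
Qed.

(** The two inequalities add up to a nonpositive integral of [(dpow a - dpow b) * (a - b)], which is
    nonnegative and vanishes only where [a = b]. *)
Lemma pairing_unique d (T : measurableType d) (R : realType)
    (mu : {measure set T -> \bar R}) (p : R) (a b : T -> R) : 1 < p ->
  Rintegrable mu (fun z => dpow p (a z) * (b z - a z)) ->
  Rintegrable mu (fun z => dpow p (b z) * (a z - b z)) ->
  0 <= \int[mu]_z (dpow p (a z) * (b z - a z)) ->
  0 <= \int[mu]_z (dpow p (b z) * (a z - b z)) ->
  {ae mu, forall z, a z = b z}.
Proof.
move=> p1 ia ib ha hb.
pose P z := -1 * (dpow p (a z) * (b z - a z) + dpow p (b z) * (a z - b z)).
have PE z : P z = (dpow p (a z) - dpow p (b z)) * (a z - b z) by rewrite /P; ring.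
have iP : Rintegrable mu P by apply: RintegrableZ; exact: RintegrableD.
have : {ae mu, forall z, P z = 0}.
  apply: rint_le0_ae0 => //.
    by move=> z; rewrite PE; exact: dpow_monotone.
  by rewrite /P rintZ ?rintD ?mulN1r ?oppr_le0 ?addr_ge0//; exact: RintegrableD.
by apply: filterS => z; rewrite PE; exact: dpow_monotone_eq0.
Qed.

Section energy_space.
Context {R : realType} {n : nat}.
Local Notation Rn := 'rV[R]_n.
Local Notation mu := (@lebesgue_rV R n).
Local Notation mm := (mu \x mu)%E.
Local Notation en := (@euclidean_norm R n).
Variables (s p Lam : R) (k : Rn * Rn -> R) (Om Om' : set Rn).
Hypotheses (n0 : (0 < n)%N) (s0 : 0 < s) (p1 : 1 < p) (Lam0 : 0 < Lam).

(** On the diagonal the value is [0^-1 = 0]. *)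
Definition riesz_kernel (z : Rn * Rn) : R := (en (z.1 - z.2) `^ (n%:R + s * p))^-1.
Local Notation k0 := riesz_kernel.

Hypothesis mk : measurable_fun setT k.
Hypothesis k_lo : forall z, Lam^-1 * k0 z <= k z.
Hypothesis k_hi : forall z, k z <= Lam * k0 z.
Hypotheses (oOm : open Om) (oOm' : open Om') (bOm : bounded_set Om)
  (bOm' : bounded_set Om') (ccOm : compactly_contained Om Om').

Let p0 : 0 < p. Proof. by rewrite (lt_trans _ p1). Qed.
Let pB0 : 0 < p - 1. Proof. by rewrite subr_gt0. Qed.
Let a0 : 0 < n%:R + s * p.
Proof. by rewrite ltr_wpDl// mulr_gt0. Qed.
Let mOm : measurable Om. Proof. exact: open_rV_measurable. Qed.
Let mOm' : measurable Om'. Proof. exact: open_rV_measurable. Qed.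
Let OmOm' : Om `<=` Om'.
Proof. by move=> x Ox; apply: ccOm.2; exact: subset_closure. Qed.

Lemma riesz_kernel_ge0 z : 0 <= k0 z.
Proof. by rewrite invr_ge0 powR_ge0. Qed.

Lemma measurable_riesz_kernel : measurable_fun setT k0.
Proof.
rewrite /k0; under eq_fun do rewrite -powRN.
apply: (measurableT_comp (measurable_powR _)).
exact: (measurableT_comp measurable_euclidean_norm measurable_rVB).
Qed.

Let k_ge0 z : 0 <= k z.
Proof. by apply: le_trans (k_lo z); rewrite mulr_ge0 ?riesz_kernel_ge0// invr_ge0 ltW. Qed.

(** The factor 2 lets [Om * ~` Om'] stand for both exterior blocks. *)
Definition weight (z : Rn * Rn) : R :=
  k z * (\1_(Om' `*` Om') z + 2 * \1_(Om `*` ~` Om') z).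

Lemma weight_in z : Om' z.1 -> Om' z.2 -> weight z = k z.
Proof.
move=> h1 h2; rewrite /weight !indicE mem_set// memNset ?mulr0 ?addr0 ?mulr1//.
by move=> [].
Qed.

Lemma weight_out z : Om z.1 -> ~ Om' z.2 -> weight z = 2 * k z.
Proof.
move=> h1 h2; rewrite /weight !indicE memNset ?mem_set// ?add0r ?mulr1 1?mulrC//.
by move=> [].
Qed.

Lemma weight_ge0 z : 0 <= weight z.
Proof. by rewrite mulr_ge0// addr_ge0// mulr_ge0. Qed.

Lemma measurable_weight : measurable_fun setT weight.
Proof.
apply: measurable_funM => //; apply: measurable_funD.
  by apply: measurable_indic; exact: measurableX.
apply: measurable_funM => //.
by apply: measurable_indic; apply: measurableX => //; exact: measurableC.
Qed.

Definition wroot (z : Rn * Rn) : R := weight z `^ p^-1.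

Lemma wroot_ge0 z : 0 <= wroot z. Proof. exact: powR_ge0. Qed.

Lemma wrootK z : wroot z `^ p = weight z.
Proof. by rewrite /wroot -powRrM mulVf ?gt_eqF// powRr1// weight_ge0. Qed.

Lemma measurable_wroot : measurable_fun setT wroot.
Proof. exact: (measurableT_comp (measurable_powR _) measurable_weight). Qed.

(** By homogeneity of [dpow], the root of the weight turns weighted pairings of differences into
    pairings in the unweighted [L^p] space. *)
Definition wdiff (f : Rn -> R) (z : Rn * Rn) : R := wroot z * (f z.1 - f z.2).

Lemma wdiff_powR (f : Rn -> R) z : `|wdiff f z| `^ p = weight z * `|f z.1 - f z.2| `^ p.
Proof. by rewrite normrM powRM// (ger0_norm (wroot_ge0 z)) wrootK. Qed.

Lemma wdiffB (f g : Rn -> R) z : wdiff (f \- g) z = wdiff f z - wdiff g z.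
Proof. by rewrite /wdiff /=; ring. Qed.

Lemma measurable_diff (f : Rn -> R) : measurable_fun setT f ->
  measurable_fun setT (fun z : Rn * Rn => f z.1 - f z.2).
Proof.
move=> mf; apply: measurable_funB.
  exact: (measurableT_comp mf measurable_fst).
exact: (measurableT_comp mf measurable_snd).
Qed.

Lemma measurable_wdiff (f : Rn -> R) : measurable_fun setT f -> measurable_fun setT (wdiff f).
Proof.
by move=> mf; apply: measurable_funM; [exact: measurable_wroot|exact: measurable_diff].
Qed.

Definition vanish_out (f : Rn -> R) := forall x, ~ Om x -> f x = 0.

(** Keep only the pairs [(x, y)] with [x] in [Om] and [y] in a unit cube [A] outside [Om']. There [f y]
    is zero and the weight is bounded below, so integrating in [y] returns [|f x|^p]. *)
Lemma poincare : exists2 C : R, 0 <= C & forall f : Rn -> R, measurable_fun setT f ->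
  vanish_out f ->
  (\int[mu]_x (`|f x| `^ p)%:E <= C%:E * \int[mm]_z (`|wdiff f z| `^ p)%:E)%E.
Proof.
have [A [mA AOm' A1 [D D0 HD]]] := cube_away n0 bOm bOm'.
have AnO y : A y -> ~ Om' y.
  by move=> Ay Oy; have : (A `&` Om') y by []; rewrite AOm'.
pose c := 2 * (Lam^-1 * (D `^ (n%:R + s * p))^-1).
have c0 : 0 < c by rewrite mulr_gt0// mulr_gt0// invr_gt0// powR_gt0.
exists c^-1 => [|f mf fO]; first by rewrite invr_ge0 ltW.
have mfp : measurable_fun setT (fun x => `|f x| `^ p) by exact: measurable_powR_norm.
have iA : (\int[mu]_x (\1_A x)%:E)%E = 1%E by rewrite integral_indic// setIT.
suff h : (c%:E * \int[mu]_x (`|f x| `^ p)%:E <= \int[mm]_z (`|wdiff f z| `^ p)%:E)%E.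
  apply: (@le_trans _ _ (c^-1%:E * (c%:E * \int[mu]_x (`|f x| `^ p)%:E))%E).
    by rewrite muleA -EFinM mulVf ?gt_eqF// mul1e.
  by rewrite lee_wpmul2l// lee_fin invr_ge0 ltW.
have i0 : (0 <= \int[mu]_x (`|f x| `^ p)%:E)%E.
  by apply: integral_ge0 => x _; rewrite lee_fin powR_ge0.
rewrite -ge0_integralZl//; last 2 first.
- exact/measurable_EFinP.
- by rewrite lee_fin ltW.
have mcf : measurable_fun setT (fun x => c%:E * (`|f x| `^ p)%:E)%E.
  by apply/measurable_EFinP; apply: measurable_funM.
have mA1 : measurable_fun setT (fun x => (\1_A x)%:E : \bar R).
  by apply/measurable_EFinP; exact: measurable_indic.
rewrite -[leLHS]mule1 -iA -(@tonelli_split _ _ _ mu (fun x => c%:E * (`|f x| `^ p)%:E)%E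
  (fun x => (\1_A x)%:E)).
- apply: ge0_le_integral => //.
  + by move=> z _; rewrite -!EFinM lee_fin mulr_ge0// mulr_ge0 ?powR_ge0// ltW.
  + apply: emeasurable_funM.
      exact: (measurableT_comp mcf measurable_fst).
    exact: (measurableT_comp mA1 measurable_snd).
  + by apply/measurable_EFinP; apply: measurable_powR_norm; exact: measurable_wdiff.
  move=> z _; rewrite -!EFinM lee_fin.
  rewrite indicE; have [|_] := boolP (z.2 \in A); last by rewrite mulr0 powR_ge0.
  rewrite inE => Az2; rewrite mulr1.
  have [Oz1|nOz1] := pselect (Om z.1); last first.
    by rewrite fO// normr0 powR0 ?gt_eqF// mulr0 powR_ge0.
  rewrite wdiff_powR (fO z.2) ?subr0; last by move=> /OmOm'; exact: AnO.
  rewrite ler_wpM2r ?powR_ge0// weight_out//; last exact: AnO.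
  rewrite /c ler_wpM2l//; apply: le_trans (k_lo z); rewrite ler_wpM2l ?invr_ge0 ?(ltW Lam0)//.
  have := HD _ _ Oz1 Az2; rewrite /riesz_kernel.
  have [e0|e0 eD] := eqVneq (en (z.1 - z.2)) 0.
    have /eqP := euclidean_norm_eq0 e0; rewrite subr_eq0 => /eqP e.
    by exfalso; apply: (AnO z.2) => //; apply: OmOm'; rewrite -e.
  have e1 : 0 < en (z.1 - z.2) by rewrite lt_neqAle eq_sym e0 euclidean_norm_ge0.
  rewrite lef_pV2 ?posrE ?powR_gt0//.
  by apply: ge0_ler_powR; rewrite ?nnegrE ?(ltW a0) ?(ltW e1) ?(ltW D0).
- by apply/measurable_EFinP; apply: measurable_funM.
- exact/measurable_EFinP.
- by move=> x; rewrite -EFinM lee_fin mulr_ge0 ?powR_ge0// ltW.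
- by move=> x; rewrite lee_fin.
Qed.

Lemma poincare_real : exists2 C : R, 0 <= C & forall f : Rn -> R, measurable_fun setT f ->
  vanish_out f -> Rintegrable mm (fun z => `|wdiff f z| `^ p) ->
  Rintegrable mu (fun x => `|f x| `^ p) /\
  \int[mu]_x (`|f x| `^ p) <= C * \int[mm]_z (`|wdiff f z| `^ p).
Proof.
have [C C0 HC] := poincare; exists C => // f mf fO fi.
have fin := integrable_fin_num measurableT fi.
have := HC f mf fO; rewrite -(fineK fin) -EFinM => h.
have i : Rintegrable mu (fun x => `|f x| `^ p).
  apply/Rintegrable_ge0P; [exact: measurable_powR_norm|move=> x; exact: powR_ge0|].
  exact: le_lt_trans h (ltry _).
by split => //; rewrite -lee_fin fineK// (integrable_fin_num measurableT i).
Qed.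

Definition tail_weight (y : Rn) : R := (1 + en y) `^ (- n%:R - s * p).
Local Notation om := tail_weight.

Lemma tail_weight_ge0 y : 0 <= om y. Proof. exact: powR_ge0. Qed.

Lemma measurable_tail_weight : measurable_fun setT om.
Proof.
apply: (measurableT_comp (measurable_powR _)).
by apply: measurable_funD => //; exact: measurable_euclidean_norm.
Qed.

Lemma Rintegrable_tail_weight : Rintegrable mu om.
Proof.
apply/Rintegrable_ge0P; [exact: measurable_tail_weight|exact: tail_weight_ge0|].
by apply: tail_weight_integrable; rewrite mulr_gt0.
Qed.

(** By [dist_weight_le] the kernel has no singularity on the exterior block and decays there like the
    weight of the tail space. *)
Lemma exterior_kernel : exists2 C : R, 0 <= C & forall z, Om z.1 -> ~ Om' z.2 ->
  k z <= C * om z.2.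
Proof.
have [c c0 Hc] := dist_weight_le bOm oOm' ccOm.
exists (Lam * c `^ (n%:R + s * p)) => [|z z1 z2].
  by rewrite mulr_ge0 ?powR_ge0// ltW.
apply: le_trans (k_hi z) _; rewrite -mulrA ler_wpM2l ?(ltW Lam0)//.
have h := Hc _ _ z1 z2.
have e1 : 0 < 1 + en z.2 by rewrite ltr_wpDr ?euclidean_norm_ge0.
have e2 : 0 < en (z.1 - z.2).
  by rewrite -(pmulr_rgt0 _ c0); exact: lt_le_trans h.
rewrite /riesz_kernel /tail_weight -opprD powRN ler_pdivlMr ?powR_gt0//.
rewrite mulrC ler_pdivrMr ?powR_gt0// -powRM ?(ltW c0) ?(ltW e2)//.
by apply: ge0_ler_powR; rewrite ?nnegrE ?(ltW a0) ?(ltW e1)// mulr_ge0 ?(ltW c0) ?(ltW e2).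
Qed.

Definition seminorm_density (f : Rn -> R) (z : Rn * Rn) : R :=
  \1_(Om' `*` Om') z * (k0 z * `|f z.1 - f z.2| `^ p).

Lemma seminorm_density_ge0 (f : Rn -> R) z : 0 <= seminorm_density f z.
Proof. by rewrite !mulr_ge0 ?riesz_kernel_ge0 ?powR_ge0. Qed.

Lemma measurable_seminorm_density (f : Rn -> R) : measurable_fun setT f ->
  measurable_fun setT (seminorm_density f).
Proof.
move=> mf; apply: measurable_funM.
  by apply: measurable_indic; exact: measurableX.
apply: measurable_funM; first exact: measurable_riesz_kernel.
by apply: measurable_powR_norm; exact: measurable_diff.
Qed.

Lemma wdiff_seminorm (f : Rn -> R) : measurable_fun setT f ->
  Rintegrable mm (fun z => `|wdiff f z| `^ p) -> Rintegrable mm (seminorm_density f).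
Proof.
move=> mf fi; apply: (@Rintegrable_le _ _ _ _ _ (fun z => Lam * `|wdiff f z| `^ p)).
- exact: measurable_seminorm_density.
- move=> z; rewrite ger0_norm ?seminorm_density_ge0// /seminorm_density indicE.
  have [|_] := boolP (z \in _); last by rewrite mul0r mulr_ge0 ?powR_ge0// ltW.
  rewrite inE => -[z1 z2]; rewrite mul1r wdiff_powR weight_in// mulrA ler_wpM2r ?powR_ge0//.
  by rewrite -ler_pdivrMl.
- exact: RintegrableZ.
Qed.

(** On the exterior block the energy density is at most a constant times [|f x|^p] times the tail
    weight of [y], a product of integrable functions. *)
Lemma seminorm_wdiff (f : Rn -> R) : measurable_fun setT f -> vanish_out f ->
  Rintegrable mu (fun x => `|f x| `^ p) -> Rintegrable mm (seminorm_density f) ->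
  Rintegrable mm (fun z => `|wdiff f z| `^ p).
Proof.
move=> mf fO f1 f2; have [C C0 HC] := exterior_kernel.
have [f3 _] := Rintegrable_prod f1 Rintegrable_tail_weight (fun x => powR_ge0 _ _) tail_weight_ge0.
apply: (@Rintegrable_le _ _ _ _ _ (fun z => Lam * seminorm_density f z +
   2 * C * (`|f z.1| `^ p * om z.2))).
- by apply: measurable_powR_norm; exact: measurable_wdiff.
- move=> z; rewrite ger0_norm ?powR_ge0// wdiff_powR.
  have r1 : 0 <= Lam * seminorm_density f z by rewrite mulr_ge0 ?seminorm_density_ge0// ltW.
  have r2 : 0 <= 2 * C * (`|f z.1| `^ p * om z.2).
    by rewrite !mulr_ge0 ?powR_ge0 ?tail_weight_ge0.
  have [[z1 z2]|nz] := pselect ((Om' `*` Om') z).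
    rewrite weight_in// ler_wpDr// /seminorm_density indicE mem_set// mul1r mulrA.
    by rewrite ler_wpM2r ?powR_ge0.
  have [[z1 z2]|nz'] := pselect ((Om `*` ~` Om') z).
    rewrite weight_out// ler_wpDl// (fO z.2) ?subr0; last by move=> /OmOm'.
    rewrite -!mulrA ler_wpM2l// [X in C * X]mulrC mulrA ler_wpM2r ?powR_ge0//.
    exact: HC.
  rewrite /weight !indicE !memNset// mulr0 addr0 mulr0 mul0r addr_ge0//.
- by apply: RintegrableD; apply: RintegrableZ.
Qed.

(** A limit of weighted differences in [L^p] is not visibly a weighted difference. The Poincare
    inequality makes the functions themselves Cauchy, a fast subsequence converges almost
    everywhere, and Fatou's lemma identifies the limit. The subsequence appears in the conclusion
    because pointwise constraints pass to the limit along it. *)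
Lemma energy_complete (F : nat -> Rn -> R) :
  (forall j, measurable_fun setT (F j)) -> (forall j, vanish_out (F j)) ->
  (forall j, Rintegrable mm (fun z => `|wdiff (F j) z| `^ p)) ->
  (forall e, 0 < e -> exists N, forall i j, (N <= i)%N -> (N <= j)%N ->
     \int[mm]_z (`|wdiff (F i) z - wdiff (F j) z| `^ p) < e) ->
  exists f : Rn -> R, [/\ measurable_fun setT f, vanish_out f,
    Rintegrable mm (fun z => `|wdiff f z| `^ p),
    forall e, 0 < e -> exists N, forall j, (N <= j)%N ->
      \int[mm]_z (`|wdiff (F j) z - wdiff f z| `^ p) < e &
    exists sg : nat -> nat, {ae mu, forall x, F (sg j) x @[j --> \oo] --> f x}].
Proof.
move=> mF vF iF cauchy.
have [Cp Cp0 HCp] := poincare_real.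
(* the rate asked for by ae_cvg_geometric *)
pose ep j : R := (2 `^ (- p)) ^+ j.
have ep0 j : 0 < ep j by rewrite exprn_gt0// powR_gt0.
have [M HM] := boolp.choice (fun j => cauchy _ (ep0 j)).
pose sg j := maxn j (\max_(i < j.+1) M i).
have sgM j i : (i <= j)%N -> (M i <= sg j)%N.
  move=> ij; rewrite /sg leq_max; apply/orP; right.
  exact: (leq_bigmax (Ordinal (ij : (i < j.+1)%N))).
have sgj j : (j <= sg j)%N by rewrite leq_maxl.
have iD i j : Rintegrable mm (fun z => `|wdiff (F i) z - wdiff (F j) z| `^ p).
  apply: (@Rintegrable_le _ _ _ _ _ (fun z => 2 `^ p * (`|wdiff (F i) z| `^ p + `|wdiff (F j) z| `^ p))).
  - by apply: measurable_powR_norm; apply: measurable_funB; exact: measurable_wdiff.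
  - move=> z; rewrite ger0_norm ?powR_ge0// -(normrN (wdiff (F j) z)).
    exact/powR_normD/ltW.
  - by apply: RintegrableZ; exact: RintegrableD.
have [Z [mZ Z0 HZ]] : {ae mu, forall x, cvgn (fun j => F (sg j) x)}.
  apply: (@ae_cvg_geometric _ _ _ _ p Cp) => // j.
  have e z : wdiff (F (sg j.+1) \- F (sg j)) z = wdiff (F (sg j.+1)) z - wdiff (F (sg j)) z by exact: wdiffB.
  have [|||h1 h2] := HCp (F (sg j.+1) \- F (sg j)).
  - exact: measurable_funB.
  - by move=> x Ox; rewrite /= !vF// subr0.
  - by under eq_fun do rewrite e; exact: iD.
  rewrite -[leLHS]fineK ?(integrable_fin_num measurableT h1)// lee_fin.
  apply: le_trans h2 _; rewrite ler_wpM2l//.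
  under eq_Rintegral do rewrite e.
  by apply: ltW; apply: (HM j); apply: sgM.
have nZ x : ~ Z x -> cvgn (fun j => F (sg j) x).
  by apply: contra_notP => nc; exact: HZ.
(* setting the functions to 0 on the null set of divergence makes the limit Borel *)
pose G j x := F (sg j) x * \1_(~` Z) x.
have GZ j x : ~ Z x -> G j x = F (sg j) x.
  by move=> Zx; rewrite /G indicE mem_set// mulr1.
have cG x : cvgn (fun j => G j x).
  have [Zx|Zx] := pselect (Z x).
    have -> : (fun j => G j x) = cst 0.
      by apply/funext => j; rewrite /G indicE memNset ?mulr0//; apply.
    exact: is_cvg_cst.
  by under eq_fun do rewrite GZ//; exact: nZ.
have mG j : measurable_fun setT (G j).
  by apply: measurable_funM => //; apply: measurable_indic; exact: measurableC.
pose f x := limn (fun j => G j x).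
have Gf x : G j x @[j --> \oo] --> f x by exact: cG.
have mf : measurable_fun setT f by apply: (measurable_fun_cvg mG) => x _; exact: Gf.
have vf : vanish_out f.
  move=> x Ox; apply: cvg_lim => //.
  have -> : (fun j => G j x) = cst 0 by apply/funext => j; rewrite /G vF// mul0r.
  exact: cvg_cst.
have aeG : {ae mu, forall x, forall j, G j x = F (sg j) x}.
  by exists Z; split => // x /=; apply: contra_notP => Zx j; exact: GZ.
have fat e N j : (forall i, (N <= i)%N -> \int[mm]_z (`|wdiff (F j) z - wdiff (F i) z| `^ p) < e) ->
    (\int[mm]_z (`|wdiff (F j) z - wdiff f z| `^ p)%:E <= e%:E)%E.
  move=> He; apply: (@fatou_le _ _ _ _ (fun i z => `|wdiff (F j) z - wdiff (G i) z| `^ p) _ _ N).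
  - by move=> i; apply: measurable_powR_norm; apply: measurable_funB; exact: measurable_wdiff.
  - by move=> i z; exact: powR_ge0.
  - move=> z.
    have cz : wdiff (F j) z - wdiff (G i) z @[i --> \oo] --> wdiff (F j) z - wdiff f z.
      apply: cvgB; first exact: cvg_cst.
      by apply: cvgM; [exact: cvg_cst|apply: cvgB; exact: Gf].
    exact: (cvg_comp _ _ cz (continuous_powR_norm p0 (x := _))).
  move=> i Ni.
  have -> : (\int[mm]_z (`|wdiff (F j) z - wdiff (G i) z| `^ p)%:E =
      \int[mm]_z (`|wdiff (F j) z - wdiff (F (sg i)) z| `^ p)%:E)%E.
    apply: ae_eq_integral_any.
    apply: filterS2 (ae_prod_fst aeG) (ae_prod_snd aeG) => z g1 g2.
    by rewrite /wdiff g1 g2.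
  rewrite -[leLHS]fineK ?(integrable_fin_num measurableT (iD _ _))// lee_fin.
  by apply: ltW; apply: He; rewrite (leq_trans Ni).
have iDf j : (exists N, forall i, (N <= i)%N -> \int[mm]_z (`|wdiff (F j) z - wdiff (F i) z| `^ p) < 1) ->
    Rintegrable mm (fun z => `|wdiff (F j) z - wdiff f z| `^ p).
  move=> [N HN]; apply/Rintegrable_ge0P.
  - by apply: measurable_powR_norm; apply: measurable_funB; exact: measurable_wdiff.
  - by move=> z; exact: powR_ge0.
  - exact: le_lt_trans (fat _ _ _ HN) (ltry _).
exists f; split => //.
- have [N HN] := cauchy 1 ltr01.
  have iN := iDf N (ex_intro _ N (fun i Ni => HN N i (leqnn N) Ni)).
  apply: (@Rintegrable_le _ _ _ _ _ (fun z => 2 `^ p * (`|wdiff (F N) z| `^ p + `|wdiff (F N) z - wdiff f z| `^ p))).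
  + by apply: measurable_powR_norm; exact: measurable_wdiff.
  + move=> z; rewrite ger0_norm ?powR_ge0// -(normrN (_ - _)).
    rewrite [X in `|X| `^ p <= _](_ : _ = wdiff (F N) z + - (wdiff (F N) z - wdiff f z)); last by ring.
    exact/powR_normD/ltW.
  + by apply: RintegrableZ; exact: RintegrableD.
- move=> e e0; have [N HN] := cauchy (Num.min (e / 2) 1) (ltac:(by rewrite lt_min ltr01 divr_gt0)).
  exists N => j Nj.
  have [e1 e2] : Num.min (e / 2) 1 <= e / 2 /\ Num.min (e / 2) 1 <= 1.
    by rewrite !ge_min !lexx orbT.
  have iN := iDf j (ex_intro _ N (fun i Ni => lt_le_trans (HN j i Nj Ni) e2)).
  have := fat _ _ j (fun i Ni => HN j i Nj Ni).
  rewrite -[X in (X <= _)%E]fineK ?(integrable_fin_num measurableT iN)// lee_fin => h.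
  apply: le_lt_trans h _; apply: le_lt_trans e1 _.
  by rewrite ltr_pdivrMr// ltr_pMr// ltr1n.
- exists sg; apply: filterS aeG => x hx.
  by have := Gf x; under eq_fun do rewrite hx.
Qed.

(** * Minimisation around a base function *)

Section base.
Variable u0 : Rn -> R.
Hypothesis mu0 : measurable_fun setT u0.
Hypothesis u0Lp : Rintegrable mu (fun x => \1_Om x * `|u0 x| `^ p).
Hypothesis u0semi : Rintegrable mm (seminorm_density u0).
Hypothesis u0tail : Rintegrable mu (fun y => `|u0 y| `^ (p - 1) * om y).

(** On [Om' * Om'] Young's inequality and the finite seminorm of [u0] suffice. On the exterior block
    [|u0 x - u0 y|^(p-1)] splits into a function of [x] and a function of [y]; after multiplication
    by [|f x|] and the kernel, each product has an [x]-factor integrable over [Om] and a [y]-factor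
    with finite tail. A tail of order [p - 1] is just what this needs. *)
Lemma moment_bound : exists2 A : R, 0 <= A & forall f : Rn -> R, measurable_fun setT f ->
  vanish_out f -> Rintegrable mm (fun z => `|wdiff f z| `^ p) ->
  Rintegrable mm (fun z => `|wdiff u0 z| `^ (p - 1) * `|wdiff f z|) /\
  \int[mm]_z (`|wdiff u0 z| `^ (p - 1) * `|wdiff f z|) <=
    A * (\int[mm]_z (`|wdiff f z| `^ p) + 1).
Proof.
have [C C0 HC] := exterior_kernel.
have [Cp Cp0 HCp] := poincare_real.
pose T : R := 2 * (C * 2 `^ (p - 1)).
have T0 : 0 <= T by rewrite !mulr_ge0 ?powR_ge0.
pose G y := om y + `|u0 y| `^ (p - 1) * om y.
have iG : Rintegrable mu G by apply: RintegrableD => //; exact: Rintegrable_tail_weight.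
have G0 y : 0 <= G y.
  by rewrite addr_ge0 ?mulr_ge0 ?powR_ge0 ?tail_weight_ge0.
have iOm : Rintegrable mu \1_Om.
  apply/Rintegrable_ge0P => //; rewrite integral_indic// setIT.
  exact: bounded_lebesgue_lty.
pose I1 := \int[mm]_z seminorm_density u0 z.
pose IG := \int[mu]_y G y.
pose I2 := \int[mu]_x (\1_Om x + \1_Om x * `|u0 x| `^ p).
have IG0 : 0 <= IG by exact: rint_ge0.
have I10 : 0 <= I1 by apply: rint_ge0 => z; exact: seminorm_density_ge0.
have I20 : 0 <= I2 by apply: rint_ge0 => z; rewrite addr_ge0// mulr_ge0// powR_ge0.
exists (Lam * I1 + 1 + T * (I2 * IG) + T * (Cp * IG)) => [|f mf fO fi].
  have := mulr_ge0 (ltW Lam0) I10; have := mulr_ge0 T0 (mulr_ge0 I20 IG0).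
  have := mulr_ge0 T0 (mulr_ge0 Cp0 IG0).
  by move: (T * _) (T * _) (Lam * _) => b1 b2 b3 h1 h2 h3; rewrite !addr_ge0.
have [fp Hfp] := HCp f mf fO fi.
pose F x := \1_Om x + \1_Om x * `|u0 x| `^ p + `|f x| `^ p.
have iF1 : Rintegrable mu (fun x => \1_Om x + \1_Om x * `|u0 x| `^ p) by exact: RintegrableD.
have iF : Rintegrable mu F by exact: RintegrableD.
have F0 x : 0 <= F x by rewrite !addr_ge0 ?mulr_ge0 ?powR_ge0.
have [iFG eFG] := Rintegrable_prod iF iG F0 G0.
pose rhs z := Lam * seminorm_density u0 z + `|wdiff f z| `^ p + T * (F z.1 * G z.2).
have irhs1 : Rintegrable mm (fun z => Lam * seminorm_density u0 z + `|wdiff f z| `^ p).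
  by apply: RintegrableD => //; exact: RintegrableZ.
have irhs : Rintegrable mm rhs by apply: RintegrableD => //; exact: RintegrableZ.
have le z : `|wdiff u0 z| `^ (p - 1) * `|wdiff f z| <= rhs z.
  have r1 : 0 <= Lam * seminorm_density u0 z by rewrite mulr_ge0 ?seminorm_density_ge0// ltW.
  have r2 : 0 <= T * (F z.1 * G z.2) by rewrite !mulr_ge0.
  have r3 : 0 <= `|wdiff f z| `^ p by exact: powR_ge0.
  have [[z1 z2]|nz] := pselect ((Om' `*` Om') z).
    rewrite ler_wpDr//; apply: le_trans (young_crude p1 _ _) _ => //.
    rewrite lerD2r wdiff_powR weight_in// /seminorm_density indicE mem_set// mul1r mulrA.
    by rewrite ler_wpM2r ?powR_ge0.
  have [[z1 z2]|nz'] := pselect ((Om `*` ~` Om') z).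
    rewrite ler_wpDl ?addr_ge0//.
    have -> : `|wdiff u0 z| `^ (p - 1) * `|wdiff f z| =
        weight z * (`|u0 z.1 - u0 z.2| `^ (p - 1) * `|f z.1|).
      rewrite /wdiff (fO z.2) ?subr0; last by move=> /OmOm'.
      rewrite !normrM (ger0_norm (wroot_ge0 z)) powRM ?wroot_ge0// mulrACA.
      by rewrite -powRS ?wroot_ge0// wrootK.
    have hk := HC _ z1 z2.
    have eG : G z.2 = om z.2 * (1 + `|u0 z.2| `^ (p - 1)).
      by rewrite /G mulrDr mulr1 [X in _ + X]mulrC.
    have -> : T * (F z.1 * G z.2) =
        2 * (C * om z.2 * (2 `^ (p - 1) * (F z.1 * (1 + `|u0 z.2| `^ (p - 1))))).
      by rewrite eG /T; ring.
    rewrite weight_out// -mulrA ler_wpM2l//.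
    apply: (@le_trans _ _ (C * om z.2 * (`|u0 z.1 - u0 z.2| `^ (p - 1) * `|f z.1|))).
      by rewrite ler_wpM2r// mulr_ge0// powR_ge0.
    rewrite ler_wpM2l ?(mulr_ge0 C0 (tail_weight_ge0 _))//.
    have hu := powR_normD (u0 z.1) (- u0 z.2) (ltW pB0).
    rewrite normrN in hu.
    apply: le_trans (ler_wpM2r (normr_ge0 (f z.1)) hu) _.
    rewrite -mulrA ler_wpM2l ?powR_ge0// /F indicE mem_set// mul1r [true%:R]mulr1n.
    have y1 := young_crude p1 (normr_ge0 (u0 z.1)) (normr_ge0 (f z.1)).
    have y2 : `|f z.1| <= 1 + `|f z.1| `^ p.
      have [f1|f1] := leP `|f z.1| 1; first by rewrite ler_wpDr// powR_ge0.
      by rewrite ler_wpDl//; apply: le1r_powR; exact: ltW.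
    exact: product_absorb y1 y2 (powR_ge0 _ _) (powR_ge0 _ _).
  rewrite {1}/wdiff /wroot /weight !indicE !memNset// mulr0 addr0 mulr0.
  rewrite powR0 ?invr_eq0 ?gt_eqF// !mul0r normr0 powR0 ?gt_eqF// mul0r.
  by rewrite !addr_ge0.
have mlhs : measurable_fun setT (fun z => `|wdiff u0 z| `^ (p - 1) * `|wdiff f z|).
  apply: measurable_funM; first by apply: measurable_powR_norm; exact: measurable_wdiff.
  by apply: measurableT_comp => //; exact: measurable_wdiff.
have ilhs : Rintegrable mm (fun z => `|wdiff u0 z| `^ (p - 1) * `|wdiff f z|).
  by apply: Rintegrable_le mlhs _ irhs => z; rewrite ger0_norm// mulr_ge0// powR_ge0.
split => //; apply: le_trans (rint_le ilhs irhs le) _.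
rewrite /rhs rintD//; last exact: RintegrableZ.
rewrite rintD//; last exact: RintegrableZ.
rewrite !rintZ// -/I1 eFG -/IG /F rintD// -/I2.
have Nf0 : 0 <= \int[mm]_z (`|wdiff f z| `^ p) by apply: rint_ge0 => z; exact: powR_ge0.
move: Hfp Nf0; set Mf := Rintegral _ _ _; set Nf := Rintegral _ _ _ => Hfp Nf0.
have h3 : T * (Mf * IG) <= T * (Cp * IG) * Nf.
  rewrite (_ : T * (Cp * IG) * Nf = T * (Cp * Nf * IG)); last by ring.
  exact: (ler_wpM2l T0 (ler_wpM2r IG0 Hfp)).
rewrite (_ : T * ((I2 + Mf) * IG) = T * (I2 * IG) + T * (Mf * IG)); last by ring.
exact: affine_absorb (mulr_ge0 (ltW Lam0) I10) (mulr_ge0 T0 (mulr_ge0 I20 IG0))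
  (mulr_ge0 T0 (mulr_ge0 Cp0 IG0)) Nf0 h3.
Qed.

Definition competitor (f : Rn -> R) :=
  [/\ measurable_fun setT f, vanish_out f & Rintegrable mm (fun z => `|wdiff f z| `^ p)].

Lemma competitor_comb f g t : competitor f -> competitor g ->
  competitor (fun x => f x + t * (g x - f x)).
Proof.
move=> [mf vf i_f] [mg vg i_g]; split.
- by apply: measurable_funD => //; apply: measurable_funM => //; exact: measurable_funB.
- by move=> x Ox; rewrite vf// vg// subr0 mulr0 addr0.
apply: (@Rintegrable_le _ _ _ _ _ (fun z => 2 `^ p * (`|1 - t| `^ p * `|wdiff f z| `^ p + `|t| `^ p * `|wdiff g z| `^ p))).
- apply: measurable_powR_norm; apply: measurable_wdiff.
  by apply: measurable_funD => //; apply: measurable_funM => //; exact: measurable_funB.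
- move=> z; rewrite ger0_norm ?powR_ge0// -!powRM// -!normrM.
  rewrite (_ : wdiff _ z = (1 - t) * wdiff f z + t * wdiff g z); last by rewrite /wdiff; ring.
  exact/powR_normD/ltW.
- by apply: RintegrableZ; apply: RintegrableD; exact: RintegrableZ.
Qed.

Lemma competitorB f g : competitor f -> competitor g -> competitor (f \- g).
Proof.
move=> [mf vf i_f] [mg vg i_g]; split.
- exact: measurable_funB.
- by move=> x Ox; rewrite /= vf// vg// subr0.
apply: (@Rintegrable_le _ _ _ _ _ (fun z => 2 `^ p * (`|wdiff f z| `^ p + `|wdiff g z| `^ p))).
- by apply: measurable_powR_norm; apply: measurable_wdiff; exact: measurable_funB.
- move=> z; rewrite ger0_norm ?powR_ge0// wdiffB -(normrN (wdiff g z)).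
  exact/powR_normD/ltW.
- by apply: RintegrableZ; exact: RintegrableD.
Qed.

(** Applied to [t * f], the two terms of [moment_bound] scale differently; dividing by [t] exhibits the
    free parameter of the abstract variational inequality. *)
Lemma moment_scaled : exists2 A : R, 0 <= A & forall f, competitor f ->
  Rintegrable mm (fun z => `|wdiff u0 z| `^ (p - 1) * `|wdiff f z|) /\
  forall t, 0 < t -> \int[mm]_z (`|wdiff u0 z| `^ (p - 1) * `|wdiff f z|) <=
    A * (t `^ (p - 1) * \int[mm]_z (`|wdiff f z| `^ p) + t^-1).
Proof.
have [A A0 HA] := moment_bound; exists A => // f [mf vf i_f].
have [im _] := HA f mf vf i_f; split => // t t0.
have et z : wdiff (fun x => t * f x) z = t * wdiff f z by rewrite /wdiff; ring.
have etp z : `|wdiff (fun x => t * f x) z| `^ p = t `^ p * `|wdiff f z| `^ p.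
  by rewrite et normrM (gtr0_norm t0) powRM// ltW.
have [||_] := HA (fun x => t * f x) (measurable_funM (measurable_cst _) mf).
- by move=> x Ox; rewrite vf// mulr0.
- by under eq_fun do rewrite etp; exact: RintegrableZ.
have -> : \int[mm]_z (`|wdiff (fun x => t * f x) z| `^ p) = t `^ p * \int[mm]_z (`|wdiff f z| `^ p).
  by under eq_Rintegral do rewrite etp; exact: rintZ.
have -> : \int[mm]_z (`|wdiff u0 z| `^ (p - 1) * `|wdiff (fun x => t * f x) z|) =
    t * \int[mm]_z (`|wdiff u0 z| `^ (p - 1) * `|wdiff f z|).
  rewrite -rintZ//; apply: eq_Rintegral => z _.
  by rewrite et (normrM t) (gtr0_norm t0) mulrCA.
move=> h; rewrite -(ler_pM2l t0); apply: le_trans h _.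
rewrite mulrCA ler_wpM2l// mulrDr mulfV ?gt_eqF// lerD2r.
by rewrite mulrA (powRS p1 (ltW t0)) [t * _]mulrC.
Qed.

Lemma pairing_Rintegrable f g : competitor f -> competitor g ->
  Rintegrable mm (fun z => dpow p (wdiff u0 z + wdiff f z) * wdiff g z).
Proof.
move=> [mf vf i_f] Cg; have [mg vg i_g] := Cg.
have [A A0 /(_ _ Cg)[im _]] := moment_scaled.
apply: (@Rintegrable_le _ _ _ _ _ (fun z => 2 `^ (p - 1) *
    (`|wdiff u0 z| `^ (p - 1) * `|wdiff g z| + (`|wdiff f z| `^ p + `|wdiff g z| `^ p)))).
- apply: measurable_funM; last exact: measurable_wdiff.
  apply: (@measurableT_comp _ _ _ _ _ _ (dpow p)).
    by apply: continuous_measurable_fun; exact: continuous_dpow.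
  by apply: measurable_funD; exact: measurable_wdiff.
- move=> z; have := dpow_add_le p1 (wdiff u0 z) (wdiff f z) (wdiff g z) ltr01.
  by rewrite powR1 divr1 mul1r.
- by apply: RintegrableZ; apply: RintegrableD => //; exact: RintegrableD.
Qed.

(** The obstacle condition is convex and survives almost everywhere limits, so the admissible
    competitors form a set to which the abstract variational inequality applies. *)
Lemma competitor_minimizer (h : Rn -> \bar R) :
  {ae mu, forall x, Om x -> (h x <= (u0 x)%:E)%E} ->
  exists2 f, competitor f /\ {ae mu, forall x, Om x -> (h x <= (u0 x + f x)%:E)%E} &
    forall g, competitor g -> {ae mu, forall x, Om x -> (h x <= (u0 x + g x)%:E)%E} ->
      0 <= \int[mm]_z (dpow p (wdiff u0 z + wdiff f z) * (wdiff g z - wdiff f z)).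
Proof.
move=> hu0.
pose adm f := competitor f /\ {ae mu, forall x, Om x -> (h x <= (u0 x + f x)%:E)%E}.
have [A A0 HA] := moment_scaled.
have mwu0 : measurable_fun setT (wdiff u0) by exact: measurable_wdiff.
pose S := [set wdiff f | f in adm].
have mS F : S F -> measurable_fun setT F.
  by move=> [f [[mf vf i_f] _] <-]; exact: measurable_wdiff.
have lpS F : S F -> Rintegrable mm (fun z => `|F z| `^ p) by move=> [f [[mf vf i_f] _] <-].
have S0 : S (cst 0).
  exists (cst 0); last by apply/funext => z; rewrite /wdiff subrr mulr0.
  split; last by apply: filterS hu0 => x; rewrite addr0.
  split => //; have -> : (fun z => `|wdiff (cst 0) z| `^ p) = cst 0.
    by apply/funext => z; rewrite /wdiff subrr mulr0 normr0 powR0// gt_eqF.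
  exact: Rintegrable0.
have convS F G t : S F -> S G -> 0 <= t <= 1 -> S (fun z => F z + t * (G z - F z)).
  move=> [f [Cf hf] <-] [g [Cg hg] <-] /andP[t0 t1].
  exists (fun x => f x + t * (g x - f x)); last by apply/funext => z; rewrite /wdiff; ring.
  split; first exact: competitor_comb.
  apply: filterS2 hf hg => x hf hg Ox.
  have [fg|gf] := leP (f x) (g x).
    by apply: le_trans (hf Ox) _; rewrite lee_fin lerD2l lerDl mulr_ge0// subr_ge0.
  apply: le_trans (hg Ox) _; rewrite lee_fin lerD2l.
  have : 0 <= (1 - t) * (f x - g x) by rewrite mulr_ge0// subr_ge0// ltW.
  lra.
have growthS F G : S F -> S G ->
    Rintegrable mm (fun z => `|wdiff u0 z| `^ (p - 1) * `|F z - G z|) /\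
    forall t, 0 < t -> \int[mm]_z (`|wdiff u0 z| `^ (p - 1) * `|F z - G z|) <=
      A * (t `^ (p - 1) * \int[mm]_z (`|F z - G z| `^ p) + t^-1).
  move=> [f [Cf _] <-] [g [Cg _] <-].
  have e : (fun z => wdiff f z - wdiff g z) = wdiff (f \- g).
    by apply/funext => z; rewrite wdiffB.
  have := HA _ (competitorB Cf Cg); rewrite -e; exact.
have complS (F : nat -> Rn * Rn -> R) : (forall j, S (F j)) ->
    (forall e, 0 < e -> exists N, forall i j, (N <= i)%N -> (N <= j)%N ->
      \int[mm]_z (`|F i z - F j z| `^ p) < e) ->
    exists2 G, S G & forall e, 0 < e -> exists N, forall j, (N <= j)%N ->
      \int[mm]_z (`|F j z - G z| `^ p) < e.
  move=> SF cauchy.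
  have SF' j : exists f, adm f /\ wdiff f = F j by have [f] := SF j; exists f.
  have [f Hf] := boolp.choice SF'.
  have [] := @energy_complete f.
  - by move=> j; have [[[]]] := Hf j.
  - by move=> j; have [[[]]] := Hf j.
  - by move=> j; have [[[]]] := Hf j.
  - move=> e e0; have [N HN] := cauchy e e0; exists N => i j Ni Nj.
    by have [_ ->] := Hf i; have [_ ->] := Hf j; exact: HN.
  move=> g [mg vg i_g cg [sg hsg]].
  exists (wdiff g).
    exists g => //; split => //.
    have := ae_foralln (fun j => (Hf (sg j)).1.2).
    apply: filterS2 hsg => x cx hx Ox.
    have cE : (u0 x + f (sg j) x)%:E @[j --> \oo] --> (u0 x + g x)%:E.
      apply: cvg_EFin; first exact: nearW.
      by apply: cvgD => //; exact: cvg_cst.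
    apply: (@closed_cvg _ _ _ eventually_filter _ _ (@closed_ereal_le_ereal R (h x)) _ _ cE).
    by apply: nearW => j; exact: hx.
  move=> e e0; have [N HN] := cg e e0; exists N => j Nj.
  by have [_ <-] := Hf j; exact: HN.
have [_ [f [Cf hf] <-] Hf] := @monotone_variational_inequality _ _ _ mm p p1
  (wdiff u0) mwu0 S mS lpS S0 convS A A0 growthS complS.
exists f => // g Cg hg; apply: Hf.
by exists g.
Qed.

Lemma competitor_unique f g : competitor f -> competitor g ->
  0 <= \int[mm]_z (dpow p (wdiff u0 z + wdiff f z) * (wdiff g z - wdiff f z)) ->
  0 <= \int[mm]_z (dpow p (wdiff u0 z + wdiff g z) * (wdiff f z - wdiff g z)) ->
  {ae mu, forall x, f x = g x}.
Proof.
move=> Cf Cg h1 h2.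
have [md vd _] := competitorB Cf Cg.
have sub f1 f2 z : wdiff u0 z + wdiff f1 z - (wdiff u0 z + wdiff f2 z) =
    wdiff (f1 \- f2) z by rewrite wdiffB; ring.
have i_pair f1 f2 : competitor f1 -> competitor f2 ->
    Rintegrable mm (fun z => dpow p (wdiff u0 z + wdiff f1 z) *
      (wdiff u0 z + wdiff f2 z - (wdiff u0 z + wdiff f1 z))).
  move=> C1 C2; under eq_fun do rewrite sub.
  by apply: pairing_Rintegrable => //; exact: competitorB.
have ge_pair f1 f2 :
    0 <= \int[mm]_z (dpow p (wdiff u0 z + wdiff f1 z) * (wdiff f2 z - wdiff f1 z)) ->
    0 <= \int[mm]_z (dpow p (wdiff u0 z + wdiff f1 z) *
      (wdiff u0 z + wdiff f2 z - (wdiff u0 z + wdiff f1 z))).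
  by under [X in _ -> _ <= X]eq_Rintegral do rewrite sub wdiffB.
have aefg := pairing_unique p1 (i_pair _ _ Cf Cg) (i_pair _ _ Cg Cf)
  (ge_pair _ _ h1) (ge_pair _ _ h2).
have ae0 : {ae mm, forall z, `|wdiff (f \- g) z| `^ p = 0}.
  apply: filterS aefg => z e.
  by rewrite -sub e subrr normr0 powR0// gt_eqF.
have E0 : (\int[mm]_z (`|wdiff (f \- g) z| `^ p)%:E = 0)%E.
  rewrite (@ae_eq_integral_any _ _ _ _ _ (cst 0%E)) ?integral0//.
  by apply: filterS ae0 => z ->.
have [C C0 HC] := poincare; have := HC _ md vd; rewrite E0 mule0 => le0.
have mdp : measurable_fun setT (fun x => (`|(f \- g) x| `^ p)%:E).
  by apply/measurable_EFinP; exact: measurable_powR_norm.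
have : (\int[mu]_x `|(`|(f \- g) x| `^ p)%:E| = 0)%E.
  apply/eqP; rewrite eq_le; apply/andP; split; last exact: integral_ge0.
  apply: le_trans le0; rewrite le_eqVlt; apply/orP; left; apply/eqP.
  by apply: eq_integral => x _; rewrite gee0_abs// lee_fin powR_ge0.
move=> /(ae_eq_integral_abs _ measurableT mdp); apply: filterS => x /(_ I) [].
by move=> /powR_eq0_eq0 /eqP; rewrite normr_eq0 subr_eq0 => /eqP.
Qed.

End base.
End energy_space.

(** * Borel representatives of Sobolev functions *)

Lemma integral_indicM d (T : measurableType d) (R : realType)
    (mu : {measure set T -> \bar R}) (D : set T) (f : T -> R) :
  (\int[mu]_(x in D) (f x)%:E = \int[mu]_x (\1_D x * f x)%:E)%E.
Proof.
rewrite integral_mkcond; apply: eq_integral => x _.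
by rewrite patchE indicE; case: ifPn => _; rewrite ?mul1r ?mul0r.
Qed.

Section sobolev_class.
Context {R : realType} {n : nat}.
Local Notation Rn := 'rV[R]_n.
Local Notation mu := (@lebesgue_rV R n).
Local Notation mm := (mu \x mu)%E.
Local Notation en := (@euclidean_norm R n).
Variables (s p : R).
Hypotheses (s0 : 0 < s) (p1 : 1 < p).
Let p0 : 0 < p. Proof. by rewrite (lt_trans _ p1). Qed.

Lemma Wsp_norm_borel (U : set Rn) (v w : Rn -> R) : open U -> measurable_fun setT w ->
  {ae mu, forall x, U x -> v x = w x} ->
  (Wsp_norm s p U v < +oo)%E <->
  Rintegrable mu (fun x => \1_U x * `|w x| `^ p) /\ Rintegrable mm (seminorm_density s p U w).
Proof.
move=> oU mw vw; have mU := open_rV_measurable oU.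
have e1 : (\int[mu]_(x in U) (`|v x| `^ p)%:E = \int[mu]_x (\1_U x * `|w x| `^ p)%:E)%E.
  rewrite -integral_indicM; apply: ae_eq_integral_in.
  by apply: filterS vw => x vw Ux; rewrite vw.
have e2 : (\int[mm]_(z in U `*` U) (`|v z.1 - v z.2| `^ p / en (z.1 - z.2) `^ (n%:R + s * p))%:E =
    \int[mm]_z (seminorm_density s p U w z)%:E)%E.
  rewrite -integral_indicM; apply: ae_eq_integral_in.
  apply: filterS2 (ae_prod_fst vw) (ae_prod_snd vw) => z h1 h2 [U1 U2].
  by rewrite h1// h2// mulrC.
have m1 : measurable_fun setT (fun x => \1_U x * `|w x| `^ p).
  by apply: measurable_funM; [exact: measurable_indic|exact: measurable_powR_norm].
have m2 : measurable_fun setT (seminorm_density s p U w).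
  exact: measurable_seminorm_density.
rewrite /Wsp_norm e1 e2.
have q0 : p^-1 != 0 by rewrite invr_eq0 gt_eqF.
split=> [lt|[/Rintegrable_ge0P-/(_ m1) r1 /Rintegrable_ge0P-/(_ m2) r2]].
  split; apply/Rintegrable_ge0P => //.
  - apply: (lty_poweRy q0); apply: le_lt_trans lt.
    by rewrite leeDl// poweR_ge0.
  - by move=> z; exact: seminorm_density_ge0.
  - apply: (lty_poweRy q0); apply: le_lt_trans lt.
    by rewrite leeDr// poweR_ge0.
apply: lte_add_pinfty; apply: poweR_lty.
  by apply: r1 => x; rewrite mulr_ge0// powR_ge0.
by apply: r2 => z; exact: seminorm_density_ge0.
Qed.

Lemma Wsp_borel (U : set Rn) (v : Rn -> R) : open U -> Wsp s p U v ->
  exists w : Rn -> R, [/\ measurable_fun setT w, {ae mu, forall x, U x -> v x = w x},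
    Rintegrable mu (fun x => \1_U x * `|w x| `^ p) & Rintegrable mm (seminorm_density s p U w)].
Proof.
move=> oU [/completed_measurable_funP[w mw vw] fin].
by exists w; have [] := (Wsp_norm_borel oU mw vw).1 fin.
Qed.

Lemma borel_Wsp (U : set Rn) (v w : Rn -> R) : open U -> measurable_fun setT w ->
  {ae mu, forall x, U x -> v x = w x} ->
  Rintegrable mu (fun x => \1_U x * `|w x| `^ p) -> Rintegrable mm (seminorm_density s p U w) ->
  Wsp s p U v.
Proof.
move=> oU mw vw i1 i2; split; last exact/(Wsp_norm_borel oU mw vw).
by apply: (ae_measurable_completed _ mw vw); exact: open_rV_measurable.
Qed.

Lemma Wsp_sub (U V : set Rn) (v : Rn -> R) : open U -> open V -> V `<=` U ->
  Wsp s p U v -> Wsp s p V v.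
Proof.
move=> oU oV VU /(Wsp_borel oU)[w [mw vw i1 i2]].
have mV := open_rV_measurable oV.
have le1 T (A B : set T) (x : T) : A `<=` B -> \1_A x <= \1_B x :> R.
  move=> AB; rewrite !indicE; have [/set_mem/AB/mem_set->//|_] := boolP (x \in A); exact: ler0n.
apply: (borel_Wsp oV mw).
- by apply: filterS vw => x vw /VU.
- apply: Rintegrable_le i1 => [|x].
    by apply: measurable_funM; [exact: measurable_indic|exact: measurable_powR_norm].
  by rewrite ger0_norm ?mulr_ge0 ?powR_ge0// ler_wpM2r ?powR_ge0// le1.
- apply: Rintegrable_le i2 => [|z]; first exact: measurable_seminorm_density.
  rewrite ger0_norm ?seminorm_density_ge0// ler_wpM2r ?mulr_ge0 ?riesz_kernel_ge0 ?powR_ge0//.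
  by apply: le1 => -[x y] [/VU ? /VU ?].
Qed.

Lemma tail_weight_le1 (y : Rn) : tail_weight s p y <= 1.
Proof.
rewrite /tail_weight -opprD powRN invf_le1 ?powR_gt0 ?ltr_wpDr ?euclidean_norm_ge0//.
apply: (@le_trans _ _ (1 `^ (n%:R + s * p))); first by rewrite powR1.
apply: ge0_ler_powR; rewrite ?nnegrE ?lerDl ?addr_ge0 ?euclidean_norm_ge0//.
by rewrite mulr_ge0// ltW.
Qed.

Lemma tail_weight_bounded (C : set Rn) : bounded_set C ->
  exists2 c, 0 < c & forall x, C x -> c <= tail_weight s p x.
Proof.
move=> /bounded_set_coord[M M0 HM].
have D0 : 0 < 1 + n%:R * M by rewrite ltr_wpDr// mulr_ge0// ltW.
exists ((1 + n%:R * M) `^ (- n%:R - s * p)) => [|x Cx]; first exact: powR_gt0.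
have e0 : 0 < 1 + en x by rewrite ltr_wpDr ?euclidean_norm_ge0.
rewrite /tail_weight -opprD !powRN lef_pV2 ?posrE ?powR_gt0//.
apply: ge0_ler_powR; rewrite ?nnegrE ?(ltW D0) ?(ltW e0)//.
  by rewrite addr_ge0// mulr_ge0// ltW.
by rewrite lerD2l; apply: euclidean_norm_le; [exact: ltW|exact: HM].
Qed.

(** The tail weight is bounded below on compact sets, so the tail condition implies local
    integrability. *)
Lemma tail_space_borel (u w : Rn -> R) : measurable_fun setT w ->
  {ae mu, forall x, u x = w x} ->
  tail_space s p u <-> Rintegrable mu (fun y => `|w y| `^ (p - 1) * tail_weight s p y).
Proof.
move=> mw uw.
have mw1 : measurable_fun setT (fun x => `|w x| `^ (p - 1)) by exact: measurable_powR_norm.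
have m1 : measurable_fun setT (fun y => `|w y| `^ (p - 1) * tail_weight s p y).
  by apply: measurable_funM => //; exact: measurable_tail_weight.
have g0 y : 0 <= `|w y| `^ (p - 1) * tail_weight s p y.
  by rewrite mulr_ge0 ?powR_ge0.
have e : (\int[mu]_x (`|u x| `^ (p - 1) * (1 + en x) `^ (- n%:R - s * p))%:E =
    \int[mu]_x (`|w x| `^ (p - 1) * tail_weight s p x)%:E)%E.
  by apply: ae_eq_integral_any; apply: filterS uw => x ->.
split=> [[_ _ fin]|i_w].
  by apply/(Rintegrable_ge0P _ m1 g0); rewrite -e.
split.
- by apply: (ae_measurable_completed measurableT mw); apply: filterS uw.
- move=> C cC; have mC : measurable C by apply: closed_rV_measurable; exact: compact_closed.
  have [c c0 Hc] := tail_weight_bounded (compact_bounded cC).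
  rewrite (@ae_eq_integral_in _ _ _ _ _ _ (fun x => (`|w x| `^ (p - 1))%:E)); last first.
    by apply: filterS uw => x ->.
  rewrite integral_indicM; apply/Rintegrable_ge0P.
  + by apply: measurable_funM => //; exact: measurable_indic.
  + by move=> x; rewrite mulr_ge0// powR_ge0.
  apply: Rintegrable_le (RintegrableZ c^-1 i_w) => [|x].
    by apply: measurable_funM => //; exact: measurable_indic.
  rewrite ger0_norm ?(mulr_ge0 (ler0n _ _) (powR_ge0 _ _))// indicE.
  have [/set_mem Cx|_] := boolP (x \in C); last first.
    by rewrite mul0r (mulr_ge0 _ (g0 x))// invr_ge0 (ltW c0).
  rewrite mul1r mulrCA (ler_peMr (powR_ge0 _ _))//.
  by rewrite mulrC (ler_pdivlMr _ _ c0) mul1r (Hc _ Cx).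
- by rewrite e; apply/(Rintegrable_ge0P _ m1 g0).
Qed.

End sobolev_class.

(** * The obstacle class and its form *)

Lemma rintE d (T : measurableType d) (R : realType) (mu : {measure set T -> \bar R})
    (f : T -> R) :
  Rintegrable mu f -> (\int[mu]_x (f x)%:E = (\int[mu]_x f x)%:E)%E.
Proof. by move=> i; rewrite fineK// (integrable_fin_num measurableT i). Qed.

Lemma Rintegrable_indicM d (T : measurableType d) (R : realType) (mu : {measure set T -> \bar R})
    (D : set T) (f : T -> R) :
  measurable D -> Rintegrable mu f -> Rintegrable mu (fun x => \1_D x * f x).
Proof.
move=> mD i_f; apply: Rintegrable_le (Rintegrable_norm i_f) => [|x].
  by apply: measurable_funM; [exact: measurable_indic|exact: Rintegrable_meas i_f].
by rewrite normrM ler_piMl// indicE normr_nat lern1 leq_b1.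
Qed.

Lemma Rintegrable_swap d (T : measurableType d) (R : realType)
    (mu : {sigma_finite_measure set T -> \bar R}) (f : T * T -> R) :
  Rintegrable (mu \x mu)%E f -> Rintegrable (mu \x mu)%E (fun z => f (z.2, z.1)) /\
  \int[(mu \x mu)%E]_z f (z.2, z.1) = \int[(mu \x mu)%E]_z f z.
Proof.
move=> i_f; have mf := Rintegrable_meas i_f.
have mf' : measurable_fun setT (fun z => f (z.2, z.1)).
  by apply: (measurableT_comp mf); exact: measurable_swap_prod.
split; last first.
  rewrite /Rintegral; congr fine; apply: (integral_swap mu (f := EFin \o f)).
  exact/measurable_EFinP.
apply/integrableP; split; first exact/measurable_EFinP.
have /integrableP[_] := i_f.
rewrite -(ge0_integral_swap mu (f := fun z => `|(f z)%:E|%E))//.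
by apply: measurableT_comp => //; exact/measurable_EFinP.
Qed.

Section obstacle.
Context {R : realType} {n : nat}.
Local Notation Rn := 'rV[R]_n.
Local Notation mu := (@lebesgue_rV R n).
Local Notation mm := (mu \x mu)%E.
Variables (s p Lam : R) (k : Rn * Rn -> R) (K : Rn -> Rn -> R) (Om Om' : set Rn).
Variables (g gb : Rn -> R) (h : Rn -> \bar R).
Hypotheses (n0 : (0 < n)%N) (s0 : 0 < s) (p1 : 1 < p) (Lam0 : 0 < Lam).
Hypothesis mk : measurable_fun setT k.
Hypothesis k_lo : forall z, Lam^-1 * riesz_kernel s p z <= k z.
Hypothesis k_hi : forall z, k z <= Lam * riesz_kernel s p z.
Hypothesis k_sym : forall z, k (z.2, z.1) = k z.
Hypothesis Kk : {ae mm, forall z, K z.1 z.2 = k z}.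
Hypotheses (oOm : open Om) (oOm' : open Om') (bOm : bounded_set Om)
  (bOm' : bounded_set Om') (ccOm : compactly_contained Om Om').
Hypothesis mgb : measurable_fun setT gb.
Hypothesis ggb : {ae mu, forall x, g x = gb x}.
Hypothesis gtail : Rintegrable mu (fun y => `|gb y| `^ (p - 1) * tail_weight s p y).

Local Notation class := (obstacle_class s p Om Om' g h).
Local Notation form := (obstacle_form p K Om Om' g).
Local Notation wd := (wdiff p k Om Om').
Local Notation comp := (competitor p k Om Om').
Local Notation semi := (seminorm_density s p Om').

Let p0 : 0 < p. Proof. by rewrite (lt_trans _ p1). Qed.
Let mOm : measurable Om. Proof. exact: open_rV_measurable. Qed.
Let mOm' : measurable Om'. Proof. exact: open_rV_measurable. Qed.
Let OmOm' : Om `<=` Om'.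
Proof. by move=> x Ox; apply: ccOm.2; exact: subset_closure. Qed.

(** Equality with [gb] holds at every point outside [Om], not just almost everywhere, so that the
    difference of two representatives vanishes there, as competitors must. *)
Definition representative (w : Rn -> R) := [/\ measurable_fun setT w,
  forall x, ~ Om x -> w x = gb x, Rintegrable mu (fun x => \1_Om' x * `|w x| `^ p) &
  Rintegrable mm (semi w)].

Lemma class_representative u : class u ->
  exists2 w, representative w & {ae mu, forall x, u x = w x}.
Proof.
move=> [Wu _ ug]; have [w0 [mw0 uw0 _ _]] := Wsp_borel p1 oOm' Wu.
pose w x := \1_Om x * w0 x + \1_(~` Om) x * gb x.
have mw : measurable_fun setT w.
  by apply: measurable_funD; apply: measurable_funM => //; apply: measurable_indic => //; exact: measurableC.
have w_in x : Om x -> w x = w0 x.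
  by move=> Ox; rewrite /w !indicE mem_set// memNset ?mul0r ?mul1r ?addr0//; apply.
have w_out x : ~ Om x -> w x = gb x.
  by move=> Ox; rewrite /w !indicE memNset// mem_set// mul0r mul1r add0r.
have uw : {ae mu, forall x, u x = w x}.
  apply: filterS3 uw0 ug ggb => x h1 h2 h3.
  have [Ox|Ox] := pselect (Om x); first by rewrite w_in// h1//; exact: OmOm'.
  by rewrite w_out// h2.
have [] := (Wsp_norm_borel s p1 oOm' mw _).1 Wu.2; first by apply: filterS uw.
by move=> i1 i2; exists w.
Qed.

Lemma representative_class w u : representative w -> {ae mu, forall x, u x = w x} ->
  {ae mu, forall x, Om x -> (h x <= (w x)%:E)%E} -> class u.
Proof.
move=> [mw wO i1 i2] uw hw; split.
- by apply: (borel_Wsp p1 oOm' mw) => //; apply: filterS uw.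
- by apply: filterS2 uw hw => x ->.
- by apply: filterS2 uw ggb => x -> -> /wO.
Qed.

Lemma representative_local w : representative w ->
  Rintegrable mu (fun x => \1_Om x * `|w x| `^ p).
Proof.
move=> [mw wO i1 i2]; apply: Rintegrable_le i1 => [|x].
  by apply: measurable_funM; [exact: measurable_indic|exact: measurable_powR_norm].
rewrite ger0_norm ?mulr_ge0 ?powR_ge0// ler_wpM2r ?powR_ge0// !indicE.
by have [/set_mem/OmOm'/mem_set->//|_] := boolP (x \in Om); exact: ler0n.
Qed.

Lemma representative_tail w : representative w ->
  Rintegrable mu (fun y => `|w y| `^ (p - 1) * tail_weight s p y).
Proof.
move=> Rw; have [mw wO i1 i2] := Rw; have i3 := representative_local Rw.
apply: (@Rintegrable_le _ _ _ _ _ (fun y => (\1_Om y + \1_Om y * `|w y| `^ p) +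
   `|gb y| `^ (p - 1) * tail_weight s p y)).
- apply: measurable_funM; first exact: measurable_powR_norm.
  exact: measurable_tail_weight.
- move=> y; rewrite ger0_norm ?mulr_ge0 ?powR_ge0 ?tail_weight_ge0// indicE.
  have [/set_mem Oy|Oy] := boolP (y \in Om); last first.
    by rewrite mul0r !add0r wO//; move/mem_set; rewrite (negPf Oy).
  rewrite ler_wpDr ?mulr_ge0 ?powR_ge0 ?tail_weight_ge0//.
  rewrite mul1r [true%:R]mulr1n; apply: (@le_trans _ _ (`|w y| `^ (p - 1))).
    by rewrite ler_piMr ?powR_ge0// tail_weight_le1.
  have := young_crude p1 (normr_ge0 (w y)) ler01.
  by rewrite mulr1 powR1 [X in _ <= X -> _]addrC.
- apply: RintegrableD => //; apply: RintegrableD => //.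
  apply/Rintegrable_ge0P => //; rewrite integral_indic// setIT.
  exact: bounded_lebesgue_lty.
Qed.

Lemma seminorm_comb (f1 f2 : Rn -> R) c : measurable_fun setT f1 -> measurable_fun setT f2 ->
  Rintegrable mm (semi f1) -> Rintegrable mm (semi f2) -> Rintegrable mm (semi (fun x => f1 x + c * f2 x)).
Proof.
move=> m1 m2 i1 i2.
apply: (@Rintegrable_le _ _ _ _ _ (fun z => 2 `^ p * (semi f1 z + `|c| `^ p * semi f2 z))).
- by apply: measurable_seminorm_density => //; apply: measurable_funD => //; exact: measurable_funM.
- move=> z; rewrite ger0_norm ?seminorm_density_ge0// /seminorm_density.
  rewrite (_ : 2 `^ p * _ = \1_(Om' `*` Om') z * (riesz_kernel s p z *
    (2 `^ p * (`|f1 z.1 - f1 z.2| `^ p + `|c| `^ p * `|f2 z.1 - f2 z.2| `^ p)))); last by ring.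
  rewrite ler_wpM2l// ler_wpM2l ?riesz_kernel_ge0//.
  rewrite (_ : _ - _ = (f1 z.1 - f1 z.2) + c * (f2 z.1 - f2 z.2)); last by ring.
  by rewrite -powRM// -normrM; exact/powR_normD/ltW.
- by apply: RintegrableZ; apply: RintegrableD => //; exact: RintegrableZ.
Qed.

Lemma representativeB w1 w2 : representative w1 -> representative w2 -> comp (w2 \- w1).
Proof.
move=> [m1 o1 l1 h1] [m2 o2 l2 h2].
have e : w2 \- w1 = (fun x => w2 x + -1 * w1 x).
  by apply/funext => x; rewrite mulN1r.
have mB : measurable_fun setT (w2 \- w1) by exact: measurable_funB.
have vB : vanish_out Om (w2 \- w1) by move=> x Ox; rewrite /= o1// o2// subrr.
split => //.
apply: (seminorm_wdiff s0 p1 Lam0 mk k_lo k_hi) => //; last by rewrite e; exact: seminorm_comb.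
apply: (@Rintegrable_le _ _ _ _ _ (fun x => 2 `^ p * (\1_Om' x * `|w2 x| `^ p + \1_Om' x * `|w1 x| `^ p))).
- exact: measurable_powR_norm.
- move=> x; rewrite ger0_norm ?powR_ge0// indicE.
  have [_|Ox] := boolP (x \in Om').
    by rewrite !mul1r -(normrN (w1 x)); exact/powR_normD/ltW.
  rewrite vB ?normr0 ?powR0 ?gt_eqF//; last by move=> /OmOm'/mem_set; rewrite (negPf Ox).
- by apply: RintegrableZ; exact: RintegrableD.
Qed.

Lemma representativeD w f : representative w -> comp f -> representative (fun x => w x + f x).
Proof.
move=> [mw wO l1 l2] [mf vf i_f].
have [C C0 HC] := poincare_real n0 s0 p1 Lam0 mk k_lo oOm oOm' bOm bOm' ccOm.
have [fp _] := HC _ mf vf i_f.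
have sf := wdiff_seminorm p1 Lam0 k_lo oOm' mf i_f.
have mD : measurable_fun setT (fun x => w x + f x) by exact: measurable_funD.
split => //.
- by move=> x Ox; rewrite vf// addr0 wO.
- apply: (@Rintegrable_le _ _ _ _ _ (fun x => 2 `^ p * (\1_Om' x * `|w x| `^ p + `|f x| `^ p))).
  + by apply: measurable_funM; [exact: measurable_indic|exact: measurable_powR_norm].
  + move=> x; rewrite ger0_norm ?mulr_ge0 ?powR_ge0// indicE.
    have [_|Ox] := boolP (x \in Om'); last first.
      by rewrite !mul0r add0r mulr_ge0 ?powR_ge0.
    by rewrite !mul1r; exact/powR_normD/ltW.
  + by apply: RintegrableZ; exact: RintegrableD.
- have -> : (fun x => w x + f x) = (fun x => w x + 1 * f x).
    by apply/funext => x; rewrite mul1r.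
  exact: seminorm_comb.
Qed.

Lemma pairingE w psi z : dpow p (wd w z) * wd psi z =
  weight k Om Om' z * (dpow p (w z.1 - w z.2) * (psi z.1 - psi z.2)).
Proof. by rewrite dpow_homo ?wroot_ge0// (wrootK _ _ p1 Lam0 k_lo). Qed.

Lemma pairing_off w psi z : ~ (Om' `*` Om') z -> ~ (Om `*` ~` Om') z ->
  dpow p (wd w z) * wd psi z = 0.
Proof.
by move=> z1 z2; rewrite pairingE /weight !indicE !memNset// mulr0 addr0 mulr0 mul0r.
Qed.

Lemma pairing_split w psi : Rintegrable mm (fun z => dpow p (wd w z) * wd psi z) ->
  \int[mm]_z (dpow p (wd w z) * wd psi z) =
  \int[mm]_z (\1_(Om' `*` Om') z * (dpow p (wd w z) * wd psi z)) +
  \int[mm]_z (\1_(Om `*` ~` Om') z * (dpow p (wd w z) * wd psi z)).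
Proof.
move=> i; rewrite -rintD; last 2 first.
- by apply: Rintegrable_indicM => //; exact: measurableX.
- by apply: Rintegrable_indicM => //; apply: measurableX => //; exact: measurableC.
apply: eq_Rintegral => z _.
have [z1|z1] := pselect ((Om' `*` Om') z).
  rewrite !indicE mem_set// memNset ?mul1r ?mul0r ?addr0//.
  by move=> [_]; apply; exact: z1.2.
have [z2|z2] := pselect ((Om `*` ~` Om') z).
  by rewrite !indicE memNset// mem_set// mul0r mul1r add0r.
by rewrite (pairing_off _ _ z1 z2) !mulr0 addr0.
Qed.

(** On the first block the weight is the kernel. On the second it is twice the kernel, [psi] vanishes
    at the second point, and the boundary values agree with [w] there. *)
Lemma formE u w f psi : representative w -> {ae mu, forall x, u x = w x} ->
  comp psi -> {ae mu, forall x, f x = psi x} ->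
  Rintegrable mm (fun z => dpow p (wd w z) * wd psi z) ->
  (form u f = (\int[mm]_z (dpow p (wd w z) * wd psi z))%:E)%E.
Proof.
move=> [mw wO _ _] uw [_ vpsi _] fpsi i.
have mQ1 : measurable (Om' `*` Om') by exact: measurableX.
have mQ2 : measurable (Om `*` ~` Om') by apply: measurableX => //; exact: measurableC.
rewrite (pairing_split i) EFinD; congr (_ + _)%E.
  rewrite -rintE; last exact: Rintegrable_indicM.
  rewrite -integral_indicM; apply: ae_eq_integral_in.
  apply: filterS3 (filterI (ae_prod_fst uw) (ae_prod_snd uw))
    (filterI (ae_prod_fst fpsi) (ae_prod_snd fpsi)) Kk => z [u1 u2] [f1 f2] -> [z1 z2].
  by rewrite u1 u2 f1 f2 L_dpow pairingE weight_in//; congr EFin; rewrite [RHS]mulrC.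
rewrite (@ae_eq_integral_in _ _ _ _ _ _
  (fun z => (2^-1 * (dpow p (wd w z) * wd psi z))%:E)); last first.
  apply: filterS3 (filterI (ae_prod_fst uw) (ae_prod_snd ggb)) (ae_prod_fst fpsi) Kk
    => z [u1 g2] f1 -> [z1 z2].
  have nz2 : ~ Om z.2 by move=> /OmOm'.
  rewrite u1 g2 f1 -wO// L_dpow pairingE weight_out// (vpsi z.2)// subr0.
  by congr EFin; field.
rewrite integral_indicM.
under eq_integral do rewrite mulrCA.
rewrite rintE; last by apply: RintegrableZ; exact: Rintegrable_indicM.
rewrite rintZ; last exact: Rintegrable_indicM.
by rewrite -EFinM mulrA divff ?mul1r// pnatr_eq0.
Qed.

(** The integrand is symmetric in the two points and vanishes when both lie outside [Om]. Hence the
    blocks [Om * ~` Om'] and [~` Om' * Om] contribute equally, which the factor 2 in the weight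
    accounts for, and no other pair contributes outside [Om' * Om']. *)
Lemma pairing_whole u w eta : representative w -> {ae mu, forall x, u x = w x} ->
  vanish_out Om eta -> Rintegrable mm (fun z => dpow p (wd w z) * wd eta z) ->
  (\int[mm]_z (L p (u z.1) (u z.2) * (eta z.1 - eta z.2) * K z.1 z.2)%:E =
   (\int[mm]_z (dpow p (wd w z) * wd eta z))%:E)%E.
Proof.
move=> [mw wO _ _] uw veta i.
have mQ1 : measurable (Om' `*` Om') by exact: measurableX.
have mQ2 : measurable (Om `*` ~` Om') by apply: measurableX => //; exact: measurableC.
pose G z := dpow p (wd w z) * wd eta z.
pose F z := dpow p (w z.1 - w z.2) * (eta z.1 - eta z.2) * k z.
pose H z := \1_(Om `*` ~` Om') z * G z.
have iH : Rintegrable mm H by exact: Rintegrable_indicM.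
have [iH' eH'] := Rintegrable_swap iH.
have i1 : Rintegrable mm (fun z => \1_(Om' `*` Om') z * G z) by exact: Rintegrable_indicM.
have H_out z : ~ (Om `*` ~` Om') z -> H z = 0 by move=> nz; rewrite /H indicE memNset// mul0r.
have H_in z : (Om `*` ~` Om') z -> H z = 2 * F z.
  move=> zQ; rewrite /H indicE mem_set// mul1r /G pairingE.
  by move: zQ => [z1 z2]; rewrite weight_out// /F; ring.
have Fsym z : F (z.2, z.1) = F z.
  by rewrite /F /= k_sym -[w z.2 - _]opprB dpowN -[eta z.2 - _]opprB mulrNN.
have F0 z : ~ Om z.1 -> ~ Om z.2 -> F z = 0.
  by move=> z1 z2; rewrite /F !veta// subrr mulr0 mul0r.
have FE z : F z = \1_(Om' `*` Om') z * G z + 2^-1 * (H z + H (z.2, z.1)).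
  have [z1|z1] := pselect (Om' z.1); have [z2|z2] := pselect (Om' z.2).
  - rewrite !H_out; [|by move=> [_]; exact..].
    by rewrite addr0 mulr0 addr0 indicE mem_set// mul1r /G pairingE weight_in// /F mulrC.
  - rewrite indicE memNset; last by move=> [].
    rewrite mul0r add0r (H_out (z.2, z.1)) ?addr0; last by move=> [/= /OmOm'].
    have [Oz1|Oz1] := pselect (Om z.1); first by rewrite H_in// mulrA mulVf ?mul1r.
    rewrite F0//; last by move=> /OmOm'.
    by rewrite H_out ?mulr0//; move=> [].
  - rewrite indicE memNset; last by move=> [].
    rewrite mul0r add0r (H_out z) ?add0r; last by move=> [/OmOm'].
    have [Oz2|Oz2] := pselect (Om z.2).
      by rewrite H_in// Fsym mulrA mulVf ?mul1r.
    rewrite F0//; last by move=> /OmOm'.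
    by rewrite H_out ?mulr0//; move=> [].
  - rewrite F0; [|by move=> /OmOm'..].
    rewrite indicE memNset; last by move=> [].
    rewrite !H_out ?addr0 ?mulr0 ?mul0r ?addr0//; first by move=> [/= /OmOm'].
    by move=> [/OmOm'].
have iHH : Rintegrable mm (fun z => H z + H (z.2, z.1)) by exact: RintegrableD.
have iF : Rintegrable mm F by rewrite (funext FE); apply: RintegrableD => //; exact: RintegrableZ.
rewrite (@ae_eq_integral_any _ _ _ _ _ (fun z => (F z)%:E)); last first.
  apply: filterS3 (ae_prod_fst uw) (ae_prod_snd uw) Kk => z u1 u2 ->.
  by rewrite u1 u2 L_dpow.
rewrite rintE//; congr EFin; rewrite (pairing_split i).
rewrite (funext FE : F = _) rintD//; last exact: RintegrableZ.
rewrite rintZ// rintD// eH' -/G; congr (_ + _).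
have half (x : R) : 2^-1 * (x + x) = x by field.
exact: half.
Qed.

End obstacle.

(** * A Borel symmetric kernel with bounds everywhere *)

Lemma le_mean (R : realType) (a b c : R) : a <= b -> a <= c -> a <= 2^-1 * (c + b).
Proof. by move=> *; lra. Qed.

Lemma mean_le (R : realType) (a b c : R) : b <= a -> c <= a -> 2^-1 * (c + b) <= a.
Proof. by move=> *; lra. Qed.

Section kernel.
Context {R : realType} {n : nat}.
Local Notation Rn := 'rV[R]_n.
Local Notation mu := (@lebesgue_rV R n).
Local Notation mm := (mu \x mu)%E.
Local Notation en := (@euclidean_norm R n).
Variables (s p Lam : R) (K : Rn -> Rn -> R).
Local Notation k0 := (riesz_kernel s p).

Lemma riesz_kernel_sym (z : Rn * Rn) : k0 (z.2, z.1) = k0 z.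
Proof. by rewrite /riesz_kernel /= -(euclidean_normN (z.2 - z.1)) opprB. Qed.

(** Clamp a Borel version of [K] between the two bounds and symmetrise it; the bounds survive because
    they are symmetric. Points where the power of [|x - y|] vanishes would satisfy [Lam^-1 <= 0], so
    they already belong to the exceptional null set. *)
Lemma regular_kernel : 1 <= Lam ->
  completed_measurable_fun mm setT (fun z => K z.1 z.2) ->
  (forall x y, K x y = K y x) ->
  {ae mm, forall z, Lam^-1 <= K z.1 z.2 * en (z.1 - z.2) `^ (n%:R + s * p) <= Lam} ->
  exists k : Rn * Rn -> R, [/\ measurable_fun setT k,
    forall z, Lam^-1 * k0 z <= k z, forall z, k z <= Lam * k0 z,
    forall z, k (z.2, z.1) = k z & {ae mm, forall z, K z.1 z.2 = k z}].
Proof.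
move=> Lam1 /completed_measurable_funP[Kt mKt KKt] Ksym Kb.
have Lam0 : 0 < Lam by exact: lt_le_trans Lam1.
pose c z := Num.max (Lam^-1 * k0 z) (Num.min (Lam * k0 z) (Kt z)).
have mc : measurable_fun setT c.
  apply: measurable_maxr; first by apply: measurable_funM => //; exact: measurable_riesz_kernel.
  apply: measurable_minr => //.
  by apply: measurable_funM => //; exact: measurable_riesz_kernel.
have lohi z : Lam^-1 * k0 z <= Lam * k0 z.
  rewrite ler_wpM2r ?riesz_kernel_ge0// (le_trans _ Lam1)// invf_le1//.
have c_lo z : Lam^-1 * k0 z <= c z by rewrite le_max lexx.
have c_hi z : c z <= Lam * k0 z by rewrite ge_max lohi/= ge_min lexx.
have cK : {ae mm, forall z, K z.1 z.2 = c z}.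
  apply: filterS2 KKt Kb => z /(_ I) KKt /andP[lo hi].
  have e0 : 0 < en (z.1 - z.2) `^ (n%:R + s * p).
    rewrite lt_neqAle powR_ge0 andbT; apply/eqP => e0.
    by move: lo; rewrite -e0 mulr0 leNgt invr_gt0 Lam0.
  rewrite /c -KKt (min_idPr _).
    by apply/esym/max_idPr; rewrite /riesz_kernel ler_pdivrMr.
  by rewrite /riesz_kernel ler_pdivlMr.
exists (fun z => 2^-1 * (c z + c (z.2, z.1))); split.
- have mc' : measurable_fun setT (fun z => c (z.2, z.1)).
    by apply: (measurableT_comp mc); exact: measurable_swap_prod.
  exact: (measurable_funM (measurable_cst _) (measurable_funD mc mc')).
- by move=> z; have := c_lo z; have := c_lo (z.2, z.1); rewrite riesz_kernel_sym; exact: le_mean.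
- by move=> z; have := c_hi z; have := c_hi (z.2, z.1); rewrite riesz_kernel_sym; exact: mean_le.
- by move=> [x y]; exact: (congr1 (fun t => 2^-1 * t) (addrC _ _)).
- apply: filterS2 cK (ae_swap cK) => -[x y] /= h1.
  by rewrite Ksym h1 => <-; field.
Qed.

End kernel.

(** * Test functions have finite energy *)

Section test_functions.
Context {R : realType} {n : nat}.
Local Notation Rn := 'rV[R]_n.
Local Notation mu := (@lebesgue_rV R n).
Local Notation mm := (mu \x mu)%E.
Local Notation en := (@euclidean_norm R n).
Variables (s p : R) (Om Om' : set Rn) (eta : Rn -> R).
Hypotheses (n0 : (0 < n)%N) (s0 : 0 < s) (s1 : s < 1) (p1 : 1 < p).
Hypotheses (oOm : open Om) (oOm' : open Om') (bOm : bounded_set Om)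
  (bOm' : bounded_set Om').
Hypothesis teta : test_function Om eta.
Let p0 : 0 < p. Proof. by rewrite (lt_trans _ p1). Qed.
Let mOm : measurable Om. Proof. exact: open_rV_measurable. Qed.
Let mOm' : measurable Om'. Proof. exact: open_rV_measurable. Qed.

Lemma test_function_measurable : measurable_fun setT eta.
Proof. by apply: continuous_rV_measurable; have [] := teta.1 [::]. Qed.

Lemma test_function_vanish : vanish_out Om eta.
Proof.
move=> x Ox; apply/eqP/negPn/negP => ex; apply: Ox.
by apply: teta.2.2; exact: subset_closure.
Qed.

Lemma test_function_Lp : Rintegrable mu (fun x => `|eta x| `^ p).
Proof.
have [B B0 HB] := smooth_lipschitz teta.
(* a point off Om at bounded distance from Om turns the Lipschitz bound into a sup bound *)
have [A [mA AOm A1 [D D0 HD]]] := cube_away n0 bOm bOm.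
have [y Ay] : A !=set0.
  apply/set0P/eqP => A0; move: A1; rewrite A0 measure0 => /eqP.
  by rewrite eq_sym onee_eq0.
have ey : eta y = 0.
  by apply: test_function_vanish => Oy; have : (A `&` Om) y by []; rewrite AOm.
apply: (@Rintegrable_le _ _ _ _ _ (fun x => (B * D) `^ p * \1_Om x)).
- by apply: measurable_powR_norm; exact: test_function_measurable.
- move=> x; rewrite ger0_norm ?powR_ge0//.
  have [Ox|Ox] := pselect (Om x); last first.
    by rewrite test_function_vanish// normr0 powR0 ?gt_eqF// mulr_ge0 ?powR_ge0.
  rewrite indicE mem_set// mulr1 ge0_ler_powR ?nnegrE ?mulr_ge0 ?(ltW p0) ?(ltW D0)//.
  have := HB x y; rewrite ey subr0 => /le_trans; apply.
  by rewrite ler_wpM2l// HD.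
- apply: RintegrableZ; apply/Rintegrable_ge0P => //; rewrite integral_indic// setIT.
  exact: bounded_lebesgue_lty.
Qed.

Lemma riesz_lipschitz (r : R) : 0 <= r ->
  (r `^ (n%:R + s * p))^-1 * r `^ p <= r `^ (p * (1 - s)) / r `^ n%:R.
Proof.
rewrite le_eqVlt => /predU1P[<-|r0].
  by rewrite [0 `^ p]powR0 ?gt_eqF// mulr0 divr_ge0 ?powR_ge0.
rewrite -!powRN -!powRD; try by rewrite (gt_eqF r0) implybT.
by rewrite le_eqVlt; apply/orP; left; apply/eqP; congr (_ `^ _); ring.
Qed.

(** The Lipschitz bound leaves the kernel [|x - y|^(p (1 - s) - n)], whose integral over bounded sets is
    uniformly bounded since [s < 1]. *)
Lemma test_function_semi : Rintegrable mm (seminorm_density s p Om' eta).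
Proof.
have [B B0 HB] := smooth_lipschitz teta.
have [M M0 HM] := bounded_set_coord bOm'.
pose D : R := n%:R * (2 * M).
have D0 : 0 < D by rewrite mulr_gt0 ?ltr0n// mulr_gt0.
have HD x y : Om' x -> Om' y -> en (x - y) <= D.
  move=> Ox Oy; apply: euclidean_norm_le => [|i]; first by rewrite mulr_ge0// ltW.
  rewrite !mxE; apply: le_trans (ler_normB _ _) _.
  by have := HM _ Ox i; have := HM _ Oy i; lra.
have b0 : 0 < p * (1 - s) by rewrite mulr_gt0// subr_gt0.
have [C C0 HC] := singular_kernel_bound (n := n) b0 D0.
pose T (w : Rn) := en w `^ (p * (1 - s)) / en w `^ n%:R * \1_[set v | en v <= D] w.
have T0 w : 0 <= T w by rewrite mulr_ge0// divr_ge0 ?powR_ge0.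
have mT : measurable_fun setT T.
  apply: measurable_funM.
    apply: measurable_funM; first exact: (measurableT_comp (measurable_powR _) measurable_euclidean_norm).
    under eq_fun do rewrite -powRN.
    exact: (measurableT_comp (measurable_powR _) measurable_euclidean_norm).
  apply: measurable_indic.
  rewrite (_ : [set v | en v <= D] = setT `&` en @^-1` [set` `]-oo, D]]); last first.
    by rewrite setTI; apply/seteqP; split => v /=; rewrite in_itv.
  by apply: measurable_euclidean_norm => //; exact: measurable_itv.
pose G (z : Rn * Rn) := B `^ p * (\1_Om' z.2 * T (z.1 - z.2)).
have G0 z : 0 <= G z.
  by apply: mulr_ge0; [exact: powR_ge0|apply: mulr_ge0 => //; exact: T0].
have mG : measurable_fun setT G.
  apply: measurable_funM => //; apply: measurable_funM.
    by apply: (measurableT_comp _ measurable_snd); exact: measurable_indic.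
  exact: (measurableT_comp mT measurable_rVB).
have mS : measurable_fun setT (seminorm_density s p Om' eta).
  by apply: measurable_seminorm_density => //; exact: test_function_measurable.
apply: (@Rintegrable_le _ _ _ _ _ G) => //.
  move=> z; rewrite ger0_norm ?seminorm_density_ge0//.
  rewrite /seminorm_density indicE; have [/set_mem[z1 z2]|_] := boolP (z \in _); last by rewrite mul0r.
  rewrite mul1r /G indicE mem_set// mul1r /T indicE mem_set ?mulr1; last exact: HD.
  apply: (@le_trans _ _ (riesz_kernel s p z * (B * en (z.1 - z.2)) `^ p)).
    rewrite ler_wpM2l ?riesz_kernel_ge0//.
    by rewrite ge0_ler_powR ?nnegrE ?(ltW p0) ?mulr_ge0 ?euclidean_norm_ge0.
  rewrite powRM ?euclidean_norm_ge0// mulrCA ler_wpM2l ?powR_ge0//.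
  by apply: riesz_lipschitz; exact: euclidean_norm_ge0.
apply/Rintegrable_ge0P => //.
have mGE : measurable_fun setT (EFin \o G) by exact/measurable_EFinP.
rewrite (fubini_tonelli2 (EFin \o G))//=.
apply: (@le_lt_trans _ _ (\int[mu]_y (B `^ p * C * \1_Om' y)%:E)%E); last first.
  apply/Rintegrable_ge0P.
  - by apply: measurable_funM => //; exact: measurable_indic.
  - by move=> y; rewrite !mulr_ge0// powR_ge0.
  - apply: RintegrableZ; apply/Rintegrable_ge0P => //; rewrite integral_indic// setIT.
    exact: bounded_lebesgue_lty.
apply: ge0_le_integral => //.
- by move=> y _; apply: integral_ge0 => x _; rewrite lee_fin.
- apply: measurable_fun_fubini_tonelli_G => //.
- by apply/measurable_EFinP; apply: measurable_funM => //; exact: measurable_indic.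
move=> y _; rewrite /fubini_G /=.
rewrite (_ : (fun x => (G (x, y))%:E) = (fun x => (B `^ p * \1_Om' y)%:E * (T (x - y))%:E)%E); last first.
  by apply/funext => x; rewrite -EFinM /G /= mulrA.
have mTy : measurable_fun setT (fun x : Rn => (T (x - y))%:E).
  apply/measurable_EFinP; apply: (measurableT_comp mT).
  apply: measurable_fun_rVP => i; under eq_fun do rewrite !mxE.
  by apply: measurable_funB; [exact: measurable_coord|exact: measurable_cst].
rewrite ge0_integralZl//; last 2 first.
- by move=> x _; rewrite lee_fin.
- by rewrite lee_fin mulr_ge0 ?powR_ge0.
apply: (@le_trans _ _ ((B `^ p * \1_Om' y)%:E * C%:E)%E).
  by rewrite lee_wpmul2l ?HC// lee_fin mulr_ge0 ?powR_ge0.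
by rewrite -EFinM mulrAC.
Qed.

End test_functions.

(** * Existence, uniqueness and the supersolution property *)

Section conclusion.
Context {R : realType} {n : nat}.
Local Notation Rn := 'rV[R]_n.
Local Notation mu := (@lebesgue_rV R n).
Local Notation mm := (mu \x mu)%E.
Variables (s p Lam : R) (k : Rn * Rn -> R) (K : Rn -> Rn -> R) (Om Om' : set Rn).
Variables (g gb : Rn -> R) (h : Rn -> \bar R).
Hypotheses (n0 : (0 < n)%N) (s0 : 0 < s) (s1 : s < 1) (p1 : 1 < p) (Lam0 : 0 < Lam).
Hypothesis mk : measurable_fun setT k.
Hypothesis k_lo : forall z, Lam^-1 * riesz_kernel s p z <= k z.
Hypothesis k_hi : forall z, k z <= Lam * riesz_kernel s p z.
Hypothesis k_sym : forall z, k (z.2, z.1) = k z.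
Hypothesis Kk : {ae mm, forall z, K z.1 z.2 = k z}.
Hypotheses (oOm : open Om) (oOm' : open Om') (bOm : bounded_set Om)
  (bOm' : bounded_set Om') (ccOm : compactly_contained Om Om').
Hypothesis mgb : measurable_fun setT gb.
Hypothesis ggb : {ae mu, forall x, g x = gb x}.
Hypothesis gtail : Rintegrable mu (fun y => `|gb y| `^ (p - 1) * tail_weight s p y).

Local Notation class := (obstacle_class s p Om Om' g h).
Local Notation form := (obstacle_form p K Om Om' g).
Local Notation solution := (obstacle_solution s p K Om Om' g h).
Local Notation wd := (wdiff p k Om Om').
Local Notation comp := (competitor p k Om Om').
Local Notation rep := (representative s p Om Om' gb).

Lemma pairing_rep w f psi : rep w -> comp f -> comp psi ->
  Rintegrable mm (fun z => dpow p (wd w z + wd f z) * wd psi z).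
Proof.
move=> Rw Cf Cpsi; have [mw _ _ sw] := Rw.
apply: (pairing_Rintegrable n0 s0 p1 Lam0 mk k_lo k_hi) => //.
- exact: representative_local Rw.
- exact: representative_tail Rw.
Qed.

Lemma wdiffD (w f : Rn -> R) z : wd (fun x => w x + f x) z = wd w z + wd f z.
Proof. by rewrite /wdiff; ring. Qed.

Lemma formDE u v w f psi : rep w -> comp f -> comp psi ->
  {ae mu, forall x, u x = w x + f x} -> {ae mu, forall x, v x = u x + psi x} ->
  form u (v \- u) = (\int[mm]_z (dpow p (wd w z + wd f z) * wd psi z))%:E.
Proof.
move=> Rw Cf Cpsi uw vu.
have e : (fun z => dpow p (wd w z + wd f z) * wd psi z) =
    (fun z => dpow p (wd (fun x => w x + f x) z) * wd psi z).
  by apply/funext => z; rewrite wdiffD.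
rewrite e; apply: (formE p1 Lam0 k_lo Kk oOm oOm' ccOm ggb) => //.
- exact: (representativeD n0 s0 p1 Lam0 mk k_lo oOm oOm' bOm bOm' ccOm) => //.
- by apply: filterS vu => x /= ->; rewrite addrAC subrr add0r.
- by rewrite -e; exact: pairing_rep.
Qed.

(** Around a representative [w] of one member, members of the class are the functions [w + f] with [f]
    a competitor, and the form becomes the pairing of weighted differences; existence and uniqueness
    are then those of the minimising competitor. *)
Theorem obstacle_existence : (exists u, class u) ->
  exists2 u, solution u & forall v, solution v -> {ae mu, forall x, v x = u x}.
Proof.
move=> [u1 Cu1]; have [w Rw u1w] := class_representative p1 oOm oOm' ccOm mgb ggb Cu1.
have [mw _ _ sw] := Rw.
have lw := representative_local oOm ccOm Rw.
have tw := representative_tail s0 p1 oOm bOm ccOm gtail Rw.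
have hw : {ae mu, forall x, Om x -> (h x <= (w x)%:E)%E}.
  by have [_ hu _] := Cu1; apply: filterS2 u1w hu => x ->.
have [f [Cf hf] Hf] := competitor_minimizer n0 s0 p1 Lam0 mk k_lo k_hi
  oOm oOm' bOm bOm' ccOm mw lw sw tw hw.
have decomp v : class v -> exists2 f', comp f' & {ae mu, forall x, v x = w x + f' x}.
  move=> Cv; have [w' Rw' vw'] := class_representative p1 oOm oOm' ccOm mgb ggb Cv.
  exists (w' \- w); first exact: (representativeB s0 p1 Lam0 mk k_lo k_hi oOm oOm' bOm ccOm Rw Rw').
  by apply: filterS vw' => x -> /=; rewrite addrC subrK.
have obst v f' : class v -> {ae mu, forall x, v x = w x + f' x} ->
    {ae mu, forall x, Om x -> (h x <= (w x + f' x)%:E)%E}.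
  by move=> [_ hv _] vf; apply: filterS2 vf hv => x ->.
have formB v v' f1 f2 : comp f1 -> comp f2 ->
    {ae mu, forall x, v x = w x + f1 x} -> {ae mu, forall x, v' x = w x + f2 x} ->
    form v (v' \- v) = (\int[mm]_z (dpow p (wd w z + wd f1 z) * (wd f2 z - wd f1 z)))%:E.
  move=> C1 C2 e1 e2.
  rewrite (@formDE v v' w f1 (f2 \- f1))//; last 2 first.
  - exact: competitorB.
  - by apply: filterS2 e1 e2 => x -> ->; rewrite /=; ring.
  by congr EFin; apply: eq_Rintegral => z _; rewrite wdiffB.
pose u x := w x + f x.
have uE : {ae mu, forall x, u x = w x + f x} by exact: nearW.
have Su : solution u.
  split.
    have Ru := representativeD n0 s0 p1 Lam0 mk k_lo oOm oOm' bOm bOm' ccOm Rw Cf.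
    by apply: (representative_class p1 oOm' ggb Ru) => //; exact: nearW.
  move=> v Cv; have [f' Cf' vf'] := decomp v Cv.
  by rewrite (formB _ _ _ _ Cf Cf')// lee_fin; apply: Hf => //; exact: obst vf'.
exists u => // v [Cv Hv]; have [f' Cf' vf'] := decomp v Cv.
have h1 : 0 <= \int[mm]_z (dpow p (wd w z + wd f z) * (wd f' z - wd f z)).
  by rewrite -lee_fin -(formB u v)//; exact: Su.2.
have h2 : 0 <= \int[mm]_z (dpow p (wd w z + wd f' z) * (wd f z - wd f' z)).
  by rewrite -lee_fin -(formB v u)//; exact: Hv Su.1.
have ff' := competitor_unique n0 s0 p1 Lam0 mk k_lo k_hi oOm oOm' bOm bOm' ccOm
  mw lw sw tw Cf Cf' h1 h2.
by apply: filterS2 vf' ff' => x -> <-.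
Qed.

(** Adding a nonnegative test function to [u] keeps it above the obstacle and unchanged outside [Om]. *)
Theorem obstacle_supersolution u : solution u -> weak_supersolution s p K Om u.
Proof.
move=> [Cu Hu]; have [w Rw uw] := class_representative p1 oOm oOm' ccOm mgb ggb Cu.
have [mw _ _ _] := Rw.
have tw := representative_tail s0 p1 oOm bOm ccOm gtail Rw.
split.
- move=> V oV ccV; have [Wu _ _] := Cu.
  apply: (Wsp_sub p1 oOm' oV _ Wu) => x Vx.
  apply: ccOm.2; apply: subset_closure; apply: ccV.2; exact: subset_closure.
- exact/(tail_space_borel s0 p1 mw uw).
move=> eta teta eta0.
have meta := test_function_measurable teta.
have veta := test_function_vanish teta.
have Ceta : comp eta.
  split => //; apply: (seminorm_wdiff s0 p1 Lam0 mk k_lo k_hi) => //.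
    exact: test_function_Lp teta.
  exact: test_function_semi teta.
have C0 : comp (cst 0).
  rewrite (_ : cst 0 = eta \- eta); first exact: competitorB.
  by apply/funext => x; rewrite /= subrr.
have wd0 z : wd (cst 0) z = 0 by rewrite /wdiff subrr mulr0.
have i_eta : Rintegrable mm (fun z => dpow p (wd w z) * wd eta z).
  by have := pairing_rep Rw C0 Ceta; under eq_fun do rewrite wd0 addr0.
rewrite (pairing_whole p1 Lam0 k_lo k_sym Kk oOm oOm' ccOm Rw uw veta i_eta).
pose v x := w x + eta x.
have Rv := representativeD n0 s0 p1 Lam0 mk k_lo oOm oOm' bOm bOm' ccOm Rw Ceta.
have Cv : class v.
  apply: (representative_class p1 oOm' ggb Rv); first exact: nearW.
  have [_ hu _] := Cu; apply: filterS2 uw hu => x -> hx /hx /le_trans; apply.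
  by rewrite lee_fin lerDl.
have := Hu v Cv; rewrite (formDE Rw C0 Ceta).
- by under eq_Rintegral do rewrite wd0 addr0.
- by apply: filterS uw => x ->; rewrite addr0.
- by apply: filterS uw => x ->.
Qed.

End conclusion.

Theorem theorem1 (R : realType) (n : nat) (s p Lambda : R)
  (K : 'rV[R]_n -> 'rV[R]_n -> R)
  (Om Om' : set 'rV[R]_n) (h : 'rV[R]_n -> \bar R) (g : 'rV[R]_n -> R) :
  (0 < n)%N ->
  0 < s < 1 -> 1 < p -> 1 <= Lambda ->
  completed_measurable_fun (@lebesgue_rV R n \x @lebesgue_rV R n)%E setT
    (fun z => K z.1 z.2) ->
  (forall x y, 0 <= K x y) ->
  (forall x y, K x y = K y x) ->
  {ae (@lebesgue_rV R n \x @lebesgue_rV R n)%E, forall z,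
    Lambda^-1 <= K z.1 z.2 * euclidean_norm (z.1 - z.2) `^ (n%:R + s * p)
              <= Lambda} ->
  open Om -> open Om' -> bounded_set Om -> bounded_set Om' ->
  compactly_contained Om Om' ->
  (forall x, h x != +oo%E) ->
  Wsp s p Om' g -> tail_space s p g ->
  (exists u, obstacle_class s p Om Om' g h u) ->
  (exists u, obstacle_solution s p K Om Om' g h u /\
     forall w, obstacle_solution s p K Om Om' g h w ->
       {ae @lebesgue_rV R n, forall x, w x = u x}) /\
  (forall u, obstacle_solution s p K Om Om' g h u ->
     weak_supersolution s p K Om u).
Proof.
move=> n0 /andP[s0 s1] p1 Lam1 mK _ Ksym Kb oOm oOm' bOm bOm' ccOm _ _ tg ex.
have Lam0 : 0 < Lambda by exact: lt_le_trans Lam1.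
have [k [mk k_lo k_hi k_sym Kk]] := regular_kernel Lam1 mK Ksym Kb.
have [mg _ _] := tg; have [gb mgb ggb'] := completed_measurable_funP mg.
have ggb : {ae @lebesgue_rV R n, forall x, g x = gb x}.
  by apply: filterS ggb' => x; apply.
have gtail := (tail_space_borel s0 p1 mgb ggb).1 tg.
split=> [|u Su].
  have [u Su uniq] := obstacle_existence n0 s0 p1 Lam0 mk k_lo k_hi Kk oOm oOm'
    bOm bOm' ccOm mgb ggb gtail ex.
  by exists u.
exact: (obstacle_supersolution n0 s0 s1 p1 Lam0 mk k_lo k_hi k_sym Kk oOm oOm'
  bOm bOm' ccOm mgb ggb gtail Su).
Qed.
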